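(* Let $k$ be a totally real number field with ring of integers $\mathcal{O}_k$, let $\Gamma=SL_2(\mathcal{O}_k)$, $G=PSL_2(\mathcal{O}_k)$ and let $p:\Gamma\to G$ be the canonical projection. Let $I$ be a complete set of representatives of conjugacy classes of maximal infinite cyclic subgroups of $G$, and let $\mathcal{I}$ be defined by taking, for each $H\in I$, an infinite cyclic subgroup $C$ of $\Gamma$ such that $p(C)=H$. For every $C\in\mathcal{I}$, choose models for $\underline{E}N_\Gamma(C)$ and $\underline{E}W_\Gamma(C)$, where $W_\Gamma(C)=N_\Gamma(C)/C$, and choose a model for $\underline{E}\Gamma$. Consider the $\Gamma$-pushout $$\begin{array}{ccc}\coprod_{C\in\mathcal{I}}\Gamma\times_{N_\Gamma(C)}\underline{E}N_\Gamma(C)&\xrightarrow{\ i\ }&\underline{E}\Gamma\\ \Big\downarrow{\scriptstyle\coprod_{C\in\mathcal{I}}\mathrm{Id}_\Gamma\times_{N_\Gamma(C)}f_C}&&\Big\downarrow\\ \coprod_{C\in\mathcal{I}}\Gamma\times_{N_\Gamma(C)}\underline{E}W_\Gamma(C)&\longrightarrow&X\end{array}$$ where $\underline{E}W_\Gamma(C)$ is viewed as an $N_\Gamma(C)$-CW-complex by restricting along the projection $N_\Gamma(C)\to W_\Gamma(C)$, and the maps starting from the upper left corner are cellular and one of them is an inclusion of $\Gamma$-CW-complexes. Then $X$ is a model for $\underline{\underline{E}}\Gamma$.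
   Context: A totally real number field is a finite extension $k$ of $\mathbb{Q}$ all of whose embeddings in $\mathbb{C}$ have image in $\mathbb{R}$; $PSL_2(\mathcal{O}_k)=SL_2(\mathcal{O}_k)/\{\pm I\}$. For a discrete group $\Gamma$ and a family $\mathcal{A}$ of subgroups (closed under conjugation and subgroups), a model for $E_{\mathcal{A}}\Gamma$ is a $\Gamma$-CW-complex whose isotropy groups all belong to $\mathcal{A}$ and whose $H$-fixed point set is contractible for every $H\in\mathcal{A}$. $\underline{E}\Gamma$ is $E_{\mathcal{A}}\Gamma$ for $\mathcal{A}$ the finite subgroups, and $\underline{\underline{E}}\Gamma$ is $E_{\mathcal{A}}\Gamma$ for $\mathcal{A}$ the virtually cyclic subgroups (those having a possibly finite cyclic subgroup of finite index). $N_\Gamma(C)$ is the normalizer of $C$ in $\Gamma$. Here $i$ is a $\Gamma$-map and $f_C:\underline{E}N_\Gamma(C)\to\underline{E}W_\Gamma(C)$ is an $N_\Gamma(C)$-map (each unique up to equivariant homotopy). *)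

(* Defs.v *)
From HB Require Import structures.
From mathcomp Require Import all_boot all_order all_algebra all_field.
From mathcomp Require Import complex.
From mathcomp Require Import all_classical all_reals topology normedtype.

Set Implicit Arguments.
Unset Strict Implicit.
Unset Printing Implicit Defensive.

Import Order.TTheory GRing.Theory Num.Theory.
Import numFieldNormedType.Exports.

Local Open Scope classical_set_scope.
Local Open Scope group_scope.

Record subgroup (G : groupType) := Subgroup {
  sg_set :> set G;
  sg1 : sg_set 1;
  sgM : forall x y, sg_set x -> sg_set y -> sg_set (x * y);
  sgV : forall x, sg_set x -> sg_set x^-1 }.

HB.instance Definition _ (G : groupType) := gen_eqMixin (subgroup G).
HB.instance Definition _ (G : groupType) := gen_choiceMixin (subgroup G).

Definition sg_type (G : groupType) (H : subgroup G) : Type :=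
  {x : G | x \in (H : set G)}.

Section SubgroupType.
Variables (G : groupType) (H : subgroup G).

HB.instance Definition _ := [isSub of sg_type H for @sval G _].
HB.instance Definition _ := [Choice of sg_type H by <:].

Fact sg_closed : group_closed (fun x : G => x \in (H : set G)).
Proof.
split=> [|x y]; first exact/mem_set/sg1.
move=> /set_mem Hx /set_mem Hy; apply/mem_set/sgM => //; exact: sgV.
Qed.

HB.instance Definition _ :=
  SubChoice_isSubGroup.Build G (fun x => x \in (H : set G)) (sg_type H)
    sg_closed.

End SubgroupType.

Section Cosets.
Variables (G : groupType) (H : subgroup G).

Definition coset_rel (x y : G) : bool := `[< sg_set H (x^-1 * y) >].

Fact coset_rel_refl : reflexive coset_rel.
Proof. by move=> x; apply/asboolP; rewrite mulVg; exact: sg1. Qed.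

Fact coset_rel_sym : symmetric coset_rel.
Proof.
move=> x y; apply/asboolP/asboolP => /sgV; by rewrite invgM invgK.
Qed.

Fact coset_rel_trans : transitive coset_rel.
Proof.
move=> y x z /asboolP xy /asboolP yz; apply/asboolP.
by have := sgM xy yz; rewrite -mulgA mulVKg.
Qed.

Definition coset_equiv :=
  EquivRel coset_rel coset_rel_refl coset_rel_sym coset_rel_trans.

Definition lcosets := {eq_quot coset_equiv}%qT.

HB.instance Definition _ := Quotient.on lcosets.
HB.instance Definition _ := Choice.on lcosets.

Definition coset_of (x : G) : lcosets := \pi_lcosets%qT x.

Lemma coset_ofP x y : coset_of x = coset_of y <-> sg_set H (x^-1 * y).
Proof.
split=> [/eqmodP/asboolP //|h]; exact/eqmodP/asboolP.
Qed.

Lemma coset_of_repr (q : lcosets) : coset_of (repr q) = q.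
Proof. exact: reprK. Qed.

Lemma repr_coset_of x : sg_set H (x^-1 * repr (coset_of x)).
Proof. by apply/coset_ofP; rewrite coset_of_repr. Qed.

End Cosets.

Record nsubgroup (G : groupType) := NSubgroup {
  nsg_sub :> subgroup G;
  nsgJ : forall x y, sg_set nsg_sub x -> sg_set nsg_sub (x ^ y) }.

Definition quot (G : groupType) (N : nsubgroup G) : Type := lcosets N.

Section QuotientGroup.
Variables (G : groupType) (N : nsubgroup G).

HB.instance Definition _ := Choice.on (quot N).

Definition quot_proj (x : G) : quot N := coset_of N x.
Definition quot_mul (a b : quot N) : quot N := quot_proj (repr a * repr b).
Definition quot_inv (a : quot N) : quot N := quot_proj (repr a)^-1.

Lemma quot_projP x y : quot_proj x = quot_proj y <-> sg_set N (x^-1 * y).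
Proof. exact: coset_ofP. Qed.

Lemma quot_mulE x y : quot_mul (quot_proj x) (quot_proj y) = quot_proj (x * y).
Proof.
apply/esym/quot_projP.
have hx := repr_coset_of N x; have hy := repr_coset_of N y.
have := sgM (nsgJ y hx) hy; rewrite /conjg invgM.
by rewrite !mulgA -(mulgA _ y y^-1) mulgV mulg1 -!mulgA.
Qed.

Lemma quot_invE x : quot_inv (quot_proj x) = quot_proj x^-1.
Proof.
apply/quot_projP; have hx := repr_coset_of N x.
have := nsgJ x^-1 hx; rewrite /conjg !invgK => h.
have : sg_set N (repr (coset_of N x) * x^-1) by move: h; rewrite !mulgA mulgV mul1g.
by [].
Qed.

Lemma quot_ind (P : quot N -> Prop) : (forall x, P (quot_proj x)) -> forall q, P q.
Proof. by move=> h q; rewrite -(coset_of_repr q); exact: h. Qed.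

Fact quot_mulA : associative quot_mul.
Proof.
by elim/quot_ind => x; elim/quot_ind => y; elim/quot_ind => z;
  rewrite !quot_mulE mulgA.
Qed.

Fact quot_mul1 : left_id (quot_proj 1) quot_mul.
Proof. by elim/quot_ind => x; rewrite quot_mulE mul1g. Qed.

Fact quot_1mul : right_id (quot_proj 1) quot_mul.
Proof. by elim/quot_ind => x; rewrite quot_mulE mulg1. Qed.

Fact quot_mulV : left_inverse (quot_proj 1) quot_inv quot_mul.
Proof. by elim/quot_ind => x; rewrite quot_invE quot_mulE mulVg. Qed.

Fact quot_Vmul : right_inverse (quot_proj 1) quot_inv quot_mul.
Proof. by elim/quot_ind => x; rewrite quot_invE quot_mulE mulgV. Qed.

HB.instance Definition _ :=
  isGroup.Build (quot N) quot_mulA quot_mul1 quot_1mul quot_mulV quot_Vmul.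

Fact quot_proj_morph : monoid.monoid_morphism quot_proj.
Proof. by split=> // x y; rewrite -quot_mulE. Qed.

HB.instance Definition _ :=
  isUMagmaMorphism.Build G (quot N) quot_proj quot_proj_morph.

End QuotientGroup.

Section SubgroupNotions.
Variable G : groupType.
Implicit Types (H K C : subgroup G) (A : set G).

Definition conj_set A (g : G) : set G := [set a ^ g | a in A].

Lemma conj_setM A g h : conj_set A (g * h) = conj_set (conj_set A g) h.
Proof.
apply/seteqP; split=> [_ [a Aa <-]|_ [_ [a Aa <-] <-]].
  by exists (a ^ g); [exists a|rewrite conjgM].
by exists a => //; rewrite conjgM.
Qed.

Lemma conj_set1 A : conj_set A 1 = A.
Proof.
apply/seteqP; split=> [_ [a Aa <-]|a Aa]; first by rewrite conjg1.
by exists a => //; rewrite conjg1.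
Qed.

Definition normalizer_set A : set G := [set g | conj_set A g = A].

Program Definition normalizer A : subgroup G :=
  @Subgroup G (normalizer_set A) _ _ _.
Next Obligation. exact: conj_set1. Qed.
Next Obligation.
by move=> A x y; rewrite /normalizer_set /= conj_setM => -> ->.
Qed.
Next Obligation.
move=> A x; rewrite /normalizer_set /= => h.
by rewrite -{1}h -conj_setM mulgV conj_set1.
Qed.

Definition powers (x : G) : set G :=
  [set y | exists n : nat, y = x ^+ n \/ y = x ^- n].

Definition cyclic H := exists x, (H : set G) = powers x.

Definition infinite_cyclic H := cyclic H /\ infinite_set H.

Definition maximal_infinite_cyclic H :=
  infinite_cyclic H /\ forall K, infinite_cyclic K -> H `<=` K -> K `<=` H.

Definition conjugate H K := exists g, (K : set G) = conj_set H g.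

Definition conj_representatives (P I : set (subgroup G)) :=
  I `<=` P /\ forall K, P K -> exists! H, I H /\ conjugate H K.

Definition finite_index C H :=
  C `<=` H /\ finite_set [set coset_of C x | x in H].

Definition finite_subgroups : set (subgroup G) := [set H | finite_set H].

Definition virtually_cyclic_subgroups : set (subgroup G) :=
  [set H | exists C, cyclic C /\ finite_index C H].

End SubgroupNotions.

Program Definition sub_normalizer (G : groupType) (C : subgroup G) :
    nsubgroup (sg_type (normalizer C)) :=
  @NSubgroup _ (@Subgroup _ [set x : sg_type (normalizer C) | sg_set C (val x)] _ _ _) _.
Next Obligation. by move=> G C; exact: (sg1 C). Qed.
Next Obligation. by move=> G C x y /= Cx Cy; exact: (sgM Cx Cy). Qed.
Next Obligation. by move=> G C x /= Cx; exact: (sgV Cx). Qed.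
Next Obligation.
move=> G C x y /= Cx; have /set_mem /= yN := valP y.
have : conj_set C (val y) (val x ^ val y) by exists (val x).
by rewrite [conj_set C _]yN.
Qed.

Definition weyl (G : groupType) (C : subgroup G) : groupType :=
  quot (sub_normalizer C).
Definition weyl_proj (G : groupType) (C : subgroup G) :
  UMagmaMorphism.type (sg_type (normalizer C)) (weyl C) :=
  @quot_proj _ (sub_normalizer C).

Section RingOfIntegers.
Variable k : fieldType.

Definition ring_of_integers : Type :=
  {x : k | `[< integralOver (intr : int -> k) x >]}.

HB.instance Definition _ := [isSub of ring_of_integers for @sval k _].
HB.instance Definition _ := [Choice of ring_of_integers by <:].

Fact ring_of_integers_closed :
  subring_closed (fun x : k => `[< integralOver (intr : int -> k) x >]).
Proof.
split=> [|x y /asboolP hx /asboolP hy|x y /asboolP hx /asboolP hy];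
  apply/asboolP.
- exact: integral1.
- exact: integral_sub.
- exact: integral_mul.
Qed.

HB.instance Definition _ :=
  GRing.SubChoice_isSubComNzRing.Build k
    (fun x : k => `[< integralOver (intr : int -> k) x >]) ring_of_integers
    ring_of_integers_closed.

End RingOfIntegers.

Definition totally_real (R : realType) (k : fieldExtType rat) :=
  forall (sigma : {rmorphism k -> R[i]}) (x : k),
    exists r : R, sigma x = (r%:C)%C.

Section SL2.
Local Open Scope ring_scope.
Variable A : comNzRingType.

Definition SL2 : Type := {M : 'M[A]_2 | \det M == 1}.

HB.instance Definition _ := [isSub of SL2 for @sval 'M[A]_2 _].
HB.instance Definition _ := [Choice of SL2 by <:].

Fact SL2_mul_subproof (M N : SL2) : \det (val M *m val N) == 1.
Proof. by rewrite det_mulmx (eqP (valP M)) (eqP (valP N)) mulr1. Qed.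

Fact SL2_one_subproof : \det (1%:M : 'M[A]_2) == 1.
Proof. by rewrite det1. Qed.

Fact SL2_inv_subproof (M : SL2) : \det (\adj (val M)) == 1.
Proof.
have := congr1 determinant (mul_mx_adj (val M)).
by rewrite det_mulmx (eqP (valP M)) mul1r det1 => ->.
Qed.

Definition SL2_mul (M N : SL2) : SL2 := exist (fun M => \det M == 1) _ (SL2_mul_subproof M N).
Definition SL2_one : SL2 := exist (fun M => \det M == 1) _ SL2_one_subproof.
Definition SL2_inv (M : SL2) : SL2 := exist (fun M => \det M == 1) _ (SL2_inv_subproof M).

Fact SL2_mulA : associative SL2_mul.
Proof. by move=> x y z; apply: val_inj; rewrite /= mulmxA. Qed.

Fact SL2_mul1 : left_id SL2_one SL2_mul.
Proof. by move=> x; apply: val_inj; rewrite /= mul1mx. Qed.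

Fact SL2_1mul : right_id SL2_one SL2_mul.
Proof. by move=> x; apply: val_inj; rewrite /= mulmx1. Qed.

Fact SL2_mulV : left_inverse SL2_one SL2_inv SL2_mul.
Proof.
by move=> x; apply: val_inj; rewrite /= mul_adj_mx (eqP (valP x)).
Qed.

Fact SL2_Vmul : right_inverse SL2_one SL2_inv SL2_mul.
Proof.
by move=> x; apply: val_inj; rewrite /= mul_mx_adj (eqP (valP x)).
Qed.

HB.instance Definition _ :=
  isGroup.Build SL2 SL2_mulA SL2_mul1 SL2_1mul SL2_mulV SL2_Vmul.

Definition pm_id : set SL2 := [set M | val M = 1%:M \/ val M = - 1%:M].

Fact pm_id1 : pm_id 1%g.
Proof. by left. Qed.

Lemma val_SL2M (x y : SL2) : val (x * y)%g = val x *m val y.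
Proof. by []. Qed.

Lemma val_SL2V (x : SL2) : val x^-1%g = \adj (val x).
Proof. by []. Qed.

Fact pm_idM (x y : SL2) : pm_id x -> pm_id y -> pm_id (x * y)%g.
Proof.
by move=> [] hx [] hy; [left|right|right|left];
  rewrite val_SL2M hx hy ?mulNmx mul1mx ?opprK.
Qed.

Fact pm_idJ (x y : SL2) : pm_id x -> pm_id (x ^ y)%g.
Proof.
by move=> [] hx; [left|right]; rewrite /conjg !val_SL2M val_SL2V hx
  ?mulNmx mul1mx ?mulmxN mul_adj_mx (eqP (valP y)).
Qed.

Fact pm_idV (x : SL2) : pm_id x -> pm_id x^-1%g.
Proof.
have h := mul_adj_mx (val x); rewrite (eqP (valP x)) in h.
move=> [] e; rewrite e ?mulmxN mulmx1 in h.
  by left; rewrite val_SL2V e.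
by right; rewrite val_SL2V e; apply: oppr_inj; rewrite h opprK.
Qed.

Definition pm_id_nsubgroup : nsubgroup SL2 :=
  @NSubgroup SL2 (Subgroup pm_id1 pm_idM pm_idV) pm_idJ.

Definition PSL2 : groupType := quot pm_id_nsubgroup.
Definition PSL2_proj : SL2 -> PSL2 := @quot_proj _ pm_id_nsubgroup.

End SL2.

Record gspace (G : groupType) := GSpace {
  gs_space :> topologicalType;
  gact : G -> gs_space -> gs_space;
  gact_cont : forall g, continuous (gact g);
  gact1 : forall x, gact 1 x = x;
  gactM : forall g h x, gact (g * h) x = gact g (gact h x) }.

Record gsubset (G : groupType) (X : gspace G) := GSubset {
  gs_set :> set X;
  gs_setP : forall g x, gs_set x -> gs_set (gact g x) }.

Lemma discrete_continuous (T : discreteTopologicalType) (U : topologicalType)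
  (f : T -> U) : continuous f.
Proof.
by move=> x V Vf; apply: filterS (discrete_set1 x) => y ->;
  exact: nbhs_singleton Vf.
Qed.

Lemma pair_continuous (S T U : topologicalType) (f : S -> T) (g : S -> U) :
  continuous f -> continuous g -> continuous (fun x => (f x, g x)).
Proof. by move=> cf cg x; apply: cvg_pair; [exact: cf|exact: cg]. Qed.

Section GSpaces.
Variable G : groupType.
Implicit Types X Y Z : gspace G.

Definition equivariant X Y (f : X -> Y) :=
  forall g x, f (gact g x) = gact g (f x).

Definition gmap X Y (f : X -> Y) := continuous f /\ equivariant f.

(* Pushouts in the category of G-spaces, for the square
     A --f--> B
     |g       |u
     C --v--> D *)
Definition gpushout (A B C D : gspace G)
    (f : A -> B) (g : A -> C) (u : B -> D) (v : C -> D) :=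
  [/\ gmap f /\ gmap g, gmap u /\ gmap v, u \o f = v \o g &
    forall (Y : gspace G) (b : B -> Y) (c : C -> Y),
      gmap b -> gmap c -> b \o f = c \o g ->
      exists! h : D -> Y, [/\ gmap h, h \o u = b & h \o v = c]].

Section Subspace.
Variables (X : gspace G) (S : gsubset X).

Definition sub_act (g : G) (x : set_type S) : set_type S :=
  SigSub (mem_set (gs_setP g (set_mem (valP x)))).

Fact sub_act_cont g : continuous (sub_act g).
Proof.
apply: continuous_comp_initial => x.
apply: (@continuous_comp _ _ _ (set_val : set_type S -> X) (gact g)).
  exact: initial_continuous.
exact: gact_cont.
Qed.

Fact sub_act1 x : sub_act 1 x = x.
Proof. by apply: val_inj; rewrite /= gact1. Qed.

Fact sub_actM g h x : sub_act (g * h) x = sub_act g (sub_act h x).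
Proof. by apply: val_inj; rewrite /= gactM. Qed.

Definition sub_gspace : gspace G :=
  @GSpace G (set_type S) sub_act sub_act_cont sub_act1 sub_actM.

End Subspace.

Section Coproduct.
Variables (I : choiceType) (X : I -> gspace G).

Definition coprod_act (g : G) (p : {i : I & X i}) : {i : I & X i} :=
  existT (fun i => X i : Type) (projT1 p) (gact g (projT2 p)).

Fact coprod_act_cont g : continuous (coprod_act g).
Proof.
apply: (@sigT_continuous _ _ _
  (fun i x => existT (fun i => X i : Type) i (gact g x))) => i x.
by apply: continuous_comp; [exact: gact_cont|exact: existT_continuous].
Qed.

Fact coprod_act1 p : coprod_act 1 p = p.
Proof. by case: p => i x; rewrite /coprod_act /= gact1. Qed.

Fact coprod_actM g h p : coprod_act (g * h) p = coprod_act g (coprod_act h p).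
Proof. by rewrite /coprod_act /= gactM. Qed.

Definition coprod_gspace : gspace G :=
  @GSpace G {i : I & X i} coprod_act coprod_act_cont coprod_act1 coprod_actM.

End Coproduct.

Definition coprod_map (I : choiceType) (X Y : I -> gspace G)
    (f : forall i, X i -> Y i) (p : coprod_gspace X) : coprod_gspace Y :=
  existT (fun i => Y i : Type) (projT1 p) (f (projT1 p) (projT2 p)).

(* G/H x D, with G/H discrete and G acting trivially on D *)
Section OrbitProduct.
Variables (H : subgroup G) (D : topologicalType).

Definition orbit_act (g : G) (p : discrete_topology (lcosets H) * D) :
    discrete_topology (lcosets H) * D :=
  (coset_of H (g * repr (p.1 : lcosets H)), p.2).

Lemma orbit_actE g x d :
  orbit_act g (coset_of H x, d) = (coset_of H (g * x), d).
Proof.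
congr pair; apply/esym/coset_ofP => /=.
by rewrite invgM -mulgA mulKg; exact: repr_coset_of.
Qed.

Fact orbit_act_cont g : continuous (orbit_act g).
Proof.
apply: pair_continuous => p; last exact: cvg_snd.
apply: (@continuous_comp _ (discrete_topology (lcosets H)) _ fst
  (fun q => coset_of H (g * repr (q : lcosets H)) :
            discrete_topology (lcosets H))); first exact: cvg_fst.
exact: discrete_continuous.
Qed.

Fact orbit_act1 p : orbit_act 1 p = p.
Proof.
by case: p => q d; rewrite -(coset_of_repr q) orbit_actE mul1g.
Qed.

Fact orbit_actM g h p : orbit_act (g * h) p = orbit_act g (orbit_act h p).
Proof.
case: p => q d; rewrite -(coset_of_repr q) (orbit_actE h) (orbit_actE g).
by rewrite orbit_actE mulgA.
Qed.

Definition orbit_gspace : gspace G :=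
  @GSpace G (discrete_topology (lcosets H) * D)%type
    orbit_act orbit_act_cont orbit_act1 orbit_actM.

End OrbitProduct.

Definition stabilizer_set X (x : X) : set G := [set g | gact g x = x].

Program Definition stabilizer X (x : X) : subgroup G :=
  @Subgroup G (stabilizer_set x) _ _ _.
Next Obligation. by move=> X x; exact: gact1. Qed.
Next Obligation.
by move=> X x g h; rewrite /stabilizer_set /= gactM => gx ->.
Qed.
Next Obligation.
by move=> X x g; rewrite /stabilizer_set /= => {1}<-; rewrite -gactM mulVg gact1.
Qed.

Definition fixed_points X (H : set G) : set X :=
  [set x | forall h, H h -> gact h x = x].

End GSpaces.

Arguments fixed_points {G} X H.

Section Restriction.
Variables (N W : groupType) (phi : UMagmaMorphism.type N W) (X : gspace W).

Definition res_act (n : N) : X -> X := gact (phi n).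

Fact res_act_cont n : continuous (res_act n).
Proof. exact: gact_cont. Qed.

Fact res_act1 x : res_act 1 x = x.
Proof. by rewrite /res_act gmulf1 gact1. Qed.

Fact res_actM g h x : res_act (g * h) x = res_act g (res_act h x).
Proof. by rewrite /res_act gmulfM gactM. Qed.

Definition res_gspace : gspace N :=
  @GSpace N X res_act res_act_cont res_act1 res_actM.

Definition res_gsubset (S : gsubset X) : gsubset res_gspace :=
  @GSubset N res_gspace S (fun n => @gs_setP W X S (phi n)).

End Restriction.

(* G x_N Y: the quotient of G x Y (G discrete) by (g n, y) ~ (g, n y) *)
Section Induction.
Variables (G : groupType) (N : subgroup G) (Y : gspace (sg_type N)).

Definition ind_pre : topologicalType := (discrete_topology G * Y)%type.

Definition ind_rel (p q : ind_pre) : bool :=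
  `[< exists n : sg_type N, (p.1 : G) = (q.1 : G) * val n /\ q.2 = gact n p.2 >].

Fact ind_rel_refl : reflexive ind_rel.
Proof.
move=> [g y]; apply/asboolP; exists 1 => /=.
by rewrite gact1; split=> //; exact/esym/mulg1.
Qed.

Fact ind_rel_sym : symmetric ind_rel.
Proof.
have h : forall p q, ind_rel p q -> ind_rel q p.
  move=> [g y] [g' y'] /asboolP[n [/= gE yE]]; apply/asboolP.
  exists n^-1 => /=; split; last by rewrite yE -gactM mulVg gact1.
  have := esym gE; exact: (canRL (mulgK (val n))).
by move=> p q; apply/idP/idP; exact: h.
Qed.

Fact ind_rel_trans : transitive ind_rel.
Proof.
move=> [g y] [g' y'] [g'' y''] /asboolP[n [/= gE yE]] /asboolP[m [/= hE zE]].
apply/asboolP; exists (m * n) => /=; split; last by rewrite zE yE gactM.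
by rewrite gE hE -mulgA.
Qed.

Definition ind_equiv := EquivRel ind_rel ind_rel_refl ind_rel_sym ind_rel_trans.

Definition ind := {eq_quot ind_equiv}%qT.

HB.instance Definition _ := Topological.copy ind (quotient_topology ind).
HB.instance Definition _ := Quotient.on ind.

Definition ind_mk (g : G) (y : Y) : ind := \pi_ind%qT ((g, y) : ind_pre).

Lemma ind_mkP g y g' y' : ind_mk g y = ind_mk g' y' <->
  exists n : sg_type N, g = g' * val n /\ y' = gact n y.
Proof. by split=> [/eqmodP/asboolP //|h]; exact/eqmodP/asboolP. Qed.

Lemma ind_mk_repr (q : ind) : ind_mk (repr q).1 (repr q).2 = q.
Proof. by rewrite /ind_mk -surjective_pairing reprK. Qed.

Definition ind_act (g : G) (q : ind) : ind := ind_mk (g * (repr q).1) (repr q).2.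

Lemma ind_actE g h y : ind_act g (ind_mk h y) = ind_mk (g * h) y.
Proof.
have /ind_mkP[n [E1 E2]] := ind_mk_repr (ind_mk h y).
by apply/ind_mkP; exists n; rewrite -mulgA -E1.
Qed.

Fact ind_act_cont g : continuous (ind_act g).
Proof.
apply/quotient_continuous.
have -> : ind_act g \o \pi_ind%qT =
    \pi_ind%qT \o (fun p : ind_pre => (g * (p.1 : G), p.2) : ind_pre).
  by apply/funext => -[h y]; exact: ind_actE.
move=> p; apply: continuous_comp; last exact: pi_continuous.
move: p; apply: pair_continuous => p; last exact: cvg_snd.
apply: (@continuous_comp _ (discrete_topology G) _ fst
  (fun h => g * (h : G) : discrete_topology G)); first exact: cvg_fst.
exact: discrete_continuous.
Qed.

Fact ind_act1 q : ind_act 1 q = q.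
Proof. by rewrite -(ind_mk_repr q) ind_actE mul1g. Qed.

Fact ind_actM g h q : ind_act (g * h) q = ind_act g (ind_act h q).
Proof. by rewrite -(ind_mk_repr q) !ind_actE mulgA. Qed.

Definition ind_gspace : gspace G :=
  @GSpace G ind ind_act ind_act_cont ind_act1 ind_actM.

Program Definition ind_gsubset (S : gsubset Y) : gsubset ind_gspace :=
  @GSubset G ind_gspace [set q | exists g y, gs_set S y /\ q = ind_mk g y] _.
Next Obligation.
by move=> S g _ [h [y [Sy ->]]]; exists (g * h), y; rewrite /= ind_actE.
Qed.

End Induction.

(* Id_G x_N f; it does not depend on the representatives when f is an N-map *)
Definition ind_map (G : groupType) (N : subgroup G) (Y Z : gspace (sg_type N))
    (f : Y -> Z) (q : ind_gspace Y) : ind_gspace Z :=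
  ind_mk (repr (q : ind Y)).1 (f (repr (q : ind Y)).2).

Program Definition coprod_gsubset (G : groupType) (I : choiceType)
    (X : I -> gspace G) (S : forall i, gsubset (X i)) :
    gsubset (coprod_gspace X) :=
  @GSubset G (coprod_gspace X) [set p | gs_set (S (projT1 p)) (projT2 p)] _.
Next Obligation. by move=> G I X S g [i x] /= ?; exact: gs_setP. Qed.

Section Disks.
Local Open Scope ring_scope.
Variables (R : realType) (n : nat).

Definition disk : set 'rV[R]_n := [set x | \sum_(i < n) x ord0 i ^+ 2 <= 1].
Definition sphere : set 'rV[R]_n := [set x | \sum_(i < n) x ord0 i ^+ 2 = 1].

Lemma sphere_disk : sphere `<=` disk.
Proof. by move=> x; rewrite /sphere /disk /= => ->. Qed.

Definition sphere_incl (x : set_type sphere) : set_type disk :=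
  SigSub (mem_set (sphere_disk (set_mem (valP x)))).

End Disks.

Arguments disk : clear implicits.
Arguments sphere : clear implicits.

Section CW.
Variables (R : realType) (G : groupType).

Definition sub_incl (X : gspace G) (S T : gsubset X)
    (ST : (S : set X) `<=` T) (x : sub_gspace S) : sub_gspace T :=
  SigSub (mem_set (ST _ (set_mem (valP (x : set_type S))))).

Definition cells (J : choiceType) (H : J -> subgroup G) (D : topologicalType) :
    gspace G :=
  coprod_gspace (fun j => orbit_gspace (H j) D).

Definition cells_incl (J : choiceType) (H : J -> subgroup G) (n : nat) :
    cells H (set_type (sphere R n)) -> cells H (set_type (disk R n)) :=
  coprod_map (fun j (p : orbit_gspace (H j) (set_type (sphere R n))) =>
    (p.1, sphere_incl p.2) : orbit_gspace (H j) (set_type (disk R n))).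

Definition attaches_cells (X : gspace G) (n : nat) (S T : gsubset X)
    (ST : (S : set X) `<=` T) :=
  exists (J : choiceType) (H : J -> subgroup G)
         (phi : cells H (set_type (sphere R n)) -> sub_gspace S)
         (Phi : cells H (set_type (disk R n)) -> sub_gspace T),
    gpushout phi (@cells_incl J H n) (sub_incl ST) Phi.

(* [sk n] is the (n-1)-skeleton, so that [sk 0] is the empty (-1)-skeleton. As
   usual for G-CW-complexes, the structure is the filtration by skeleta: the
   attaching maps are only required to exist. *)
Record gcw_filtration (X : gspace G) (sk : nat -> gsubset X) : Prop := {
  gcw_empty : (sk 0 : set X) = set0;
  gcw_incr : forall n, (sk n : set X) `<=` sk n.+1;
  gcw_exhaust : forall x, exists n, gs_set (sk n) x;
  gcw_colimit : forall Z : set X,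
    (forall n, closed (set_val @^-1` Z : set (set_type (sk n)))) -> closed Z;
  gcw_attach : forall n, attaches_cells n (@gcw_incr n) }.

Record gcw := GCW {
  gcw_gspace :> gspace G;
  skel : nat -> gsubset gcw_gspace;
  gcwP : gcw_filtration skel }.

Definition cellular (A B : gspace G) (skA : nat -> gsubset A)
    (skB : nat -> gsubset B) (f : A -> B) :=
  forall n x, gs_set (skA n) x -> gs_set (skB n) (f x).

(* f is an isomorphism onto a subcomplex, i.e., onto a closed union of open
   cells with the induced filtration; the open n-cells are the connected
   components of X_n \ X_(n-1) *)
Record gcw_inclusion (A B : gspace G) (skA : nat -> gsubset A)
    (skB : nat -> gsubset B) (f : A -> B) : Prop := {
  gcw_incl_map : gmap f;
  gcw_incl_inj : injective f;
  gcw_incl_closed : forall Z : set A, closed Z -> closed (f @` Z);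
  gcw_incl_skel : forall n, f @^-1` (skB n) = skA n;
  gcw_incl_cell : forall n x, (skB n.+1 `\` skB n) x -> range f x ->
    connected_component (skB n.+1 `\` skB n) x `<=` range f }.

Definition contractible (T : topologicalType) :=
  exists (t0 : T) (h : T * set_type (`[0%R, 1%R] : set R) -> T),
    [/\ continuous h, forall x t, val t = 0%R -> h (x, t) = x &
        forall x t, val t = 1%R -> h (x, t) = t0].

Definition classifying_space (F : set (subgroup G)) (X : gspace G) :=
  [/\ exists sk : nat -> gsubset X, gcw_filtration sk,
      forall x : X, F (stabilizer x) &
      forall H : subgroup G, F H -> contractible (set_type (fixed_points X H))].

End CW.

(* Main.v *)
Require Import Defs.
From HB Require Import structures.
From mathcomp Require Import all_boot all_order all_algebra all_field.
From mathcomp Require Import complex.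
From mathcomp Require Import all_classical all_reals topology normedtype.
From mathcomp Require Import realfun ring lra zify.

Set Implicit Arguments.
Unset Strict Implicit.
Unset Printing Implicit Defensive.

Import Order.TTheory GRing.Theory Num.Theory.
Import numFieldNormedType.Exports.
Local Open Scope classical_set_scope.

(** The square is an instance of the pushout construction of Lueck and
   Weiermann, and [pushout_classifying] proves it for a family of cyclic
   subgroups [C L] of an arbitrary group, under the one condition that group
   theory has to provide: an infinite virtually cyclic subgroup [H] has a
   conjugate in exactly one of the normalizers [N(C L)] with finite image in
   [W(C L)], the conjugating element being unique up to [N(C L)].

   Fixed points. A coproduct of induced spaces is a disjoint union of blocks,
   one for each [L] and each coset of [N(C L)]; the [H]-fixed points live in the
   blocks of the cosets [g N(C L)] such that [H^g <= N(C L)]. If [H] is finite,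
   each of these blocks has contractible fixed points both upstairs and
   downstairs, so that the vertical map is a homotopy equivalence on fixed
   points, and [X^H] is contractible because [EGamma^H] is. If [H] is infinite,
   [EGamma^H] is empty and [X^H] is the fixed point set of the lower left
   corner, in which only one block occurs.

   The step from a homotopy equivalence to contractibility of the pushout is
   made by an explicit homotopy. As one of the two maps is the inclusion of a
   subcomplex, it has the equivariant homotopy extension property
   ([equivariant_retraction]), which passes to fixed points; hence [X^H] is
   dominated by the double mapping cylinder of the fixed point sets
   ([fixed_cylinder], and [cylinder_flip] for the other inclusion), and a map
   from such a cylinder is contracted by hand ([cylinder_contractible]).

   Cells. A filtration by skeleta with equivariant attaching pushouts is
   equivalent to a [cellular_structure], in which each cell is labelled by its
   centre and has a characteristic map into the space
   ([cellular_of_filtration], [filtration_of_cellular]). In this form cells can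
   be induced, restricted along a morphism, and glued ([pushout_cellular]).

   Group theory ([infinite_block]). Let [h] in SL2 of the integers of [k] have
   infinite order. Its centralizer is commutative, since a matrix commuting with
   a non-scalar two by two matrix [A] is a combination of [A] and the identity.
   The torsion of the centralizer is [{1, -1}]: this is where [k] has to be
   totally real, because a non-scalar torsion element makes the discriminants
   [tr^2 - 4] nonpositive for all powers of [h] and all real embeddings, which
   leaves finitely many powers. For the same reason, namely finiteness of the
   set of algebraic integers with bounded conjugates
   ([bounded_integers_finite]), [h] has finitely many roots up to sign. Hence
   a root of maximal index of the image of [h] in PSL2 generates a cyclic
   subgroup containing every infinite cyclic subgroup that meets the powers of
   that image ([maximal_root], [maximal_cyclic_over]). So an infinite virtually
   cyclic subgroup normalizes, in PSL2, exactly one maximal infinite cyclic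
   subgroup to which it is commensurable. Finally the normalizer of [C] is the
   whole preimage of that of [p(C)] ([normalizer_lift]): the sign that might
   appear in conjugating a generator would make its trace zero, and an element
   of trace zero has finite order. *)

(** * Closed sets and pushouts of G-spaces *)

Lemma closed_preim (S T : topologicalType) (f : S -> T) (Z : set T) :
  continuous f -> closed Z -> closed (f @^-1` Z).
Proof. by move=> /continuous_closedP; apply. Qed.

Lemma open_preim (S T : topologicalType) (f : S -> T) (Z : set T) :
  continuous f -> open Z -> open (f @^-1` Z).
Proof. by move=> /continuousP; apply. Qed.

Lemma closed_subtypeP (T : topologicalType) (A : set T) (W : set (set_type A)) :
  closed W <-> exists2 Z : set T, closed Z & W = set_val @^-1` Z.
Proof.
split=> [cW|[Z cZ ->]].
  have oW : open (~` W) by exact: closed_openC.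
  case: oW => Z oZ ZE; exists (~` Z); first exact: open_closedC.
  by rewrite -(setCK W) -ZE.
by apply: closed_preim => //; exact: initial_continuous.
Qed.

Lemma closed_subtype (T : topologicalType) (A Z : set T) :
  closed A -> closed (set_val @^-1` Z : set (set_type A)) <-> closed (A `&` Z).
Proof.
move=> cA; split=> [/closed_subtypeP[Y cY YE]|cZ]; last first.
  apply/closed_subtypeP; exists (A `&` Z) => //.
  by apply/seteqP; split=> [[x Ax] /= Zx|[x Ax] /= []//]; split=> //; exact: set_mem.
suff -> : A `&` Z = A `&` Y by exact: closedI.
apply/seteqP; split=> x [Ax Zx]; split=> //.
  have : (set_val @^-1` Z) (SigSub (mem_set Ax) : set_type A) by [].
  by rewrite YE.
have : (set_val @^-1` Y) (SigSub (mem_set Ax) : set_type A) by [].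
by rewrite -YE.
Qed.

Lemma continuous_subtype (S T : topologicalType) (A : set T)
    (f : S -> set_type A) :
  continuous (fun x => set_val (f x)) -> continuous f.
Proof. exact: continuous_comp_initial. Qed.

Lemma continuous_set_val (T : topologicalType) (A : set T) :
  continuous (set_val : set_type A -> T).
Proof. exact: initial_continuous. Qed.

(** A copy of [T], which may carry a topology already, for the final topology of
   [u] and [v]. *)
Definition final_top (T : choiceType) (B C : Type) (u : B -> T) (v : C -> T) :
  Type := T.

Section FinalTopology.
Variables (T : choiceType) (B C : topologicalType) (u : B -> T) (v : C -> T).

Definition final_open (U : set (final_top u v)) :=
  open (u @^-1` U) /\ open (v @^-1` U).

Fact final_openT : final_open setT.
Proof. by split; rewrite preimage_setT; exact: openT. Qed.

Fact final_openI : setI_closed final_open.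
Proof. by move=> U V [? ?] [? ?]; split; rewrite preimage_setI; exact: openI. Qed.

Fact final_open_bigU (I : Type) (f : I -> set (final_top u v)) :
  (forall i, final_open (f i)) -> final_open (\bigcup_i f i).
Proof.
move=> h; split; rewrite preimage_bigcup; apply: bigcup_open => i _;
  by have [] := h i.
Qed.

HB.instance Definition _ := Choice.on (final_top u v).
HB.instance Definition _ := isOpenTopological.Build (final_top u v)
  final_openT final_openI final_open_bigU.

End FinalTopology.

Definition indiscrete (T : Type) : Type := T.

Section Indiscrete.
Variable T : Type.

Definition indiscrete_open (U : set (indiscrete T)) := U = set0 \/ U = setT.

Fact indiscrete_openT : indiscrete_open setT.
Proof. by right. Qed.

Fact indiscrete_openI : setI_closed indiscrete_open.
Proof.
by move=> U V [->|->] [->|->];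
  rewrite ?set0I ?setI0 ?setTI ?setIT; [left|left|left|right].
Qed.

Fact indiscrete_open_bigU (I : Type) (f : I -> set (indiscrete T)) :
  (forall i, indiscrete_open (f i)) -> indiscrete_open (\bigcup_i f i).
Proof.
move=> h; have [[i fi]|h'] := pselect (exists i, f i = setT).
  by right; apply/seteqP; split=> // x _; exists i => //; rewrite fi.
left; apply/seteqP; split=> // x [i _]; case: (h i) => [->//|fi].
by case: h'; exists i.
Qed.

HB.instance Definition _ := gen_eqMixin (indiscrete T).
HB.instance Definition _ := gen_choiceMixin (indiscrete T).
HB.instance Definition _ := isOpenTopological.Build (indiscrete T)
  indiscrete_openT indiscrete_openI indiscrete_open_bigU.

Lemma indiscrete_continuous (S : topologicalType) (f : S -> indiscrete T) :
  continuous f.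
Proof.
apply/continuousP => U [->|->]; rewrite ?preimage_set0 ?preimage_setT;
  [exact: open0|exact: openT].
Qed.

End Indiscrete.

Section GPushout.
Variables (G : groupType).

Lemma gpushout_sym (A B C D : gspace G) (f : A -> B) (g : A -> C)
    (u : B -> D) (v : C -> D) : gpushout f g u v -> gpushout g f v u.
Proof.
move=> [[fm gm] [um vm] e U]; split=> // Y c b cm bm bc.
have [h [[hm hu hv] hU]] := U Y b c bm cm (esym bc).
by exists h; split=> // h' [? ? ?]; apply: hU.
Qed.

Variables (A B C D : gspace G) (f : A -> B) (g : A -> C)
  (u : B -> D) (v : C -> D).
Hypothesis po : gpushout f g u v.

(** The final topology makes a G-space out of the set of [D]; the universal
   property yields a continuous map from [D] to it that has to be the identity. *)
Lemma gpushout_closed (W : set D) :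
  closed (u @^-1` W) -> closed (v @^-1` W) -> closed W.
Proof.
move=> cu cv; have [_ [[uc ue] [vc ve]] uv U] := po.
have actc (k : G) : continuous (gact k : final_top u v -> final_top u v).
  apply/continuousP => V [Vu Vv]; split.
    have -> : u @^-1` (gact k @^-1` V) = gact k @^-1` (u @^-1` V).
      by apply/funext => b /=; rewrite /preimage /= ue.
    by apply: open_preim => //; exact: gact_cont.
  have -> : v @^-1` (gact k @^-1` V) = gact k @^-1` (v @^-1` V).
    by apply/funext => b /=; rewrite /preimage /= ve.
  by apply: open_preim => //; exact: gact_cont.
pose D' : gspace G := @GSpace G (final_top u v) _ actc (@gact1 _ D) (@gactM _ D).
have um : @gmap _ B D' u by split=> //; apply/continuousP => V [].
have vm : @gmap _ C D' v by split=> //; apply/continuousP => V [].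
have [h [[[hc he] hu hv] _]] := U D' u v um vm uv.
have idc : continuous (id : D' -> D).
  by apply/continuousP => V oV; split; apply: open_preim.
have [h0 [_ hU]] := U D u v (conj uc ue) (conj vc ve) uv.
have h0id : h0 = id by apply: hU; split=> //; split=> // x; exact: cvg_id.
have hid : h = id.
  rewrite -h0id; apply/esym/hU; split=> //; split=> //.
  by move=> x; apply: (@continuous_comp _ D' D h id); [exact: hc|exact: idc].
have -> : W = h @^-1` W by rewrite hid.
apply: closed_preim hc _.
by rewrite -openC; split; rewrite preimage_setC; exact: closed_openC.
Qed.

(** The test object is the indiscrete space of propositions with trivial action:
   membership in the union of the two images and the constant [True] both extend
   the same pair of maps. *)
Lemma gpushout_cover (x : D) : (exists b, x = u b) \/ (exists c, x = v c).
Proof.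
have [_ [[uc ue] [vc ve]] uv U] := po.
pose P := indiscrete Prop.
have Pa (k : G) : continuous (fun p : P => p) by move=> ? ?; exact: cvg_id.
pose Y : gspace G := @GSpace G P _ Pa (fun _ => erefl) (fun _ _ _ => erefl).
have [h [_ hU]] := U Y (fun _ => True) (fun _ => True)
  (conj (@indiscrete_continuous _ _ _) (fun _ _ => erefl))
  (conj (@indiscrete_continuous _ _ _) (fun _ _ => erefl)) erefl.
(* membership in the union of the images, as a map to propositions *)
pose r : D -> Y := fun x => (exists b, x = u b) \/ (exists c, x = v c).
have e1 : h = r.
  apply: hU; split; first split.
  - exact: indiscrete_continuous.
  - move=> k y; rewrite /r /=; apply/propext; split=> -[] [b E]; [left|right|left|right].
    + by exists (gact k^-1%g b); rewrite ue -E -gactM mulVg gact1.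
    + by exists (gact k^-1%g b); rewrite ve -E -gactM mulVg gact1.
    + by exists (gact k b); rewrite ue -E.
    + by exists (gact k b); rewrite ve -E.
  - by apply/funext => b; apply/propext; split=> // _; left; exists b.
  - by apply/funext => b; apply/propext; split=> // _; right; exists b.
have e2 : h = fun _ => True.
  by apply: hU; split=> //; split=> //; exact: indiscrete_continuous.
by have : r x by rewrite -e1 e2.
Qed.

Hypothesis gI : injective g.

(** The set-theoretic pushout along an injection [g] is the sum of [B] and of the
   complement of the range of [g]. With the indiscrete topology it is a G-space
   to which all maps are continuous, so the universal property of [D] gives
   information on the underlying sets. *)
Lemma gpushout_test : exists (S : Type) (b : B -> S) (c : C -> S) (h : D -> S),
  [/\ h \o u = b, h \o v = c, injective b,
     forall x y, b x = c y -> exists2 a, x = f a & y = g a &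
     forall x y, c x = c y -> x = y \/ (range g x /\ range g y)].
Proof.
have [[[fc fe] [gc ge]] [[uc ue] [vc ve]] uv U] := po.
pose S := (B + {x : C | ~ range g x})%type.
pose c (x : C) : S := match pselect (range g x) with
  | left gx => inl (f (projT1 (cid2 gx)))
  | right ngx => inr (exist _ x ngx) end.
have cg a : c (g a) = inl (f a).
  rewrite /c; case: pselect => [h|h]; last by case: h; exists a.
  by case: cid2 => a' _ /= /gI ->.
have cn x (h : ~ range g x) : c x = inr (exist _ x h).
  rewrite /c; case: pselect => h' //; congr inr; apply: eq_exist => //.
have nact k x : ~ range g x -> ~ range g (gact k x).
  move=> h [a _ ga]; apply: h; exists (gact k^-1%g a) => //.
  by rewrite ge ga -gactM mulVg gact1.
pose act (k : G) (s : S) : S := match s with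
  | inl x => inl (gact k x)
  | inr (exist x h) => inr (exist _ (gact k x) (nact k x h)) end.
have a1 s : act 1%g s = s.
  case: s => [x|[x h]] /=; first by rewrite gact1.
  by congr inr; apply: eq_exist; rewrite gact1.
have aM k l s : act (k * l)%g s = act k (act l s).
  case: s => [x|[x h]] /=; first by rewrite gactM.
  by congr inr; apply: eq_exist; rewrite gactM.
pose Y : gspace G := @GSpace G (indiscrete S) act
  (fun k => @indiscrete_continuous S (indiscrete S) (act k)) a1 aM.
have ce : @equivariant _ C Y c.
  move=> k x; have [[a _ <-]|h] := pselect (range g x).
    by rewrite -ge !cg /= fe.
  by rewrite (cn _ h) /= (cn _ (nact k _ h)).
have [h [[_ hu hv] _]] := U Y inl c
  (conj (@indiscrete_continuous S B _) (fun _ _ => erefl))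
  (conj (@indiscrete_continuous S C _) ce)
  (funext (fun a => esym (cg a))).
exists S, inl, c, h; split=> //; first by move=> x y [].
- move=> x y; have [[a _ <-]|ny] := pselect (range g y).
    by rewrite cg => -[->]; exists a.
  by rewrite (cn _ ny).
- move=> x y; have [rx|nx] := pselect (range g x);
    have [ry|ny] := pselect (range g y); first by right.
  + by case: rx => a _ <-; rewrite cg (cn _ ny).
  + by case: ry => a _ <-; rewrite cg (cn _ nx).
  + by rewrite (cn _ nx) (cn _ ny) => -[->]; left.
Qed.

Lemma gpushout_inj : injective u.
Proof.
have [S [b [c [h [hu hv bI _ _]]]]] := gpushout_test.
by move=> x y xy; apply: bI; rewrite -hu /= xy.
Qed.

Lemma gpushout_cross x y : u x = v y -> exists2 a, x = f a & y = g a.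
Proof.
have [S [b [c [h [hu hv bI bc _]]]]] := gpushout_test.
by move=> xy; apply: bc; rewrite -hu -hv /= xy.
Qed.

Lemma gpushout_quasi_inj x y : v x = v y -> x = y \/ (range g x /\ range g y).
Proof.
have [S [b [c [h [hu hv bI _ cc]]]]] := gpushout_test.
by move=> xy; apply: cc; rewrite -hv /= xy.
Qed.

End GPushout.

(** * Cell structures given by characteristic maps *)

Section Disks.
Local Open Scope ring_scope.
Variable R : realType.

Definition sqnorm n (d : 'rV[R]_n) : R := \sum_(i < n) d ord0 i ^+ 2.

Definition odisk n : set 'rV[R]_n := [set d | sqnorm d < 1].

Lemma sqnorm_continuous n : continuous (@sqnorm n).
Proof.
apply: continuous_big => [|i _]; first exact: add_continuous.
by move=> d; exact: (cvgM (@coord_continuous R 1 n ord0 i d)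
  (@coord_continuous R 1 n ord0 i d)).
Qed.

Lemma diskE n : disk R n = @sqnorm n @^-1` [set r | r <= 1].
Proof. by []. Qed.

Lemma closed_disk n : closed (disk R n).
Proof. exact: (closed_preim (@sqnorm_continuous n) (@closed_le R 1)). Qed.

Lemma closed_sphere n : closed (sphere R n).
Proof. exact: (closed_preim (@sqnorm_continuous n) (@closed_eq R 1)). Qed.

Lemma odisk_disk n : @odisk n `<=` disk R n.
Proof. by move=> d; exact: ltW. Qed.

Lemma disk_case n d : disk R n d -> odisk d \/ sphere R n d.
Proof.
rewrite /disk /= le_eqVlt => /orP[/eqP|]; [by right|by left].
Qed.

Lemma sphere_not_odisk n d : sphere R n d -> ~ odisk d.
Proof. by rewrite /sphere /odisk /sqnorm /= => ->; rewrite ltxx. Qed.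

Lemma odisk0 n : odisk (0 : 'rV[R]_n).
Proof.
rewrite /odisk /sqnorm /= big1 ?ltr01 // => i _.
by rewrite mxE expr0n.
Qed.

Lemma sqnormZ n (a : R) (d : 'rV[R]_n) : sqnorm (a *: d) = a ^+ 2 * sqnorm d.
Proof. by rewrite /sqnorm mulr_sumr; apply: eq_bigr => i _; rewrite mxE exprMn. Qed.

Lemma sqnorm_ge0 n (d : 'rV[R]_n) : 0 <= sqnorm d.
Proof. by apply: sumr_ge0 => i _; exact: sqr_ge0. Qed.

End Disks.

Arguments odisk {R} n.

Section SumClosed.

Lemma sigT_closedP (I : choiceType) (X : I -> topologicalType)
    (W : set {i & X i}) :
  closed W <-> forall i, closed (existT (fun i => X i : Type) i @^-1` W).
Proof.
rewrite -openC sigT_openP; split=> h i; have := h i;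
  by rewrite preimage_setC ?openC // -openC setCK.
Qed.

Lemma discrete_slice_continuous (Q : choiceType) (D : topologicalType) (q : Q) :
  continuous (fun d : D => ((q : discrete_topology Q), d)).
Proof. by apply: pair_continuous => d; [exact: cvg_cst|exact: cvg_id]. Qed.

Lemma discrete_prod_closedP (Q : choiceType) (D : topologicalType)
    (W : set (discrete_topology Q * D)) :
  closed W <-> forall q : Q, closed [set d | W ((q : discrete_topology Q), d)].
Proof.
split=> [cW q|h].
  apply: (@closed_preim D (discrete_topology Q * D)%type
    (fun d => ((q : discrete_topology Q), d))) => //.
  exact: discrete_slice_continuous.
rewrite -openC openE => -[q d] nW; rewrite /interior.
exists ([set q], ~` [set d | W (q, d)]); last first.
  by move=> [q' d'] [/= -> ].
split=> /=; first exact: discrete_set1.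
by apply: open_nbhs_nbhs; split=> //; exact: closed_openC.
Qed.

Lemma discrete_prod_continuous (Q : choiceType) (D Y : topologicalType)
    (f : discrete_topology Q * D -> Y) :
  (forall q : Q, continuous (fun d => f (q, d))) -> continuous f.
Proof.
move=> h; apply/continuous_closedP => Z cZ; apply/discrete_prod_closedP => q.
exact: (closed_preim (h q) cZ).
Qed.

Lemma sigT_slice_continuous (I : choiceType) (X : I -> topologicalType)
    (Y : topologicalType) (f : {i & X i} -> Y) :
  (forall i, continuous (fun x : X i => f (existT _ i x))) -> continuous f.
Proof.
move=> h; apply/continuous_closedP => Z cZ; apply/sigT_closedP => i.
exact: (closed_preim (h i) cZ).
Qed.

End SumClosed.

(** The [n]-cells that are attached to [S] to form [T]. Each cell is labelled by
   its centre, so that the group acts on labels without any choice of orbit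
   representatives, and [chi x] is the characteristic map of the cell of centre
   [x]. It is a function on the whole vector space with arbitrary values outside
   of the disk, which avoids subtypes. *)
Record cell_family (R : realType) (G : groupType) (X : gspace G) (n : nat)
    (S T : set X) (ctr : set X) (chi : X -> 'rV[R]_n -> X) : Prop := {
  cf_ctr_act : forall g x, ctr x -> ctr (gact g x);
  cf_act : forall g x d, ctr x -> disk R n d ->
    chi (gact g x) d = gact g (chi x d);
  cf_center : forall x, ctr x -> chi x 0%R = x;
  cf_sphere : forall x d, ctr x -> sphere R n d -> S (chi x d);
  cf_in : forall x d, ctr x -> odisk n d -> (T `\` S) (chi x d);
  cf_inj : forall x y d e, ctr x -> ctr y -> odisk n d -> odisk n e ->
    chi x d = chi y e -> x = y /\ d = e;
  cf_surj : forall y, (T `\` S) y ->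
    exists x d, [/\ ctr x, odisk n d & y = chi x d];
  cf_cont : forall x Z, ctr x -> closed Z ->
    closed (disk R n `&` chi x @^-1` Z) }.

(** The last two fields express that [X] has the weak topology. They speak of
   closed subsets of [X] rather than of the skeleta, which amounts to the same
   since skeleta are closed ([cs_skel_closed]). *)
Record cellular_structure (R : realType) (G : groupType) (X : gspace G)
    (sk ctr : nat -> set X) (chi : forall n, X -> 'rV[R]_n -> X) : Prop := {
  cs_skel_act : forall n g x, sk n x -> sk n (gact g x);
  cs_empty : sk 0%N = set0;
  cs_incr : forall n, sk n `<=` sk n.+1;
  cs_exhaust : forall x, exists n, sk n x;
  cs_family : forall n, cell_family (sk n) (sk n.+1) (ctr n) (chi n);
  cs_step : forall n (Z : set X), Z `<=` sk n.+1 -> closed (Z `&` sk n) ->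
    (forall x, ctr n x -> closed (disk R n `&` chi n x @^-1` Z)) -> closed Z;
  cs_colim : forall Z : set X, (forall n, closed (Z `&` sk n)) -> closed Z }.

Definition relclosed (X : topologicalType) (A Z : set X) := exists2 Y, closed Y & A `&` Z = A `&` Y.

Lemma relclosedP (X : topologicalType) (A Z : set X) :
  closed (set_val @^-1` Z : set (set_type A)) <-> relclosed A Z.
Proof.
rewrite closed_subtypeP; split=> -[Y cY e]; exists Y => //.
  apply/seteqP; split=> x [Ax Zx]; split=> //.
    have : (set_val @^-1` Z) (SigSub (mem_set Ax) : set_type A) by [].
    by rewrite e.
  have : (set_val @^-1` Y) (SigSub (mem_set Ax) : set_type A) by [].
  by rewrite -e.
have e' x : A x -> Z x <-> Y x.
  move=> Ax; have : (A `&` Z) x <-> (A `&` Y) x by rewrite e.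
  by move=> [h1 h2]; split=> h; [case: h1|case: h2].
by apply/seteqP; split=> -[x Ax] /=; apply e'; exact: set_mem.
Qed.

Section FromAttach.
Variables (R : realType) (G : groupType) (X : gspace G) (n : nat).
Variables (S T : gsubset X) (ST : (S : set X) `<=` T).
Hypothesis att : attaches_cells R n ST.

(** The inclusion of the spheres in the disks is injective, so that the pushout is
   known as a set: open disks embed outside of [S], and the image of the origin
   determines the cell. The weak topology is [gpushout_closed]. *)
Lemma attach_cell_family : exists ctr chi,
  @cell_family R G X n S T ctr chi /\
  (forall Z, Z `<=` T -> relclosed S Z ->
    (forall x, ctr x -> closed (disk R n `&` chi x @^-1` Z)) -> relclosed T Z).
Proof.
have [J [H [phi [Phi po]]]] := att.
have inclI : injective (@cells_incl R G J H n).
  move=> [j [q d]] [j' [q' d']] /= e.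
  have := projT1_eq e; rewrite /= => jj; case: _ / jj in q' d' e *.
  have /= [qq dd] := eq_from_Tagged e.
  have dd' : d = d' by apply: val_inj.
  by rewrite qq dd'.
have [pm [um vm] uv _] := po.
have z0 : disk R n 0%R by exact/odisk_disk/odisk0.
pose clip (d : 'rV[R]_n) : set_type (disk R n) :=
  match pselect (disk R n d) with left h => SigSub (mem_set h)
  | right _ => SigSub (mem_set z0) end.
have clipK d : disk R n d -> val (clip d) = d.
  by rewrite /clip; case: pselect.
have clipV (d : set_type (disk R n)) : clip (val d) = d.
  by apply: val_inj; rewrite clipK //; exact/set_mem/valP.
pose cell (c : {j & lcosets (H j)}) (d : 'rV[R]_n) : cells H (set_type (disk R n)) :=
  existT _ (projT1 c) ((projT2 c : discrete_topology _), clip d).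
pose P c d : X := val (Phi (cell c d)).
have cell_act g c : exists c', forall d, gact g (cell c d) = cell c' d.
  by exists (existT _ (projT1 c) (coset_of _ (g * repr (projT2 c))%g)).
have cell_range c d : disk R n d -> ~ sphere R n d -> ~ range (@cells_incl R G J H n) (cell c d).
  move=> dd ns [[j [q s]] _] e; apply: ns.
  have := congr1 (fun p => val (projT2 p).2) e => /=; rewrite clipK // => <-.
  by case: s {e} => s /= /set_mem.
have P_sphere c d : sphere R n d -> gs_set S (P c d).
  move=> sd; pose s : set_type (sphere R n) := SigSub (mem_set sd).
  pose a : cells H (set_type (sphere R n)) := existT _ (projT1 c) ((projT2 c : discrete_topology _), s).
  have -> : P c d = val (phi a).
    have /(congr1 (fun k => val (k a))) /= -> := uv.
    rewrite /P /cell (_ : clip d = sphere_incl s) //; apply: val_inj.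
    by rewrite clipK //; exact: sphere_disk.
  exact/set_mem/valP.
have P_T c d : gs_set T (P c d) by exact/set_mem/valP.
have P_S c d : odisk n d -> ~ gs_set S (P c d).
  move=> od Sx; pose s : sub_gspace S := SigSub (mem_set Sx).
  have : sub_incl ST s = Phi (cell c d) by apply: val_inj.
  move=> /(gpushout_cross po inclI) [a _ e].
  apply: (@cell_range c d); first exact: odisk_disk.
    by move=> /sphere_not_odisk.
  by exists a.
have P_inj c c' d d' : odisk n d -> odisk n d' -> P c d = P c' d' -> c = c' /\ d = d'.
  move=> od od' /val_inj /(gpushout_quasi_inj po inclI)[|[rc _]]; last first.
    exfalso; move: rc; apply: cell_range; first exact: odisk_disk.
    by move=> /sphere_not_odisk.
  case: c c' => [j q] [j' q'] e.
  have := projT1_eq e; rewrite /= => jj; case: _ / jj in q' e *.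
  have /= := eq_from_Tagged e; rewrite /tagged /= => -[qq dd]; rewrite qq; split=> //.
  by rewrite -(clipK d) ?dd ?clipK //; exact: odisk_disk.
have P_cont c Z : closed Z -> closed (disk R n `&` P c @^-1` Z).
  move=> cZ; apply/closed_subtype; first exact: closed_disk.
  have -> : set_val @^-1` (P c @^-1` Z) = (fun d : set_type (disk R n) =>
      val (Phi (existT _ (projT1 c) ((projT2 c : discrete_topology _), d)))) @^-1` Z.
    by apply/funext => d; rewrite /preimage /= /P /cell set_valE clipV.
  apply: closed_preim cZ => d.
  apply: (@continuous_comp _ _ _ (fun d => Phi (existT _ (projT1 c) ((projT2 c : discrete_topology _), d))) set_val); last exact: continuous_set_val.
  apply: (@continuous_comp _ _ _ (fun d => (existT _ (projT1 c) ((projT2 c : discrete_topology _), d))) Phi); last by have [h _] := vm; exact: h.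
  apply: (@continuous_comp _ _ _ (fun d => ((projT2 c : discrete_topology _), d))); last exact: existT_continuous.
  exact: discrete_slice_continuous.
pose ctr : set X := [set x | exists c, x = P c 0%R].
pose chi (x : X) (d : 'rV[R]_n) : X :=
  if pselect (ctr x) is left h then P (projT1 (cid h)) d else x.
have chiE c d : chi (P c 0%R) d = P c d.
  rewrite /chi; case: pselect => [h|[]]; last by exists c.
  by case: cid => c' /= e; have [->] := P_inj _ _ _ _ (@odisk0 R n) (@odisk0 R n) e.
exists ctr, chi; split; first split.
- move=> g _ [c ->]; have [c' e] := cell_act g c; exists c'.
  by rewrite /P -e; case: vm => _ ->.
- move=> g _ d [c ->] dd; have [c' e] := cell_act g c.
  have eP d' : gact g (P c d') = P c' d' by rewrite /P -e; case: vm => _ ->.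
  by rewrite eP !chiE eP.
- by move=> _ [c ->]; rewrite chiE.
- by move=> _ d [c ->] sd; rewrite chiE; exact: P_sphere.
- by move=> _ d [c ->] od; rewrite chiE; split; [exact: P_T|exact: P_S].
- move=> _ _ d e [c ->] [c' ->] od oe; rewrite !chiE => /P_inj.
  by case=> // -> ->.
- move=> y [Ty nSy]; pose t : sub_gspace T := SigSub (mem_set Ty).
  have [[s e]|[[j [q d]] e]] := gpushout_cover po t.
    case: nSy; have -> : y = val s by rewrite -[y]/(val t) e.
    exact/set_mem/valP.
  have yE : y = P (existT _ j q) (val d).
    by rewrite -[y]/(val t) e /P /cell clipV.
  exists (P (existT _ j q) 0%R), (val d); split; last by rewrite chiE.
    by exists (existT _ j q).
  have [//|sd] := disk_case (set_mem (valP d)).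
  by case: nSy; rewrite yE; exact: P_sphere.
- by move=> _ Z [c ->] cZ; rewrite (_ : chi _ = P c) //; [exact: P_cont|apply/funext => d; exact: chiE].
- move=> Z ZT rS cells; apply/relclosedP.
  apply: (gpushout_closed po); first by move/relclosedP: rS.
  apply/sigT_closedP => j; apply/discrete_prod_closedP => q.
  have := cells (P (existT _ j q) 0%R) (ex_intro _ _ erefl).
  rewrite (_ : chi _ = P (existT _ j q)); last by apply/funext => d; exact: chiE.
  move=> /(closed_subtype _ (@closed_disk R n)).
  congr closed; apply/funext => d; rewrite /preimage /= /P /cell /= set_valE.
  by rewrite clipV.
Qed.

End FromAttach.

Lemma relclosed_closed (X : topologicalType) (A Z : set X) :
  closed A -> relclosed A Z -> closed (A `&` Z).
Proof. by move=> cA [Y cY ->]; exact: closedI. Qed.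

Lemma relclosedW (X : topologicalType) (A B Z : set X) :
  B `<=` A -> relclosed A Z -> relclosed B Z.
Proof.
move=> BA [Y cY e]; exists Y => //.
by rewrite -(setIidl BA) -!setIA e.
Qed.

Section CellularTheory.
Variables (R : realType) (G : groupType) (X : gspace G).

Section OfFiltration.
Variable sk : nat -> gsubset X.
Hypothesis skP : gcw_filtration R sk.

(** The filtration only tells which sets are closed in a skeleton. But a subset
   that is closed in one skeleton remains so in all later ones, because it meets
   the later closed cells only along their boundary spheres; this is [rel], and
   makes it closed in [X]. *)
Lemma cellular_of_filtration :
  exists ctr chi, @cellular_structure R G X sk ctr chi.
Proof.
have : forall n, exists p : set X * (X -> 'rV[R]_n -> X),
  cell_family (sk n) (sk n.+1) p.1 p.2 /\
  (forall Z, Z `<=` sk n.+1 -> relclosed (sk n) Z ->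
    (forall x, p.1 x -> closed (disk R n `&` p.2 x @^-1` Z)) ->
    relclosed (sk n.+1) Z).
  move=> n; have [ctr [chi h]] := attach_cell_family (gcw_attach skP n).
  by exists (ctr, chi).
have inc m n : (m <= n)%N -> (sk m : set X) `<=` sk n.
  elim: n => [|n IH]; first by rewrite leqn0 => /eqP ->.
  rewrite leq_eqVlt => /orP[/eqP -> //|]; rewrite ltnS => /IH h x /h.
  exact: (gcw_incr skP).
move=> h.
pose p n := projT1 (cid (h n)).
have hp n := projT2 (cid (h n)).
pose ctr n := (p n).1; pose chi n := (p n).2.
have rel n Z : (Z `<=` sk n) -> relclosed (sk n) Z -> closed Z.
  move=> Zn rZ; apply: (gcw_colimit skP) => m; apply/relclosedP.
  have [mn|/ltnW nm] := leqP m n; first exact: relclosedW (inc _ _ mn) rZ.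
  rewrite -(subnK nm); elim: (m - n)%N => {m nm} [//|m IH].
  rewrite addSn; have [cf step] := hp (m + n)%N.
  have Zm : Z `<=` sk (m + n)%N.
    by move=> x /Zn; apply: inc; rewrite leq_addl.
  apply: step => //; first by move=> x /Zm; exact: (gcw_incr skP).
  move=> x cx; have [Y cY e] := IH.
  have -> : disk R (m + n) `&` (p (m + n)%N).2 x @^-1` Z =
      sphere R (m + n) `&` (disk R (m + n) `&` (p (m + n)%N).2 x @^-1` Y).
    have ZY y : gs_set (sk (m + n)%N) y -> Z y <-> Y y.
      move=> sy; have : (gs_set (sk (m + n)%N) `&` Z) y <-> (gs_set (sk (m + n)%N) `&` Y) y by rewrite e.
      by move=> [h1 h2]; split=> h3; [case: h1|case: h2].
    apply/seteqP; split=> d.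
      move=> [dd Zd]; have [od|sd] := disk_case dd.
        by have [_ []] := cf_in cf cx od; exact: Zm.
      by split=> //; split=> //; apply/ZY => //; exact: Zm.
    move=> [sd [dd Yd]]; split=> //; apply/ZY => //.
    exact: (cf_sphere cf).
  apply: closedI; first exact: closed_sphere.
  exact: (cf_cont cf).
have skc n : closed (sk n : set X).
  by apply: (rel n) => //; exists setT; [exact: closedT|rewrite setIid setIT].
exists ctr, chi; split.
- by move=> n g x; exact: gs_setP.
- exact: (gcw_empty skP).
- exact: (gcw_incr skP).
- exact: (gcw_exhaust skP).
- by move=> n; have [] := hp n.
- move=> n Z Zn cZ cells; apply: (rel n.+1) => //.
  have [_ step] := hp n; apply: step => //.
  by exists (Z `&` sk n) => //; apply/seteqP; split=> x [] // ? [].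
- move=> Z cZ; apply: (gcw_colimit skP) => n; apply/relclosedP.
  by exists (Z `&` sk n) => //; apply/seteqP; split=> x [] // ? [].
Qed.

End OfFiltration.

Variables (sk ctr : nat -> set X) (chi : forall n, X -> 'rV[R]_n -> X).
Arguments chi : clear implicits.
Hypothesis cs : cellular_structure sk ctr chi.

Lemma cs_skel_closed n : closed (sk n).
Proof.
elim: n => [|n IH]; first by rewrite (cs_empty cs); exact: closed0.
apply: (cs_step cs (n := n)) => //.
  by rewrite setIC (setIidl (@cs_incr _ _ _ _ _ _ cs n)).
move=> x cx; rewrite (_ : _ `&` _ = disk R n); first exact: closed_disk.
apply/seteqP; split=> [d []//|d dd]; split=> //.
have [od|sd] := disk_case dd; first by case: (cf_in (cs_family cs n) cx od).
by apply: (cs_incr cs); exact: (cf_sphere (cs_family cs n)).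
Qed.

Lemma cs_skel_le m n : (m <= n)%N -> sk m `<=` sk n.
Proof.
elim: n => [|n IH]; first by rewrite leqn0 => /eqP ->.
rewrite leq_eqVlt => /orP[/eqP -> //|]; rewrite ltnS => /IH h x /h.
exact: (cs_incr cs).
Qed.

Lemma cs_skel_chi n x d : ctr n x -> disk R n d -> sk n.+1 (chi n x d).
Proof.
move=> cx /disk_case[od|sd]; first by case: (cf_in (cs_family cs n) cx od).
by apply: (cs_incr cs); exact: (cf_sphere (cs_family cs n)).
Qed.

Lemma cs_closed_skel n (Z : set X) :
  (forall m x, (m < n)%N -> ctr m x -> closed (disk R m `&` chi m x @^-1` Z)) ->
  closed (Z `&` sk n).
Proof.
elim: n => [|n IH] h; first by rewrite (cs_empty cs) setI0; exact: closed0.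
apply: (cs_step cs (n := n)) => [x []//||x cx].
  rewrite -setIA [sk n.+1 `&` _]setIC (setIidl (@cs_incr _ _ _ _ _ _ cs n)).
  by apply: IH => m x mn; apply: h; rewrite (ltn_trans mn).
rewrite (_ : _ `&` _ = disk R n `&` chi n x @^-1` Z); first exact: h.
apply/seteqP; split=> d [dd] => [[]//|Zd]; split=> //; split=> //.
exact: cs_skel_chi.
Qed.

Lemma cs_closed (Z : set X) :
  (forall n x, ctr n x -> closed (disk R n `&` chi n x @^-1` Z)) -> closed Z.
Proof.
by move=> h; apply: (cs_colim cs) => n; apply: cs_closed_skel => m x _; exact: h.
Qed.

Lemma cs_fixed_chi n x d (g : G) : ctr n x -> odisk n d ->
  gact g (chi n x d) = chi n x d <-> gact g x = x.
Proof.
move=> cx od; have dd := odisk_disk od.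
rewrite -(cf_act (cs_family cs n)) //; split=> [|-> //] e.
by case: (cf_inj (cs_family cs n) _ cx od od e) => //; exact: (cf_ctr_act (cs_family cs n)).
Qed.

(** If the centre of a cell is fixed, so is the whole closed cell. Otherwise no
   point of the open cell is fixed, and the fixed points of the closed cell lie
   on its boundary, where induction on the dimension applies. *)
Lemma closed_fixed_points (H : set G) : closed (fixed_points X H).
Proof.
suff h n : forall m x, (m < n)%N -> ctr m x ->
    closed (disk R m `&` chi m x @^-1` fixed_points X H).
  by apply: cs_closed => n x; exact: (h n.+1).
elim: n => [//|n IH] m x; rewrite ltnS leq_eqVlt => /orP[/eqP ->{m}|]; last exact: IH.
move=> cx; have [fx|nfx] := pselect (forall h, H h -> gact h x = x).
  rewrite (_ : _ `&` _ = disk R n); first exact: closed_disk.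
  apply/seteqP; split=> [d []//|d dd]; split=> // h Hh.
  by rewrite -(cf_act (cs_family cs n)) // fx.
rewrite (_ : _ `&` _ = sphere R n `&` (disk R n `&` chi n x @^-1`
    (fixed_points X H `&` sk n))).
  apply: closedI; first exact: closed_sphere.
  apply: (cf_cont (cs_family cs n)) => //; exact: cs_closed_skel.
apply/seteqP; split=> d.
  move=> [dd fd]; have [od|sd] := disk_case dd.
    by case: nfx => h Hh; apply/(cs_fixed_chi h cx od); exact: fd.
  by do !split=> //; exact: (cf_sphere (cs_family cs n)).
by move=> [_ [dd [fd _]]].
Qed.

End CellularTheory.

Section ToFiltration.
Variables (R : realType) (G : groupType) (X : gspace G).
Variables (sk ctr : nat -> set X) (chi : forall n, X -> 'rV[R]_n -> X).
Arguments chi : clear implicits.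
Hypothesis cs : cellular_structure sk ctr chi.

Definition cs_gsubset n : gsubset X := GSubset (@cs_skel_act _ _ _ _ _ _ cs n).

Definition gorbit (x : X) : set X := [set y | exists g, y = gact g x].

Lemma gorbit_act g x : gorbit (gact g x) = gorbit x.
Proof.
apply/seteqP; split=> _ [h ->]; first by exists (h * g)%g; rewrite gactM.
by exists (h * g^-1)%g; rewrite -gactM mulgVK.
Qed.

Definition orbit_rep (x : X) : X := xget x (gorbit x).

Lemma orbit_repP x : exists g, orbit_rep x = gact g x.
Proof. by apply: (@xgetPex _ x (gorbit x)); exists x; exists 1%g; rewrite gact1. Qed.

Lemma orbit_rep_act g x : orbit_rep (gact g x) = orbit_rep x.
Proof.
rewrite /orbit_rep gorbit_act /xget; case: pselect => // -[].
by exists x; apply/asboolP; exists 1%g; rewrite gact1.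
Qed.

(** Index the cells by one centre in each orbit; the isotropy group of a cell is
   the stabilizer of its centre, which fixes the closed cell pointwise by
   [cf_act]. *)
Lemma attaches_of_cells n (ST : (cs_gsubset n : set X) `<=` cs_gsubset n.+1) :
  attaches_cells R n ST.
Proof.
have cf := cs_family cs n.
pose J : choiceType := set_type [set x | ctr n x /\ orbit_rep x = x].
pose H (j : J) := stabilizer (val j).
have ctrJ (j : J) : ctr n (val j) by have [] := set_mem (valP j).
have repJ (j : J) : orbit_rep (val j) = val j by have [] := set_mem (valP j).
(* the centre of the cell to which the point [p] belongs *)
pose pos D (p : cells H D) : X := gact (repr (projT2 p).1) (val (projT1 p)).
have pos_ctr D p : ctr n (@pos D p) by apply: (cf_ctr_act cf).
have pos_coset (D : topologicalType) j g (d : D) :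
    @pos D (existT _ j (coset_of (H j) g, d)) = gact g (val j).
  rewrite /pos /=; have := repr_coset_of (H j) g.
  rewrite /= /stabilizer_set /= gactM => e.
  by rewrite -[in RHS]e -gactM mulgV gact1.
have pos_act (D : topologicalType) g (p : cells H D) : pos D (gact g p) = gact g (pos D p).
  by case: p => j [q d]; rewrite {1}/gact /= /coprod_act /= /orbit_act /= pos_coset gactM.
have pos_inj (D : topologicalType) (p p' : cells H D) : pos D p = pos D p' ->
    (projT2 p).2 = (projT2 p').2 :> D -> p = p'.
  case: p p' => j [q d] [j' [q' d']] /= e dd; rewrite -dd in e *.
  have jj : j = j'.
    apply: val_inj; rewrite -(repJ j) -(repJ j').
    by have := congr1 orbit_rep e; rewrite /pos !orbit_rep_act.
  case: _ / jj in q' e *.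
  suff -> : q = q' by [].
  rewrite -(coset_of_repr q) -(coset_of_repr q'); apply/coset_ofP.
  by rewrite /= /stabilizer_set /= gactM -[X in gact _ X]e -gactM mulVg gact1.
have pos_surj (D : topologicalType) (d : D) x : ctr n x -> exists2 p : cells H D, pos D p = x & (projT2 p).2 = d.
  move=> cx; have [g eg] := orbit_repP x.
  have Jx : ctr n (orbit_rep x) /\ orbit_rep (orbit_rep x) = orbit_rep x.
    by split; rewrite eg ?orbit_rep_act //; exact: (cf_ctr_act cf).
  pose j : J := SigSub (mem_set Jx).
  exists (existT _ j (coset_of (H j) g^-1%g, d)) => //.
  by rewrite pos_coset /= eg -gactM mulVg gact1.
pose Pv (p : cells H (set_type (disk R n))) : X := chi n (pos _ p) (val (projT2 p).2).
have PT p : sk n.+1 (Pv p) by apply: (cs_skel_chi cs) => //; exact/set_mem/valP.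
pose Phi p : sub_gspace (cs_gsubset n.+1) := SigSub (mem_set (PT p)).
pose pv (p : cells H (set_type (sphere R n))) : X := chi n (pos _ p) (val (projT2 p).2).
have pS p : sk n (pv p) by apply: (cf_sphere cf) => //; exact/set_mem/valP.
pose phi p : sub_gspace (cs_gsubset n) := SigSub (mem_set (pS p)).
have cont (B : set 'rV[R]_n) (BD : B `<=` disk R n) :
    continuous (fun p : cells H (set_type B) => chi n (pos _ p) (val (projT2 p).2)).
  apply: sigT_slice_continuous => j; apply: discrete_prod_continuous => q.
  apply/continuous_closedP => Z cZ.
  have cx : ctr n (gact (repr (q : lcosets (H j))) (val j)) by exact: (cf_ctr_act cf).
  apply/closed_subtypeP; exists (disk R n `&` chi n (gact (repr (q : lcosets (H j))) (val j)) @^-1` Z).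
    exact: (cf_cont cf).
  apply/seteqP; split=> [d Zd|d []//]; split=> //.
  by apply: BD; exact/set_mem/valP.
have Phi_map : gmap Phi.
  split; first by apply: continuous_subtype; exact: cont.
  move=> g p; apply: val_inj; rewrite /= /Pv -(cf_act cf) ?pos_act //.
  exact/set_mem/valP.
have phi_map : gmap phi.
  split; first by apply: continuous_subtype; apply: cont; exact: sphere_disk.
  move=> g p; apply: val_inj; rewrite /= /pv -(cf_act cf) ?pos_act //.
  by apply: sphere_disk; exact/set_mem/valP.
have incl_map : gmap (@cells_incl R G J H n).
  split; last by move=> g [j [q d]].
  apply: sigT_slice_continuous => j; apply: discrete_prod_continuous => q d.
  apply: (@continuous_comp _ (discrete_topology (lcosets (H j)) * set_type (disk R n))%type _
    (fun d => (q, sphere_incl d))); last exact: existT_continuous.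
  apply: (@continuous_comp _ (set_type (disk R n)) _ (@sphere_incl R n)
    (fun d => (q : discrete_topology _, d))); last exact: discrete_slice_continuous.
  move: d.
  by apply: continuous_subtype; exact: continuous_set_val.
have sub_map : gmap (sub_incl ST).
  split; last by move=> g x; exact: val_inj.
  by apply: continuous_subtype; exact: continuous_set_val.
have comm : sub_incl ST \o phi = Phi \o @cells_incl R G J H n.
  by apply/funext => -[j [q d]]; exact: val_inj.
exists J, H, phi, Phi; split=> // Y b c bm cm bc.
have cellP (t : sub_gspace (cs_gsubset n.+1)) : ~ sk n (val t) ->
    exists p, odisk n (val (projT2 p).2) /\ Phi p = t.
  move=> nt; have [x [d [cx od e]]] := cf_surj cf (conj (set_mem (valP t)) nt).
  have [p px pd] := pos_surj _ (SigSub (mem_set (odisk_disk od)) : set_type (disk R n)) x cx.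
  exists p; rewrite pd; split=> //; apply: val_inj.
  by rewrite /= /Pv px pd /= -e.
pose h (t : sub_gspace (cs_gsubset n.+1)) : Y :=
  match pselect (sk n (val t)) with
  | left s => b (SigSub (mem_set s))
  | right ns => c (projT1 (cid (cellP t ns))) end.
have hb s : h (sub_incl ST s) = b s.
  rewrite /h; case: pselect => [h0|[]]; last exact: (set_mem (valP (s : set_type (cs_gsubset n)))).
  by congr b; exact: val_inj.
have hc p : h (Phi p) = c p.
  have [od|sd] := disk_case (set_mem (valP (projT2 p).2)).
    rewrite /h; case: pselect => [s|ns].
      by have [] := cf_in cf (pos_ctr _ p) od.
    case: cid => p' /= [od' e]; congr c.
    have [e1 e2] := cf_inj cf (pos_ctr _ p') (pos_ctr _ p) od' od (congr1 val e).
    by apply: pos_inj => //; exact: val_inj.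
  case: p sd => j [q d] /= sd.
  pose p0 : cells H (set_type (sphere R n)) := existT _ j (q, SigSub (mem_set sd)).
  have -> : existT _ j (q, d) = cells_incl p0.
    by rewrite /cells_incl /coprod_map /=; congr (existT _ j _); congr pair; exact: val_inj.
  have /(congr1 (fun k => k p0)) /= <- := comm.
  by rewrite hb; have /(congr1 (fun k => k p0)) /= -> := bc.
have hcover t : (exists s, t = sub_incl ST s) \/ exists p, t = Phi p.
  have [s|/cellP[p [_ e]]] := pselect (sk n (val t)); last by right; exists p.
  by left; exists (SigSub (mem_set s)); exact: val_inj.
exists h; split.
  split; [split|by apply/funext|by apply/funext].
    apply/continuous_closedP => Z cZ.
    apply/closed_subtypeP; exists (val @` (h @^-1` Z)); last first.
      apply/seteqP; split=> t; first by move=> ht; exists t.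
      by move=> [t' ht' /val_inj <-].
    apply: (cs_step cs (n := n)).
    - by move=> _ [t _ <-]; exact: (set_mem (valP (t : set_type (cs_gsubset n.+1)))).
    - have := closed_preim bm.1 cZ; move/closed_subtypeP => [W cW e].
      rewrite (_ : _ `&` _ = W `&` sk n); first by apply: closedI => //; exact: (cs_skel_closed cs).
      have key s : Z (b s) <-> W (val s).
        by rewrite -[Z (b s)]/((b @^-1` Z) s) e.
      apply/seteqP; split=> x.
        move=> [[t ht <-] st]; split=> //.
        have et : t = sub_incl ST (SigSub (mem_set st)) by exact: val_inj.
        by move: ht; rewrite /preimage /= et hb => /key.
      move=> [Wx sx]; split=> //; pose s : sub_gspace (cs_gsubset n) := SigSub (mem_set sx).
      by exists (sub_incl ST s) => //; rewrite /preimage /= hb; apply/key.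
    - move=> x cx.
      have d0 : disk R n 0%R by exact/odisk_disk/odisk0.
      have [[j [q d]] px pd] := pos_surj _ (SigSub (mem_set d0) : set_type (disk R n)) x cx.
      have := closed_preim cm.1 cZ; move/sigT_closedP/(_ j)/discrete_prod_closedP/(_ q).
      move/closed_subtypeP => [W cW e].
      rewrite (_ : _ `&` _ = disk R n `&` W); first by apply: closedI => //; exact: closed_disk.
      have key (d' : set_type (disk R n)) : Z (c (existT _ j (q, d'))) <-> W (val d').
        by have := congr1 (fun A => A d') e => /= <-.
      have Pj d' : chi n x (val d') = val (Phi (existT _ j (q, d'))).
        by rewrite /= /Pv /= -px.
      apply/seteqP; split=> d' [dd].
        move=> [t ht e']; split=> //; apply/(key (SigSub (mem_set dd))).
        rewrite -hc; have <- // : t = Phi (existT _ j (q, SigSub (mem_set dd))).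
        by apply: val_inj; rewrite e' -Pj.
      move=> Wd; split=> //; exists (Phi (existT _ j (q, SigSub (mem_set dd)))).
        by rewrite /preimage /= hc; apply/key.
      by rewrite -Pj.
  move=> g t; have [[s ->]|[p ->]] := hcover t.
    by rewrite -sub_map.2 !hb bm.2.
  by rewrite -Phi_map.2 !hc cm.2.
move=> h' [_ hu' hv']; apply/funext => t; have [[s ->]|[p ->]] := hcover t.
  by rewrite hb -hu'.
by rewrite hc -hv'.
Qed.

Lemma filtration_of_cellular : gcw_filtration R cs_gsubset.
Proof.
apply: (@Build_gcw_filtration R G X cs_gsubset (cs_empty cs) (@cs_incr _ _ _ _ _ _ cs)
  (cs_exhaust cs)).
- move=> Z cZ; apply: (cs_colim cs) => n; rewrite setIC.
  have rc : relclosed (sk n) Z by apply/(@relclosedP X (sk n)); exact: cZ.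
  exact: (relclosed_closed (@cs_skel_closed _ _ _ _ _ _ cs n) rc).
- move=> n; exact: attaches_of_cells.
Qed.

End ToFiltration.

(** * Induced spaces and their cells *)

Section Induced.
Variables (G : groupType) (N : subgroup G) (Y : gspace (sg_type N)).

Lemma ind_closedP (W : set (ind_gspace Y)) :
  closed W <-> forall g : G, closed [set y | W (ind_mk g y)].
Proof.
rewrite -(discrete_prod_closedP [set p : discrete_topology G * Y | W (ind_mk (p.1 : G) p.2)]).
have -> : [set p : discrete_topology G * Y | W (ind_mk (p.1 : G) p.2)] =
    (\pi_(ind Y)%qT : ind_pre Y -> ind Y) @^-1` W.
  by apply/funext => -[g y].
split=> [cW|cp]; first by apply: closed_preim cW; exact: pi_continuous.
rewrite -openC.
have op : open (~` ((\pi_(ind Y)%qT : ind_pre Y -> ind Y) @^-1` W)) by exact: closed_openC.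
exact: op.
Qed.

Lemma ind_gsubsetE (S : gsubset Y) g y :
  gs_set (ind_gsubset S) (ind_mk g y) <-> gs_set S y.
Proof.
split=> [[g' [y' [Sy' /ind_mkP[n [_ e]]]]]|Sy]; last by exists g, y.
have -> : y = gact n^-1%g y' by rewrite e -gactM mulVg gact1.
exact: gs_setP.
Qed.

Lemma ind_repr g y : exists n : sg_type N,
  g = ((repr (ind_mk g y : ind Y)).1 * val n)%g /\
  (repr (ind_mk g y : ind Y)).2 = gact n y.
Proof. by apply/ind_mkP; rewrite ind_mk_repr. Qed.

End Induced.

Section CoprodInd.
Variables (R : realType) (G : groupType) (I : choiceType).
Variables (N : I -> subgroup G) (Y : forall i, gspace (sg_type (N i))).
Let CI : gspace G := coprod_gspace (fun i => ind_gspace (Y i)).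

Definition ind_pt (i : I) (g : G) (y : Y i) : CI :=
  existT (fun i => ind_gspace (Y i) : Type) i (ind_mk g y).

Lemma ind_ptP (p : CI) : exists i g y, p = @ind_pt i g y.
Proof. by case: p => i q; exists i, (repr q).1, (repr q).2; rewrite /ind_pt ind_mk_repr. Qed.

Lemma ind_pt_idx i g y j h z : @ind_pt i g y = @ind_pt j h z -> i = j.
Proof. exact: projT1_eq. Qed.

Lemma ind_pt_eqP i g y h z : @ind_pt i g y = @ind_pt i h z <->
  exists n : sg_type (N i), g = (h * val n)%g /\ z = gact n y.
Proof.
rewrite -ind_mkP; split=> [e|]; last by rewrite /ind_pt => ->.
exact: (eq_from_Tagged e).
Qed.

Lemma ind_pt_act g i h y : gact g (@ind_pt i h y) = ind_pt (g * h)%g y.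
Proof. by rewrite {1}/gact /= /coprod_act /= ind_actE. Qed.

Lemma ind_pt_closedP (W : set CI) :
  closed W <-> forall i g, closed [set y | W (@ind_pt i g y)].
Proof.
rewrite sigT_closedP; split=> h i; first by move: (h i) => /ind_closedP.
by apply/ind_closedP; exact: h.
Qed.

Lemma ind_pt_continuous i g : continuous (@ind_pt i g).
Proof. by apply/continuous_closedP => Z /ind_pt_closedP; exact. Qed.

Section Cells.
Variables (S : forall i, nat -> gsubset (Y i)).
Variables (ctr : forall i, nat -> set (Y i)).
Variables (chi : forall i n, Y i -> 'rV[R]_n -> Y i).
Arguments chi : clear implicits.
Hypothesis cs : forall i, cellular_structure (fun n => gs_set (S i n)) (@ctr i) (chi i).

Definition ind_skel n : gsubset CI := coprod_gsubset (fun i => ind_gsubset (S i n)).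

Definition ind_ctr n : set CI := [set p | ctr n (repr (projT2 p : ind _)).2].

Definition ind_chi n (p : CI) (d : 'rV[R]_n) : CI :=
  ind_pt (repr (projT2 p : ind _)).1 (chi (projT1 p) n (repr (projT2 p : ind _)).2 d).

Arguments ind_chi : clear implicits.

Lemma ind_skelE n i g y : gs_set (ind_skel n) (@ind_pt i g y) <-> gs_set (S i n) y.
Proof. exact: ind_gsubsetE. Qed.

Lemma ind_ctrE n i g y : ind_ctr n (@ind_pt i g y) <-> ctr n y.
Proof.
rewrite /ind_ctr /=; have [m [_ ->]] := ind_repr g y.
have h := fun m z => @cf_ctr_act _ _ _ _ _ _ _ _ (cs_family (cs i) n) m z.
split=> [/(h m^-1%g)|/h]; last exact.
by rewrite -gactM mulVg gact1.
Qed.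

Lemma ind_chiE n i g y d : ctr n y -> disk R n d ->
  ind_chi n (@ind_pt i g y) d = ind_pt g (chi i n y d).
Proof.
move=> cy dd; apply/esym/ind_pt_eqP => /=; have [m [gm ->]] := ind_repr g y.
by exists m; split=> //; rewrite (cf_act (cs_family (cs i) n)).
Qed.

(** The cells are the translates of the cells of the spaces [Y i]. The choice of
   representatives in the definitions is harmless because centres are permuted
   by the group and characteristic maps are equivariant. *)
Lemma ind_cellular :
  cellular_structure (fun n => gs_set (ind_skel n)) ind_ctr ind_chi.
Proof.
split.
- by move=> n g p; exact: gs_setP.
- apply/seteqP; split=> // p; have [i [g [y ->]]] := ind_ptP p.
  by move/ind_skelE; rewrite (cs_empty (cs i)).
- move=> n p; have [i [g [y ->]]] := ind_ptP p.
  by move/ind_skelE => h; apply/ind_skelE; exact: (cs_incr (cs i)).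
- move=> p; have [i [g [y ->]]] := ind_ptP p; have [n h] := cs_exhaust (cs i) y.
  by exists n; apply/ind_skelE.
- move=> n; split.
  + move=> g p; have [i [h [y ->]]] := ind_ptP p.
    by rewrite ind_pt_act !ind_ctrE.
  + move=> g p d; have [i [h [y ->]]] := ind_ptP p.
    by rewrite ind_pt_act => /ind_ctrE cy dd; rewrite !ind_chiE // ind_pt_act.
  + move=> p; have [i [h [y ->]]] := ind_ptP p => /ind_ctrE cy.
    rewrite ind_chiE ?(cf_center (cs_family (cs i) n)) //.
    exact/odisk_disk/odisk0.
  + move=> p d; have [i [h [y ->]]] := ind_ptP p => /ind_ctrE cy sd.
    rewrite ind_chiE //; last exact: sphere_disk.
    by apply/ind_skelE; exact: (cf_sphere (cs_family (cs i) n)).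
  + move=> p d; have [i [h [y ->]]] := ind_ptP p => /ind_ctrE cy od.
    have [h1 h2] := cf_in (cs_family (cs i) n) cy od.
    by rewrite ind_chiE //; [split; rewrite ind_skelE|exact: odisk_disk].
  + move=> p q d e; have [i [g [y ->]]] := ind_ptP p; have [j [h [z ->]]] := ind_ptP q.
    move=> /ind_ctrE cy /ind_ctrE cz od oe.
    rewrite !ind_chiE //; try exact: odisk_disk.
    move=> E; have ij := ind_pt_idx E; case: _ / ij in z cz E *.
    have [m [gm]] := (ind_pt_eqP _ _ _ _).1 E.
    have cf := cs_family (cs i) n.
    rewrite -(cf_act cf) //; last exact: odisk_disk.
    move=> /(cf_inj cf cz (cf_ctr_act cf m cy) oe od) [zE ->].
    by split=> //; apply/ind_pt_eqP; exists m.
  + move=> p; have [i [g [y ->]]] := ind_ptP p => -[/ind_skelE h1 h2].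
    have {}h2 : ~ gs_set (S i n) y by move=> h; apply: h2; apply/ind_skelE.
    have [x [d [cx od ->]]] := cf_surj (cs_family (cs i) n) (conj h1 h2).
    exists (ind_pt g x), d; split=> //; first exact/ind_ctrE.
    by rewrite ind_chiE //; exact: odisk_disk.
  + move=> p Z; have [i [g [y ->]]] := ind_ptP p => /ind_ctrE cy cZ.
    rewrite (_ : _ `&` _ = disk R n `&` chi i n y @^-1` [set y | Z (ind_pt g y)]).
      by apply: (cf_cont (cs_family (cs i) n)) => //; move/ind_pt_closedP: cZ.
    by apply/seteqP; split=> d [dd]; rewrite /preimage /= ind_chiE.
- move=> n Z Zn cZ cells; apply/ind_pt_closedP => i g.
  apply: (cs_step (cs i) (n := n)).
  + by move=> y /Zn /ind_skelE.
  + rewrite (_ : _ `&` _ = [set y | (Z `&` gs_set (ind_skel n)) (ind_pt g y)]).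
      by move/ind_pt_closedP: cZ.
    by apply/seteqP; split=> y [Zy] h; split=> //; apply/(ind_skelE n g y).
  + move=> y cy; have /cells : ind_ctr n (ind_pt g y) by apply/ind_ctrE.
    congr closed; apply/seteqP; split=> d [dd]; rewrite /preimage /= ind_chiE //.
- move=> Z cZ; apply/ind_pt_closedP => i g; apply: (cs_colim (cs i)) => n.
  rewrite (_ : _ `&` _ = [set y | (Z `&` gs_set (ind_skel n)) (ind_pt g y)]).
    by move/ind_pt_closedP: (cZ n).
  by apply/seteqP; split=> y [Zy] h; split=> //; apply/(ind_skelE n g y).
Qed.

End Cells.
End CoprodInd.

Section Restrict.
Variables (R : realType) (N W : groupType) (phi : UMagmaMorphism.type N W).
Variables (X : gspace W) (sk ctr : nat -> set X) (chi : forall n, X -> 'rV[R]_n -> X).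

Lemma res_cellular : cellular_structure sk ctr chi ->
  @cellular_structure R N (res_gspace phi X) sk ctr chi.
Proof.
move=> [h1 h2 h3 h4 h5 h6 h7]; split=> //; first by move=> n g x; exact: h1.
move=> n; have [c1 c2 c3 c4 c5 c6 c7 c8] := h5 n; split=> //.
  by move=> g x; exact: c1.
by move=> g x d; exact: c2.
Qed.

End Restrict.

(** * Pushouts along closed embeddings and their cells *)

Lemma within_closedP (S T : topologicalType) (A : set S) (f : S -> T) :
  closed A ->
  {within A, continuous f} <-> forall Z, closed Z -> closed (A `&` f @^-1` Z).
Proof.
move=> cA; split=> [/continuous_closedP h Z /h|h].
  by rewrite -closed_setSI.
by apply/continuous_closedP => Z /h; rewrite closed_setSI.
Qed.

Lemma ray_continuous (R : realType) n (d : 'rV[R]_n) :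
  continuous (fun s : R => s *: d)%R.
Proof. by move=> s; apply: cvgZr_tmp; exact: cvg_id. Qed.

(** What is used of a pushout along a closed embedding [i]. Unlike a
   universal property among G-spaces, these facts pass to fixed points ([fixed_pushout]). *)
Record closed_pushout (A B C X : topologicalType) (i : A -> B) (F : A -> C)
    (u : B -> X) (v : C -> X) : Prop := {
  cp_i : continuous i;
  cp_F : continuous F;
  cp_u : continuous u;
  cp_v : continuous v;
  cp_comm : forall a, u (i a) = v (F a);
  cp_inj : injective i;
  cp_closed : forall Z, closed Z -> closed (i @` Z);
  cp_cover : forall x, (exists b, x = u b) \/ (exists c, x = v c);
  cp_v_inj : injective v;
  cp_cross : forall b c, u b = v c -> exists2 a, b = i a & c = F a;
  cp_quasi : forall b b', u b = u b' -> b = b' \/ (range i b /\ range i b');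
  cp_detect : forall W, closed (u @^-1` W) -> closed (v @^-1` W) -> closed W }.

Lemma closed_pushout_of_gpushout (G : groupType) (A B C X : gspace G)
    (i : A -> B) (F : A -> C) (u : B -> X) (v : C -> X) :
  gpushout i F u v -> injective i ->
  (forall Z : set A, closed Z -> closed (i @` Z)) -> closed_pushout i F u v.
Proof.
move=> po iI ic; have po' := gpushout_sym po.
have [[[ci _] [cF _]] [[cu _] [cv _]] e _] := po.
split=> //.
- by move=> a; have := congr1 (fun k => k a) e.
- exact: (gpushout_cover po).
- exact: (gpushout_inj po' iI).
- by move=> b c /esym /(gpushout_cross po' iI)[a -> ->]; exists a.
- exact: (gpushout_quasi_inj po' iI).
- exact: (gpushout_closed po).
Qed.

Section PushoutCells.
Variables (R : realType) (G : groupType) (A B C X : gspace G).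
Variables (i : A -> B) (F : A -> C) (u : B -> X) (v : C -> X).
Hypothesis po : closed_pushout i F u v.
Hypotheses (ei : equivariant i) (eu : equivariant u) (ev : equivariant v).
Variables (skA : nat -> set A).
Variables (skB ctrB : nat -> set B) (chiB : forall n, B -> 'rV[R]_n -> B).
Variables (skC ctrC : nat -> set C) (chiC : forall n, C -> 'rV[R]_n -> C).
Arguments chiB : clear implicits.
Arguments chiC : clear implicits.
Hypothesis csB : cellular_structure skB ctrB chiB.
Hypothesis csC : cellular_structure skC ctrC chiC.
Hypothesis skiA : forall n, i @^-1` (skB n) = skA n.
Hypothesis skF : forall n a, skA n a -> skC n (F a).
Hypothesis sat : forall n x d e, ctrB n x -> odisk n d -> odisk n e ->
  range i (chiB n x d) -> range i (chiB n x e).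

Lemma range_act g b : range i (gact g b) <-> range i b.
Proof.
split=> -[a _ e]; last by exists (gact g a); rewrite // ei e.
by exists (gact g^-1%g a); rewrite // ei e -gactM mulVg gact1.
Qed.

Definition po_skel n : set X := u @` skB n `|` v @` skC n.

Lemma po_skel_v n c : po_skel n (v c) <-> skC n c.
Proof.
split=> [[[b sb /(cp_cross po)[a ba ->]]|[c' sc /(cp_v_inj po) <-//]]|sc].
  by apply: skF; rewrite -skiA /preimage /= -ba.
by right; exists c.
Qed.

Lemma po_skel_u n b : ~ range i b -> po_skel n (u b) <-> skB n b.
Proof.
move=> nb; split=> [[[b' sb /(cp_quasi po)[<-//|[_ //]]]|]|sb].
  by move=> [c sc /esym /(cp_cross po)[a ba _]]; case: nb; exists a.
by left; exists b.
Qed.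

Lemma po_skel_u' n b : skB n b -> po_skel n (u b).
Proof. by left; exists b. Qed.

Definition po_ctr n : set X := u @` (ctrB n `\` range i) `|` v @` ctrC n.

Definition po_chi n (x : X) (d : 'rV[R]_n) : X :=
  if pselect (exists c, x = v c) is left h then v (chiC n (projT1 (cid h)) d)
  else if pselect (exists b, x = u b) is left h
  then u (chiB n (projT1 (cid h)) d) else x.
Arguments po_chi : clear implicits.

Lemma po_chi_v n c d : po_chi n (v c) d = v (chiC n c d).
Proof.
rewrite /po_chi; case: pselect => [h|[]]; last by exists c.
by case: cid => c' /= /(cp_v_inj po) ->.
Qed.

Lemma po_chi_u n b d : ~ range i b -> po_chi n (u b) d = u (chiB n b d).
Proof.
move=> nb; rewrite /po_chi; case: pselect => [h|_].
  by have [c /(cp_cross po)[a ba _]] := h; case: nb; exists a.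
case: pselect => [h|[]]; last by exists b.
by case: cid => b' /= e; have [<- //|[/nb]] := cp_quasi po e.
Qed.

Lemma po_ctr_v n c : po_ctr n (v c) <-> ctrC n c.
Proof.
split=> [[[b [_ nb] /(cp_cross po)[a ba _]]|[c' sc /(cp_v_inj po) <-//]]|sc].
  by case: nb; exists a.
by right; exists c.
Qed.

Lemma po_ctr_u n b : ctrB n b -> ~ range i b -> po_ctr n (u b).
Proof. by move=> cb nb; left; exists b. Qed.

Lemma po_cell_range n b d : ctrB n b -> ~ range i b -> odisk n d ->
  ~ range i (chiB n b d).
Proof.
move=> cb nb od rd; apply: nb.
rewrite -(cf_center (cs_family csB n) cb).
by apply: sat rd => //; exact: odisk0.
Qed.

(** The cells are those of [C] and the cells of [B] outside of the subcomplex [A].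
   To see that a set is closed one first treats its preimage in [C]; the trace
   on [A] of its preimage in [B] is then closed, which leaves the cells of [B]
   outside of [A]. *)
Lemma pushout_cellular : cellular_structure po_skel po_ctr po_chi.
Proof.
split.
- move=> n g _ [[b sb <-]|[c sc <-]]; rewrite -?eu -?ev.
    by apply: po_skel_u'; exact: (cs_skel_act csB).
  by apply/po_skel_v; exact: (cs_skel_act csC).
- by rewrite /po_skel (cs_empty csB) (cs_empty csC) !image_set0 setU0.
- move=> n _ [[b sb <-]|[c sc <-]].
    by apply: po_skel_u'; exact: (cs_incr csB).
  by apply/po_skel_v; exact: (cs_incr csC).
- move=> x; have [[b ->]|[c ->]] := cp_cover po x.
    by have [n h] := cs_exhaust csB b; exists n; exact: po_skel_u'.
  by have [n h] := cs_exhaust csC c; exists n; exact/po_skel_v.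
- move=> n; have cfB := cs_family csB n; have cfC := cs_family csC n; split.
  + move=> g _ [[b [cb nb] <-]|[c cc <-]]; rewrite -?eu -?ev.
      apply: po_ctr_u; first exact: (cf_ctr_act cfB).
      by move/range_act.
    by apply/po_ctr_v; exact: (cf_ctr_act cfC).
  + move=> g _ d [[b [cb nb] <-]|[c cc <-]] dd; rewrite -?eu -?ev.
      by rewrite !po_chi_u -?eu ?(cf_act cfB) // => /range_act.
    by rewrite !po_chi_v -ev (cf_act cfC).
  + move=> _ [[b [cb nb] <-]|[c cc <-]].
      by rewrite po_chi_u // (cf_center cfB).
    by rewrite po_chi_v (cf_center cfC).
  + move=> _ d [[b [cb nb] <-]|[c cc <-]] sd.
      by rewrite po_chi_u //; apply: po_skel_u'; exact: (cf_sphere cfB).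
    by rewrite po_chi_v; apply/po_skel_v; exact: (cf_sphere cfC).
  + move=> _ d [[b [cb nb] <-]|[c cc <-]] od.
      rewrite po_chi_u //; have nr := po_cell_range cb nb od.
      have [h1 h2] := cf_in cfB cb od.
      by split; [apply/po_skel_u|move/po_skel_u => /(_ nr)].
    rewrite po_chi_v; have [h1 h2] := cf_in cfC cc od.
    by split; [apply/po_skel_v|move/po_skel_v].
  + move=> _ _ d e [[b [cb nb] <-]|[c cc <-]] [[b' [cb' nb'] <-]|[c' cc' <-]] od oe;
      rewrite ?po_chi_u // ?po_chi_v.
    * case/(cp_quasi po) => [/(cf_inj cfB cb cb' od oe)[-> ->]//|[h _]].
      by case: (po_cell_range cb nb od).
    * move=> /(cp_cross po)[a ea _]; case: (po_cell_range cb nb od).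
      by rewrite ea; exists a.
    * move=> /esym/(cp_cross po)[a ea _]; case: (po_cell_range cb' nb' oe).
      by rewrite ea; exists a.
    * by move=> /(cp_v_inj po) /(cf_inj cfC cc cc' od oe)[-> ->].
  + move=> x [Tx Sx]; have [[c xc]|nx] := pselect (exists c, x = v c).
      rewrite xc in Tx Sx *; have nc : ~ skC n c by move=> h; apply: Sx; apply/po_skel_v.
      have [y [d [cy od ->]]] := cf_surj cfC (conj ((po_skel_v _ _).1 Tx) nc).
      by exists (v y), d; split=> //; [apply/po_ctr_v|rewrite po_chi_v].
    have [[b xb]|//] := cp_cover po x; rewrite xb in nx Tx Sx *.
    have nb : ~ range i b by move=> [a _ e]; apply: nx; exists (F a); rewrite -e (cp_comm po).
    have nc : ~ skB n b by move=> h; apply: Sx; apply/po_skel_u.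
    have [y [d [cy od e]]] := cf_surj cfB (conj ((po_skel_u _ nb).1 Tx) nc).
    have ny : ~ range i y.
      move=> h; apply: nb; rewrite e; apply: (sat cy (@odisk0 R n) od).
      by rewrite (cf_center cfB).
    by exists (u y), d; split=> //; [exact: po_ctr_u|rewrite po_chi_u // e].
  + move=> _ Z [[b [cb nb] <-]|[c cc <-]] cZ.
      rewrite (_ : po_chi n (u b) = u \o chiB n b); last by apply/funext => d; exact: po_chi_u.
      exact: (cf_cont cfB cb (closed_preim (cp_u po) cZ)).
    rewrite (_ : po_chi n (v c) = v \o chiC n c); last by apply/funext => d; exact: po_chi_v.
    exact: (cf_cont cfC cc (closed_preim (cp_v po) cZ)).
- move=> n Z Zn cZ cells.
  have cv : closed (v @^-1` Z).
    apply: (cs_step csC (n := n)).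
    + by move=> c /Zn /po_skel_v.
    + rewrite (_ : _ `&` _ = v @^-1` (Z `&` po_skel n) `&` skC n).
        by apply: closedI; [exact: closed_preim (cp_v po) cZ|exact: (cs_skel_closed csC)].
      apply/seteqP; split=> c; first by move=> [Zc sc]; split=> //; split=> //; apply/po_skel_v.
      by move=> [[]].
    + move=> c cc; have /cells : po_ctr n (v c) by apply/po_ctr_v.
      by congr closed; apply/seteqP; split=> d [dd]; rewrite /preimage /= po_chi_v.
  have cA : closed (i @` (F @^-1` (v @^-1` Z))).
    by apply: (cp_closed po); exact: closed_preim (cp_F po) cv.
  apply: (cp_detect po) => //.
  rewrite (_ : u @^-1` Z = (u @^-1` Z `&` skB n.+1) `|` i @` (F @^-1` (v @^-1` Z))); last first.
    apply/seteqP; split=> b; last by move=> [[]//|[a Za <-]]; rewrite /preimage /= (cp_comm po).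
    move=> Zb; have [[a _ e]|nb] := pselect (range i b); [right|left].
      by exists a => //; rewrite /preimage /= -(cp_comm po) e.
    by split=> //; apply/po_skel_u => //; exact: Zn.
  apply: closedU => //; apply: (cs_step csB (n := n)).
  + by move=> b [].
  + rewrite (_ : _ `&` _ = u @^-1` (Z `&` po_skel n) `&` skB n).
      by apply: closedI; [exact: closed_preim (cp_u po) cZ|exact: (cs_skel_closed csB)].
    apply/seteqP; split=> b.
      by move=> [[Zb _] sb]; split=> //; split=> //; exact: po_skel_u'.
    by move=> [[Zb _] sb]; split=> //; split=> //; exact: (cs_incr csB).
  + move=> b cb; have cfB := cs_family csB n.
    have [rb|nb] := pselect (range i b); last first.
      have /cells : po_ctr n (u b) by exact: po_ctr_u.
      congr closed; apply/seteqP; split=> d [dd]; rewrite /preimage /= po_chi_u // => Zd.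
        by split=> //; split=> //; exact: (cs_skel_chi csB).
      by case: Zd.
    rewrite (_ : _ `&` _ = (disk R n `&` chiB n b @^-1` (i @` (F @^-1` (v @^-1` Z)))) `|`
        (sphere R n `&` (disk R n `&` chiB n b @^-1` (u @^-1` (Z `&` po_skel n))))).
      apply: closedU; first exact: (cf_cont cfB cb cA).
      apply: closedI; first exact: closed_sphere.
      exact: (cf_cont cfB cb (closed_preim (cp_u po) cZ)).
    apply/seteqP; split=> d.
      move=> [dd [Zd _]]; have [od|sd] := disk_case dd; last first.
        right; split=> //; split=> //; split=> //.
        by apply: po_skel_u'; exact: (cf_sphere cfB).
      left; split=> //; have [a _ e] : range i (chiB n b d).
        by apply: (sat cb (@odisk0 R n) od); rewrite (cf_center cfB).
      by exists a => //; rewrite /preimage /= -(cp_comm po) e.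
    move=> [[dd [a Za e]]|[sd [dd [Zd _]]]]; split=> //; split=> //;
      try exact: (cs_skel_chi csB).
    by rewrite /preimage /= -e (cp_comm po).
- move=> Z cZ; apply: (cp_detect po).
    apply: (cs_colim csB) => n.
    rewrite (_ : _ `&` _ = u @^-1` (Z `&` po_skel n) `&` skB n).
      by apply: closedI; [exact: closed_preim (cp_u po) (cZ n)|exact: (cs_skel_closed csB)].
    apply/seteqP; split=> b; last by move=> [[]].
    by move=> [Zb sb]; split=> //; split=> //; exact: po_skel_u'.
  apply: (cs_colim csC) => n.
  rewrite (_ : _ `&` _ = v @^-1` (Z `&` po_skel n) `&` skC n).
    by apply: closedI; [exact: closed_preim (cp_v po) (cZ n)|exact: (cs_skel_closed csC)].
  apply/seteqP; split=> c; last by move=> [[]].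
  by move=> [Zc sc]; split=> //; split=> //; apply/po_skel_v.
Qed.

End PushoutCells.

Section Saturated.
Local Open Scope ring_scope.
Variables (R : realType) (G : groupType) (X : gspace G).
Variables (sk ctr : nat -> set X) (chi : forall n, X -> 'rV[R]_n -> X).
Arguments chi : clear implicits.
Hypothesis cs : cellular_structure sk ctr chi.

Lemma odiskZ n (s : R) (d : 'rV[R]_n) : 0 <= s <= 1 -> odisk n d -> odisk n (s *: d).
Proof.
move=> /andP[s0 s1]; rewrite /odisk /= sqnormZ; apply: le_lt_trans.
by rewrite ler_piMl ?sqnorm_ge0 // expr_le1.
Qed.

Lemma cell_connected n x d : ctr n x -> odisk n d ->
  connected_component (sk n.+1 `\` sk n) x (chi n x d).
Proof.
move=> cx od; have cf := cs_family cs n.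
exists [set chi n x (s *: d) | s in `[0, 1]]; last first.
  by exists 1; rewrite ?scale1r //= in_itv /= ler01 lexx.
split.
- by exists 0; rewrite ?scale0r ?(cf_center cf) //= in_itv /= ler01 lexx.
- move=> y [s /=]; rewrite in_itv /= => s01 <-.
  by apply: (cf_in cf) => //; exact: odiskZ.
apply: connected_continuous_connected; first exact: segment_connected.
apply/within_closedP; first exact: itv_closed.
move=> Z cZ; rewrite (_ : _ `&` _ = `[0, 1] `&`
    ( *:%R^~ d) @^-1` (disk R n `&` chi n x @^-1` Z)).
  apply: closedI; first exact: itv_closed.
  apply: closed_preim (cf_cont cf cx cZ); exact: ray_continuous.
apply/seteqP; split=> s; last by move=> [s01 []].
move=> [s01 Zs]; split=> //; split=> //; apply: odisk_disk; apply: odiskZ => //.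
Qed.

(** An open cell is connected, each of its points being joined to the centre by
   the image of a ray. *)
Lemma saturated_cells (U : set X) :
  (forall n x, (sk n.+1 `\` sk n) x -> U x ->
     connected_component (sk n.+1 `\` sk n) x `<=` U) ->
  forall n x d e, ctr n x -> odisk n d -> odisk n e ->
  U (chi n x d) -> U (chi n x e).
Proof.
move=> h n x d e cx od oe Ud; have cf := cs_family cs n.
apply: (h n (chi n x d)) => //; first exact: (cf_in cf).
apply: (connected_component_trans (y := x)); last exact: cell_connected.
by apply: connected_component_sym; exact: cell_connected.
Qed.

End Saturated.

Local Open Scope ring_scope.

(** * Maps from a product with the line; retraction of a disk cylinder *)

Section ProductWithLine.
Variable R : realType.

Lemma closed_proj (P T : topologicalType) (K : set T) (E : set (P * T)) :
  compact K -> closed E -> closed [set p | exists2 t, K t & E (p, t)].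
Proof.
move=> /compact_near_coveringP cK cE.
rewrite -openC openE => p np; rewrite /interior.
have h : forall t, K t -> \forall t' \near t & q \near nbhs p, ~ E (q, t').
  move=> t Kt; have oE : open (~` E) by exact: closed_openC.
  have : nbhs (p, t) (~` E).
    by apply: open_nbhs_nbhs; split=> // Ept; apply: np; exists t.
  case=> -[U V] /= [Up Vt] UV; exists (V, U) => //= -[t' q] [/= Vt' Uq].
  exact: (UV (q, t')).
have := cK P (nbhs p) (fun q t => ~ E (q, t)) (nbhs_filter p) h.
by move=> hK; apply: filterS hK => q hq [t Kt Eqt]; exact: (hq t Kt).
Qed.

(** A product of quotient maps need not be one, but the line is locally compact:
   by the tube lemma, the points over which some value on a compact interval is
   not in a given open set form a closed set, because the family detects it. *)
Lemma continuous_of_detection (I : Type) (Q Y : topologicalType) (P : I -> topologicalType)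
    (q : forall i, P i -> Q) (f : Q * R -> Y) :
  (forall W : set Q, (forall i, closed (q i @^-1` W)) -> closed W) ->
  (forall i, continuous (q i)) ->
  (forall x, exists i p, x = q i p) ->
  (forall i, continuous (fun p : P i * R => f (q i p.1, p.2))) ->
  continuous f.
Proof.
move=> det cq cov cf; apply/continuousP => O oO.
rewrite openE => -[x0 t0] Ofx; rewrite /interior.
have [i0 [p0 e0]] := cov x0.
have oS : open [set t | O (f (x0, t))].
  rewrite e0; apply: (open_preim (f := fun t => f (q i0 p0, t)) _ oO).
  move=> t.
  apply: (@continuous_comp R (P i0 * R)%type Y (fun t => (p0, t)) (fun p => f (q i0 p.1, p.2))).
    by move: t; apply: pair_continuous => t; [exact: cvg_cst|exact: cvg_id].
  exact: cf.
have /nbhs_ballP[e /= e_gt0 be] : nbhs t0 [set t | O (f (x0, t))].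
  exact: open_nbhs_nbhs.
pose K : set R := [set` `[(t0 : R) - e / 2, (t0 : R) + e / 2]].
have e2 : 0 < e / 2 by rewrite divr_gt0.
have KO t : K t -> O (f (x0, t)).
  rewrite /K /= in_itv /= => /andP[h1 h2]; apply: be.
  rewrite /ball /= distrC (@le_lt_trans _ _ (e / 2)) //.
    by rewrite ler_distl h1 h2.
  by rewrite ltr_pdivrMr // ltr_pMr // ltr1n.
have nK : nbhs t0 K.
  apply/nbhs_ballP; exists (e / 2) => // t.
  rewrite /ball /= /K /= in_itv /= distrC ltr_distl => /andP[h1 h2].
  by rewrite !ltW.
pose W := [set x | exists2 t, K t & (~` (f @^-1` O)) (x, t)].
have cW : closed W.
  apply: det => i.
  apply: (@closed_proj (P i) R K (fun p => ~ O (f (q i p.1, p.2)))).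
    exact: segment_compact.
  apply: open_closedC; exact: open_preim (cf i) oO.
exists (~` W, K) => /=.
  split=> //; apply: open_nbhs_nbhs; split; first exact: closed_openC.
  by move=> [t Kt]; apply; exact: KO.
move=> [x t] [/= nW Kt]; apply: contrapT => nO; apply: nW.
by exists t.
Qed.

End ProductWithLine.

Section DiskRetraction.
Variable R : realType.

Definition clamp (t : R) : R := Num.max 0 (Num.min 1 t).

Lemma clamp_ge0 t : 0 <= clamp t.
Proof. by rewrite /clamp le_max lexx. Qed.

Lemma clamp_le1 t : clamp t <= 1.
Proof. by rewrite /clamp ge_max ler01 ge_min lexx. Qed.

Lemma clamp_id t : 0 <= t <= 1 -> clamp t = t.
Proof. by move=> /andP[h0 h1]; rewrite /clamp (min_idPr h1) (max_idPr h0). Qed.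

Lemma clamp_clamp t : clamp (clamp t) = clamp t.
Proof. by apply: clamp_id; rewrite clamp_ge0 clamp_le1. Qed.

Lemma clamp_le0E t : t <= 0 -> clamp t = 0.
Proof.
move=> h; rewrite /clamp; apply/max_idPl.
by rewrite ge_min h orbT.
Qed.

Lemma clamp_ge1E t : 1 <= t -> clamp t = 1.
Proof. by move=> h; rewrite /clamp (min_idPl h); apply/max_idPr; exact: ler01. Qed.

Lemma clamp_continuous : continuous clamp.
Proof.
move=> t; apply: (@continuous_max R R (cst 0) (fun t : R^o => Num.min 1 t) t).
  exact: cvg_cst.
apply: (@continuous_min R R (cst 1) (fun t : R^o => t) t); [exact: cvg_cst|exact: cvg_id].
Qed.

Variable n : nat.
Implicit Type d : 'rV[R]_n.

(** The radial projection from the point [(0, 2)] of the cylinder over the disk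
   onto its bottom and its wall divides both [d] and [2 - t] by this factor. *)
Definition ret_scale d (t : R) : R :=
  Num.max (Num.sqrt (sqnorm d)) (1 - clamp t / 2).
Definition ret_disk d t : 'rV[R]_n := (ret_scale d t)^-1 *: d.
Definition ret_time d t : R := 2 - (2 - clamp t) / ret_scale d t.

Lemma ret_scale_ge d t : 1 - clamp t / 2 <= ret_scale d t.
Proof. by rewrite /ret_scale le_max lexx orbT. Qed.

Lemma half_gt0 t : 0 < 1 - clamp t / 2.
Proof.
rewrite subr_gt0 ltr_pdivrMr // mul1r.
by rewrite (le_lt_trans (clamp_le1 t)) // ltr1n.
Qed.

Lemma ret_scale_gt0 d t : 0 < ret_scale d t.
Proof. exact: lt_le_trans (half_gt0 t) (ret_scale_ge d t). Qed.

Lemma ret_scale_disk1 d t : disk R n d -> ret_scale d t <= 1.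
Proof.
move=> dd; rewrite /ret_scale ge_max; apply/andP; split.
  by rewrite -[leRHS]sqrtr1 ler_wsqrtr.
by rewrite lerBlDr lerDl divr_ge0 ?clamp_ge0.
Qed.

Lemma ret_disk_in d t : disk R n (ret_disk d t).
Proof.
rewrite diskE /preimage /= sqnormZ exprVn mulrC ler_pdivrMr ?exprn_gt0 ?ret_scale_gt0 //.
rewrite mul1r -[leLHS]sqr_sqrtr ?sqnorm_ge0 //.
rewrite ler_pXn2r // ?nnegrE ?sqrtr_ge0 ?(ltW (ret_scale_gt0 d t)) //.
by rewrite /ret_scale le_max lexx.
Qed.

Lemma ret_sphere d t : ret_time d t != 0 -> sphere R n (ret_disk d t).
Proof.
rewrite /ret_time subr_eq0 => h.
have sE : ret_scale d t = Num.sqrt (sqnorm d).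
  rewrite /ret_scale; apply/max_idPl; rewrite leNgt; apply: contra h => h.
  rewrite /ret_scale (max_idPr (ltW h)) (_ : 2 - clamp t = 2 * (1 - clamp t / 2)); last lra.
  by rewrite mulfK // gt_eqF // half_gt0.
have s0 := ret_scale_gt0 d t.
rewrite /sphere /= -/(sqnorm _) sqnormZ exprVn -[sqnorm d]sqr_sqrtr ?sqnorm_ge0 //.
by rewrite -sE mulVf // expf_neq0 // gt_eqF.
Qed.

Lemma ret_scale1 d t : disk R n d -> clamp t = 0 \/ sphere R n d ->
  ret_scale d t = 1.
Proof.
move=> dd [t0|sd]; apply/eqP; rewrite eq_le ret_scale_disk1 //= /ret_scale le_max.
  by rewrite t0 mul0r subr0 lexx orbT.
by rewrite (_ : sqnorm d = 1) // sqrtr1 lexx.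
Qed.

Lemma ret_fix d t : disk R n d -> clamp t = 0 \/ sphere R n d ->
  ret_disk d t = d /\ ret_time d t = clamp t.
Proof.
move=> dd h; rewrite /ret_disk /ret_time ret_scale1 // invr1 scale1r mulr1.
by rewrite opprB addrC subrK.
Qed.

Lemma ret_scale_continuous : continuous (fun p : 'rV[R]_n * R => ret_scale p.1 p.2).
Proof.
move=> p; apply: (@continuous_max R _ (fun p : 'rV[R]_n * R => Num.sqrt (sqnorm p.1))
  (fun p : 'rV[R]_n * R => 1 - clamp p.2 / 2) p).
  apply: (@continuous_comp _ _ _ (fun p : 'rV[R]_n * R => sqnorm p.1)); last exact: sqrt_continuous.
  apply: (@continuous_comp _ _ _ (fun p : 'rV[R]_n * R => p.1)); last exact: sqnorm_continuous.
  exact: cvg_fst.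
apply: cvgB; first exact: cvg_cst.
apply: cvgM; last exact: cvg_cst.
apply: (@continuous_comp _ _ _ (fun p : 'rV[R]_n * R => p.2)); last exact: clamp_continuous.
exact: cvg_snd.
Qed.

Lemma ret_disk_continuous : continuous (fun p : 'rV[R]_n * R => ret_disk p.1 p.2).
Proof.
move=> p; apply: (@cvgZ R _ _ _ _ (fun p : 'rV[R]_n * R => (ret_scale p.1 p.2)^-1)
  (fun p : 'rV[R]_n * R => p.1)); last exact: cvg_fst.
by apply: cvgV; [rewrite gt_eqF ?ret_scale_gt0|exact: ret_scale_continuous].
Qed.

Lemma ret_time_continuous : continuous (fun p : 'rV[R]_n * R => ret_time p.1 p.2).
Proof.
move=> p; apply: cvgB; first exact: cvg_cst.
apply: cvgM; last first.
  by apply: cvgV; [rewrite gt_eqF ?ret_scale_gt0|exact: ret_scale_continuous].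
apply: cvgB; first exact: cvg_cst.
apply: (@continuous_comp _ _ _ (fun p : 'rV[R]_n * R => p.2)); last exact: clamp_continuous.
exact: cvg_snd.
Qed.

Lemma disk_odisk_closure (K : set 'rV[R]_n) :
  closed K -> odisk n `<=` K -> disk R n `<=` K.
Proof.
move=> cK oK d /disk_case[/oK//|sd].
have cf := closed_preim (@ray_continuous R n d) cK.
suff : ((fun s : R => s *: d) @^-1` K) 1 by rewrite /preimage /= scale1r.
apply: cf => B /nbhs_ballP[e /= e0 be].
pose m := Num.min e 1; have m0 : 0 < m by rewrite lt_min e0 ltr01.
have m1 : m <= 1 by rewrite ge_min lexx orbT.
have mh : m / 2 < m by rewrite ltr_pdivrMr // ltr_pMr // ltr1n.
have mh0 : 0 < m / 2 by rewrite divr_gt0.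
exists (1 - m / 2); split; last first.
  apply: be; rewrite /ball /= opprB addrC subrK gtr0_norm //.
  by rewrite (lt_le_trans mh) // ge_min lexx.
apply: oK; rewrite /odisk /= sqnormZ (_ : sqnorm d = 1) // mulr1.
rewrite expr_lt1 //; first by rewrite ltrBlDr ltrDl.
by rewrite subr_ge0 ltW // (lt_le_trans mh).
Qed.

End DiskRetraction.

(** * Equivariant homotopy extension *)

Section Retraction.
Variables (R : realType) (G : groupType) (X : gspace G).
Variables (sk ctr : nat -> set X) (chi : forall n, X -> 'rV[R]_n -> X).
Arguments chi : clear implicits.
Hypothesis cs : cellular_structure sk ctr chi.
Variable U : set X.
Hypothesis Uc : closed U.
Hypothesis Uact : forall g x, U (gact g x) <-> U x.
Hypothesis Usat : forall n x d e, ctr n x -> odisk n d -> odisk n e ->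
  U (chi n x d) -> U (chi n x e).

Definition coord n (x : X) : X * 'rV[R]_n :=
  if pselect (exists p : X * 'rV[R]_n,
       [/\ ctr n p.1, odisk n p.2 & x = chi n p.1 p.2]) is left h
  then projT1 (cid h) else (x, 0).

Lemma coordE n c d : ctr n c -> odisk n d -> coord n (chi n c d) = (c, d).
Proof.
move=> cc od; rewrite /coord; case: pselect => [h|[]]; last by exists (c, d).
case: cid => -[c' d'] /= [cc' od' e].
by have [-> ->] := cf_inj (cs_family cs n) cc cc' od od' e.
Qed.

Lemma coordP n x : sk n.+1 x -> ~ sk n x ->
  exists c d, [/\ ctr n c, odisk n d, x = chi n c d & coord n x = (c, d)].
Proof.
move=> h1 h2; have [c [d [cc od ->]]] := cf_surj (cs_family cs n) (conj h1 h2).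
by exists c, d; split=> //; exact: coordE.
Qed.

(** A retraction onto the bottom and the part over [U], by recursion on skeleta.
   A point over an open cell outside of [U] is projected radially; if it hits the
   wall of the cylinder, it lies over the previous skeleton and moves on. *)
Fixpoint retr (n : nat) (x : X) (t : R) : X * R :=
  if n is m.+1 then
    if pselect (sk m x) then retr m x t
    else if pselect (U x) then (x, clamp t)
    else let p := coord m x in
      if ret_time p.2 t == 0 then (chi m p.1 (ret_disk p.2 t), 0)
      else retr m (chi m p.1 (ret_disk p.2 t)) (ret_time p.2 t)
  else (x, clamp t).

Lemma cell_in_U n c d : ctr n c -> U c -> disk R n d -> U (chi n c d).
Proof.
move=> cc Uc' dd; have cf := cs_family cs n.
have [] : (disk R n `&` chi n c @^-1` U) d; last by [].
apply: (disk_odisk_closure (cf_cont cf cc Uc)) dd => e oe.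
split; first exact: odisk_disk.
by apply: (Usat cc (@odisk0 R n) oe); rewrite (cf_center cf).
Qed.

Lemma cell_notin_U n c d : ctr n c -> ~ U c -> odisk n d -> ~ U (chi n c d).
Proof.
move=> cc Uc' od h; apply: Uc'; rewrite -(cf_center (cs_family cs n) cc).
exact: (Usat cc od (@odisk0 R n) h).
Qed.

Lemma retr_skel m x t : sk m x -> retr m.+1 x t = retr m x t.
Proof. by move=> h /=; case: pselect. Qed.

Lemma retr_le m n x t : (m <= n)%N -> sk m x -> retr n x t = retr m x t.
Proof.
move=> /subnK <-; elim: (n - m)%N => [//|k IH] h.
by rewrite addSn retr_skel ?IH //; apply: (cs_skel_le cs _ h); rewrite leq_addl.
Qed.

Lemma retr_new m c d t : ctr m c -> odisk m d -> retr m.+1 (chi m c d) t =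
  if pselect (U c) then (chi m c d, clamp t)
  else if ret_time d t == 0 then (chi m c (ret_disk d t), 0)
  else retr m (chi m c (ret_disk d t)) (ret_time d t).
Proof.
move=> cc od /=; have [_ ns] := cf_in (cs_family cs m) cc od.
case: pselect => //= _; rewrite coordE //=.
case: (pselect (U c)) => [Uc'|nU]; case: (pselect (U (chi m c d))) => //.
  by move=> h; case: (h); apply: cell_in_U => //; exact: odisk_disk.
by move=> h; case: (cell_notin_U cc nU od).
Qed.

Lemma retr_clamp n x t : retr n x (clamp t) = retr n x t.
Proof.
elim: n x t => [|n IH] x t /=; first by rewrite clamp_clamp.
by rewrite IH /ret_disk /ret_time /ret_scale clamp_clamp.
Qed.

Lemma retr_0 n x t : sk n x -> clamp t = 0 -> retr n x t = (x, 0).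
Proof.
elim: n x t => [|n IH] x t; first by move=> _ /= ->.
move=> sx t0; have [s|ns] := pselect (sk n x); first by rewrite retr_skel // IH.
have [c [d [cc od -> _]]] := coordP sx ns; rewrite retr_new //.
case: pselect => [/= _|/= _]; first by rewrite t0.
have [-> ->] := ret_fix (odisk_disk od) (or_introl t0).
by rewrite t0 eqxx.
Qed.

Lemma retr_U n x t : sk n x -> U x -> retr n x t = (x, clamp t).
Proof.
elim: n x t => [//|n IH] x t sx Ux; have [s|ns] := pselect (sk n x).
  by rewrite retr_skel // IH.
have [c [d [cc od e _]]] := coordP sx ns; rewrite e retr_new //.
case: pselect => // nU; move: Ux; rewrite e => Ux.
by case: (cell_notin_U cc nU od).
Qed.

Lemma retr_boundary n c d t : ctr n c -> disk R n d -> ret_time d t != 0 ->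
  sk n (chi n c (ret_disk d t)).
Proof. by move=> cc dd /ret_sphere h; exact: (cf_sphere (cs_family cs n)). Qed.

(** The recursive formula for an open cell holds on the closed cell, since the
   radial projection fixes the wall. This form can be tested for continuity on
   the closed disk. *)
Lemma retr_cell m c d t : ctr m c -> ~ U c -> disk R m d ->
  retr m.+1 (chi m c d) t =
  if ret_time d t == 0 then (chi m c (ret_disk d t), 0)
  else retr m (chi m c (ret_disk d t)) (ret_time d t).
Proof.
move=> cc nU dd; have [od|sd] := disk_case dd.
  by rewrite retr_new //; case: pselect.
have s := cf_sphere (cs_family cs m) cc sd.
rewrite retr_skel //; have [-> ->] := @ret_fix R m d t dd (or_intror sd).
by case: eqP => [t0|_]; rewrite ?retr_clamp // retr_0.
Qed.

Lemma retr_target n x t : sk n x -> (retr n x t).2 = 0 \/ U (retr n x t).1.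
Proof.
elim: n x t => [|n IH] x t; first by rewrite (cs_empty cs).
move=> sx; have [s|ns] := pselect (sk n x); first by rewrite retr_skel //; exact: IH.
have [c [d [cc od -> _]]] := coordP sx ns; rewrite retr_new //.
case: pselect => [Uc'|/= _]; first by right; apply: cell_in_U => //; exact: odisk_disk.
case: eqP => [_|/eqP nt]; first by left.
by apply: IH; exact: (retr_boundary cc (odisk_disk od) nt).
Qed.

Lemma retr_range n x t : sk n x -> 0 <= (retr n x t).2 <= 1.
Proof.
elim: n x t => [|n IH] x t; first by rewrite (cs_empty cs).
move=> sx; have [s|ns] := pselect (sk n x); first by rewrite retr_skel //; exact: IH.
have [c [d [cc od -> _]]] := coordP sx ns; rewrite retr_new //.
case: pselect => [/= _|/= _]; first by rewrite /= clamp_ge0 clamp_le1.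
case: eqP => [_|/eqP nt]; first by rewrite /= lexx ler01.
by apply: IH; exact: (retr_boundary cc (odisk_disk od) nt).
Qed.

Lemma retr_act n g x t : sk n x ->
  retr n (gact g x) t = (gact g (retr n x t).1, (retr n x t).2).
Proof.
elim: n x t => [|n IH] x t; first by rewrite (cs_empty cs).
move=> sx; have [s|ns] := pselect (sk n x).
  by rewrite !retr_skel // ?IH //; exact: (cs_skel_act cs).
have [c [d [cc od -> _]]] := coordP sx ns.
have cf := cs_family cs n; have dd := odisk_disk od.
rewrite -(cf_act cf) // !retr_new //; last exact: (cf_ctr_act cf).
case: (pselect (U c)) => Uc'; case: pselect => h /=.
- by rewrite /= (cf_act cf).
- by case: h; apply/Uact.
- by move/Uact: h.
- rewrite (cf_act cf) //; last exact: ret_disk_in.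
  by case: eqP => [//|/eqP nt]; rewrite IH //; exact: (retr_boundary cc dd nt).
Qed.

Lemma paste_continuous (S T : topologicalType) (E F : set S) (f g : S -> T)
    (h : set_type F -> T) :
  closed E -> closed F -> (forall x, E x \/ F x) ->
  continuous g -> continuous h ->
  (forall x, E x -> f x = g x) -> (forall x : set_type F, f (val x) = h x) ->
  continuous f.
Proof.
move=> cE cF cov cg ch fg fh; apply/continuous_closedP => Z cZ.
rewrite (_ : f @^-1` Z = (E `&` g @^-1` Z) `|` (F `&` f @^-1` Z)).
  apply: closedU; first by apply: closedI => //; exact: closed_preim cg cZ.
  apply/closed_subtype => //.
  rewrite (_ : _ @^-1` _ = h @^-1` Z); first exact: closed_preim ch cZ.
  by apply/funext => x; rewrite /preimage /= -fh.
apply/seteqP; split=> x.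
  move=> Zx; have [Ex|Fx] := cov x; [left|right] => //.
  by split=> //; rewrite /preimage /= -fg.
by move=> [[Ex]|[]//]; rewrite /preimage /= fg.
Qed.

Lemma chi_continuous n c : ctr n c ->
  continuous (fun d : set_type (disk R n) => chi n c (val d)).
Proof.
move=> cc; apply/continuous_closedP => Z cZ.
exact: ((closed_subtype (chi n c @^-1` Z) (@closed_disk R n)).2 (cf_cont (cs_family cs n) cc cZ)).
Qed.

Lemma fst_val_continuous n :
  continuous (fun p : set_type (disk R n) * R => (val p.1, p.2) : 'rV[R]_n * R).
Proof.
apply: pair_continuous => p; last exact: cvg_snd.
apply: (@continuous_comp _ _ _ (fun p : set_type (disk R n) * R => p.1)); first exact: cvg_fst.
exact: continuous_set_val.
Qed.

Definition cell_index (n : nat) := {m : nat & set_type [set c | (m < n)%N /\ ctr m c]}.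

Lemma retr_skel_continuous_of n :
  (forall m c, (m < n)%N -> ctr m c ->
     continuous (fun p : set_type (disk R m) * R => retr m.+1 (chi m c (val p.1)) p.2)) ->
  continuous (fun p : set_type (sk n) * R => retr n (val p.1) p.2).
Proof.
move=> h.
pose P (j : cell_index n) : topologicalType := set_type (disk R (projT1 j)).
have cj (j : cell_index n) : (projT1 j < n)%N /\ ctr (projT1 j) (val (projT2 j)).
  by case: j => m c; exact: (set_mem (valP c)).
have qs (j : cell_index n) (d : P j) : sk n (chi _ (val (projT2 j)) (val d)).
  have [mn cc] := cj j; apply: (cs_skel_le cs mn).
  by apply: (cs_skel_chi cs) => //; exact: (set_mem (valP d)).
pose q (j : cell_index n) (d : P j) : set_type (sk n) := SigSub (mem_set (qs j d)).
apply: (@continuous_of_detection R _ _ _ P q (fun p => retr n (val p.1) p.2)).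
- move=> W hW; apply/closed_subtypeP; exists (val @` W); last first.
    apply/seteqP; split=> x; first by move=> Wx; exists x.
    by move=> [y Wy /val_inj <-].
  suff -> : val @` W = (val @` W) `&` sk n.
    apply: (cs_closed_skel cs) => m c mn cc.
    have /= := hW (existT _ m (SigSub (mem_set (conj mn cc)))).
    move/closed_subtypeP => [Y cY e].
    rewrite (_ : _ `&` _ = disk R m `&` Y); first by apply: closedI => //; exact: closed_disk.
    apply/seteqP; split=> d [dd].
      move=> [w Ww ew]; split=> //.
      have := congr1 (fun A => A (SigSub (mem_set dd) : set_type (disk R m))) e.
      rewrite /preimage /= => <-; congr W: Ww; exact: val_inj.
    move=> Yd; split=> //; exists (q (existT _ m (SigSub (mem_set (conj mn cc)))) (SigSub (mem_set dd))) => //.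
    by have := congr1 (fun A => A (SigSub (mem_set dd) : set_type (disk R m))) e; rewrite /preimage /= => ->.
  by apply/seteqP; split=> [x|x []//]; move=> [w Ww <-]; split; [exists w|exact: (set_mem (valP w))].
- move=> j; apply: continuous_subtype; apply: chi_continuous; by case: (cj j).
- move=> [x sx]; have sx' := set_mem sx.
  have : exists m, [/\ (m < n)%N, sk m.+1 x & ~ sk m x].
    elim: {h P cj qs q sx} n sx' => [|n IH]; first by rewrite (cs_empty cs).
    have [s _|ns s] := pselect (sk n x); last by exists n.
    by have [m [mn h1 h2]] := IH s; exists m; split=> //; exact: ltnW.
  move=> [m [mn h1 h2]]; have [c [d [cc od e _]]] := coordP h1 h2.
  exists (existT _ m (SigSub (mem_set (conj mn cc)))), (SigSub (mem_set (odisk_disk od))).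
  exact: val_inj.
- move=> j; have [mn cc] := cj j.
  rewrite (_ : (fun p => _) = fun p : P j * R => retr (projT1 j).+1 (chi (projT1 j) (val (projT2 j)) (val p.1)) p.2).
    exact: h.
  apply/funext => p; apply: (retr_le (m := (projT1 j).+1) (n := n)) => //.
  by apply: (cs_skel_chi cs) => //; exact: (set_mem (valP p.1)).
Qed.

(** On a closed cell outside of [U], the map is pasted from the part projected to
   the bottom and the part projected to the wall, and on the latter it factors
   through the previous skeleton, to which induction applies. *)
Lemma retr_cell_continuous m c : ctr m c ->
  continuous (fun p : set_type (disk R m) * R => retr m.+1 (chi m c (val p.1)) p.2).
Proof.
elim/ltn_ind: m c => m IH c cc.
have csk : continuous (fun p : set_type (sk m) * R => retr m (val p.1) p.2).
  by apply: retr_skel_continuous_of => k d km; exact: IH.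
have dP (p : set_type (disk R m) * R) : disk R m (val p.1) by exact: (set_mem (valP p.1)).
have [Uc'|nU] := pselect (U c).
  rewrite (_ : (fun p => _) = fun p : set_type (disk R m) * R => (chi m c (val p.1), clamp p.2)).
    apply: pair_continuous => p.
      apply: (@continuous_comp _ _ _ (fun p : set_type (disk R m) * R => p.1)
        (fun d : set_type (disk R m) => chi m c (val d))); first exact: cvg_fst.
      exact: chi_continuous.
    apply: (@continuous_comp _ _ _ (fun p : set_type (disk R m) * R => p.2) (@clamp R));
      first exact: cvg_snd.
    exact: clamp_continuous.
  apply/funext => p; apply: retr_U; first exact: (cs_skel_chi cs).
  exact: cell_in_U.
pose D : Type := set_type (disk R m).
pose rt (p : D * R) : R := ret_time (val p.1) p.2.
pose rd (p : D * R) : set_type (disk R m) := SigSub (mem_set (@ret_disk_in R m (val p.1) p.2)).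
have crt : continuous rt.
  move=> p; apply: (@continuous_comp _ _ _ (fun p : D * R => (val p.1, p.2) : 'rV[R]_m * R)
    (fun p => ret_time p.1 p.2)); first exact: fst_val_continuous.
  exact: ret_time_continuous.
have crd : continuous rd.
  apply: continuous_subtype => p.
  apply: (@continuous_comp _ _ _ (fun p : D * R => (val p.1, p.2) : 'rV[R]_m * R)
    (fun p => ret_disk p.1 p.2)); first exact: fst_val_continuous.
  exact: ret_disk_continuous.
pose E : set (D * R) := rt @^-1` [set 0].
pose F : set (D * R) := rd @^-1` (val @^-1` (sphere R m)).
have FS (p : set_type F) : sk m (chi m c (ret_disk (val (val p).1) (val p).2)).
  by apply: (cf_sphere (cs_family cs m)) => //; exact: (set_mem (valP p)).
pose k (p : set_type F) : set_type (sk m) * R := (SigSub (mem_set (FS p)), rt (val p)).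
apply: (@paste_continuous _ _ E F _ (fun p => (chi m c (val (rd p)), 0))
  (fun p => retr m (val (k p).1) (k p).2)).
- by apply: closed_preim crt _; exact: closed_eq.
- apply: closed_preim crd _; apply: closed_preim; last exact: closed_sphere.
  exact: continuous_set_val.
- move=> p; have [t0|nt] := eqVneq (rt p) 0; [by left|right].
  exact: ret_sphere.
- apply: pair_continuous => p; last exact: cvg_cst.
  apply: (@continuous_comp _ _ _ rd (fun d : set_type (disk R m) => chi m c (val d))); first exact: crd.
  exact: chi_continuous.
- move=> p; apply: (@continuous_comp _ _ _ k (fun p => retr m (val p.1) p.2)); last exact: csk.
  move: p; apply: pair_continuous => p.
    move: p; apply: continuous_subtype => p.
    apply: (@continuous_comp _ _ _ (fun p : set_type F => rd (val p)) (fun d : set_type (disk R m) => chi m c (val d))).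
      apply: (@continuous_comp _ _ _ (val : set_type F -> _) rd); first exact: continuous_set_val.
      exact: crd.
    exact: chi_continuous.
  apply: (@continuous_comp _ _ _ (val : set_type F -> _) rt); first exact: continuous_set_val.
  exact: crt.
- by move=> p Ep; rewrite retr_cell // -/(rt p) Ep eqxx.
- move=> p; rewrite retr_cell // -/(rt (val p)) /=; case: eqP => // t0.
  by rewrite t0 retr_0 ?clamp_le0E //; exact: FS.
Qed.

(** The homotopy extension property of the subcomplex [U]. The radial projection
   of a disk does not depend on any choice, which makes the result equivariant. *)
Lemma equivariant_retraction : exists r : X * R -> X * R,
  [/\ continuous r, forall x, r (x, 0) = (x, 0),
     forall x t, U x -> r (x, t) = (x, clamp t),
     forall p, ((r p).2 = 0 \/ U (r p).1) /\ 0 <= (r p).2 <= 1 &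
     forall g x t, r (gact g x, t) = (gact g (r (x, t)).1, (r (x, t)).2)].
Proof.
pose N x := projT1 (cid (cs_exhaust cs x)).
have NP x : sk (N x) x by exact: (projT2 (cid (cs_exhaust cs x))).
have rhoN n x t : sk n x -> retr (N x) x t = retr n x t.
  move=> sx; have [nN|/ltnW nN] := leqP n (N x); first exact: retr_le.
  by apply/esym/retr_le.
exists (fun p => retr (N p.1) p.1 p.2); split.
- pose J := {m : nat & set_type (ctr m)}.
  pose P (j : J) : topologicalType := set_type (disk R (projT1 j)).
  have cj (j : J) : ctr (projT1 j) (val (projT2 j)) by exact: (set_mem (valP (projT2 j))).
  pose q (j : J) (d : P j) : X := chi (projT1 j) (val (projT2 j)) (val d).
  apply: (@continuous_of_detection R J _ _ P q).
  + move=> W hW; apply: (cs_closed cs) => n c cc.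
    have := hW (existT _ n (SigSub (mem_set cc))).
    by move=> h; exact/(closed_subtype _ (@closed_disk R n)).
  + by move=> j; exact: chi_continuous.
  + move=> x; have : exists m, sk m.+1 x /\ ~ sk m x.
      elim: (N x) (NP x) => [|n IH]; first by rewrite (cs_empty cs).
      by have [s _|ns s] := pselect (sk n x); [exact: IH|exists n].
    move=> [m [h1 h2]]; have [c [d [cc od e _]]] := coordP h1 h2.
    by exists (existT _ m (SigSub (mem_set cc))), (SigSub (mem_set (odisk_disk od))).
  + move=> j; rewrite (_ : (fun p => _) = fun p : P j * R => retr (projT1 j).+1 (q j p.1) p.2).
      exact: retr_cell_continuous.
    apply/funext => p; apply: rhoN; apply: (cs_skel_chi cs) => //.
    exact: (set_mem (valP p.1)).
- by move=> x /=; rewrite retr_0 // clamp_le0E.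
- by move=> x t Ux /=; rewrite retr_U.
- by move=> [x t] /=; split; [exact: retr_target|exact: retr_range].
- move=> g x t /=; rewrite (rhoN (N x)); first exact: retr_act.
  exact: (cs_skel_act cs).
Qed.

End Retraction.

(** * Homotopies and double mapping cylinders *)

Section Homotopy.
Variable R : realType.

Definition homotopic (X Y : topologicalType) (f g : X -> Y) :=
  exists h : X * R -> Y, [/\ continuous h, forall x, h (x, 0) = f x &
    forall x, h (x, 1) = g x].

Lemma comp_pair_continuous (S T U V : topologicalType) (f : S -> T) (g : S -> U)
    (h : T * U -> V) :
  continuous f -> continuous g -> continuous h -> continuous (fun x => h (f x, g x)).
Proof.
move=> cf cg ch x; apply: (@continuous_comp _ _ _ (fun x => (f x, g x)) h).
  by move: x; exact: pair_continuous.
exact: ch.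
Qed.

Lemma comp_continuous (S T U : topologicalType) (f : S -> T) (g : T -> U) :
  continuous f -> continuous g -> continuous (fun x => g (f x)).
Proof. by move=> cf cg x; apply: continuous_comp; [exact: cf|exact: cg]. Qed.

Lemma fst_continuous (S T : topologicalType) : continuous (@fst S T).
Proof. by move=> x; exact: cvg_fst. Qed.

Lemma snd_continuous (S T : topologicalType) : continuous (@snd S T).
Proof. by move=> x; exact: cvg_snd. Qed.

Lemma affine_continuous (a b : R) : continuous (fun t : R => a + b * t).
Proof.
by move=> t; apply: cvgD; [exact: cvg_cst|apply: cvgM; [exact: cvg_cst|exact: cvg_id]].
Qed.

Lemma paste_halves (X Y : topologicalType) (f g : X * R -> Y) :
  continuous f -> continuous g -> (forall x, f (x, 1) = g (x, 0)) ->
  continuous (fun p : X * R => if p.2 <= 1 / 2 then f (p.1, clamp (2 * p.2))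
                               else g (p.1, clamp (2 * p.2 - 1))).
Proof.
move=> cf cg fg; apply/continuous_closedP => Z cZ.
pose f' (p : X * R) := f (p.1, clamp (0 + 2 * p.2)).
pose g' (p : X * R) := g (p.1, clamp (- 1 + 2 * p.2)).
have c2 (a : R) : continuous (fun p : X * R => clamp (a + 2 * p.2)).
  apply: (@comp_continuous _ _ _ (fun p : X * R => a + 2 * p.2) (@clamp R)).
    exact: (comp_continuous (@snd_continuous X R) (@affine_continuous a 2)).
  exact: clamp_continuous.
have cf' : continuous f' by apply: comp_pair_continuous => //; exact: fst_continuous.
have cg' : continuous g' by apply: comp_pair_continuous => //; exact: fst_continuous.
pose E := [set p : X * R | p.2 <= 1 / 2]; pose F := [set p : X * R | 1 / 2 <= p.2].
have cE : closed E by exact: (closed_preim (@snd_continuous X R) (@closed_le R _)).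
have cF : closed F by exact: (closed_preim (@snd_continuous X R) (@closed_ge R _)).
rewrite (_ : _ @^-1` _ = (E `&` f' @^-1` Z) `|` (F `&` g' @^-1` Z)).
  by apply: closedU; apply: closedI => //; exact: closed_preim.
rewrite /f' /g' /E /F; apply/seteqP; split=> -[x t]; rewrite /preimage /=.
  rewrite add0r [- 1 + _]addrC.
  case: ifP => [h Zt|/negbT]; [by left|rewrite -ltNge => /ltW h Zt; by right].
rewrite add0r [- 1 + _]addrC => -[[-> //]|[h Zt]].
case: ifP => // h'; have -> : t = 1 / 2 by apply/eqP; rewrite eq_le h h'.
rewrite clamp_ge1E; last lra.
rewrite fg; congr (Z (g (_, _))): Zt; rewrite (_ : t = 1 / 2); first by rewrite clamp_le0E //; lra.
by apply/eqP; rewrite eq_le h h'.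
Qed.

Lemma homotopic_trans (X Y : topologicalType) (f g k : X -> Y) :
  homotopic f g -> homotopic g k -> homotopic f k.
Proof.
move=> [h [ch h0 h1]] [h' [ch' h0' h1']].
exists (fun p : X * R => if p.2 <= 1 / 2 then h (p.1, clamp (2 * p.2))
                               else h' (p.1, clamp (2 * p.2 - 1))); split.
- by apply: paste_halves => // x; rewrite h1 h0'.
- by move=> x /=; rewrite ifT ?mulr0 ?clamp_le0E //; lra.
- by move=> x /=; rewrite ifF ?clamp_ge1E //; [lra|apply/negbTE; rewrite -ltNge; lra].
Qed.

Definition null_homotopic (T : topologicalType) :=
  exists t0 : T, homotopic (@id T) (fun=> t0).

Definition line_clamp (t : R) : set_type (`[0, 1] : set R).
Proof.
exists (clamp t); apply/mem_set; rewrite /= in_itv /=.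
by rewrite clamp_ge0 clamp_le1.
Defined.

Lemma contractibleP (T : topologicalType) : contractible R T <-> null_homotopic T.
Proof.
split=> -[t0 [h [ch h0 h1]]]; exists t0.
  exists (fun p => h (p.1, line_clamp p.2)); split.
  - have cl : continuous line_clamp.
      by apply: continuous_subtype; exact: clamp_continuous.
    exact: (comp_pair_continuous (@fst_continuous T R)
      (comp_continuous (@snd_continuous T R) cl) ch).
  - by move=> x; apply: h0; rewrite /= clamp_le0E.
  - by move=> x; apply: h1; rewrite /= clamp_ge1E.
exists (fun p => h (p.1, val p.2)); split.
- exact: (comp_pair_continuous (@fst_continuous T _)
    (comp_continuous (@snd_continuous T _) (@continuous_set_val _ _)) ch).
- by move=> x t ->.
- by move=> x t ->.
Qed.

(** A space all whose blocks contract separately. That the index [lam] is a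
   continuous map to a discrete space says that the blocks are open. *)
Record block_contraction (T : topologicalType) (L : choiceType)
    (lam : T -> discrete_topology L) (base : L -> T) (k : T * R -> T) : Prop := {
  bc_lam : continuous lam;
  bc_base : forall l, lam (base l) = l;
  bc_cont : continuous k;
  bc_k0 : forall x, k (x, 0) = x;
  bc_k1 : forall x, k (x, 1) = base (lam x);
  bc_lamk : forall p, lam (k p) = lam p.1 }.

(** Follow the contraction of a block, then backwards the path of the new base
   point. *)
Lemma bc_rebase (T : topologicalType) (L : choiceType)
    (lam : T -> discrete_topology L) (base base' : L -> T) (k : T * R -> T) :
  block_contraction lam base k -> (forall l, lam (base' l) = l) ->
  exists k', block_contraction lam base' k'.
Proof.
move=> [cl lb ck k0 k1 lk] lb'.
exists (fun p : T * R => if p.2 <= 1 / 2 then k (p.1, clamp (2 * p.2))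
  else (fun p : T * R => k (base' (lam p.1), 1 - p.2)) (p.1, clamp (2 * p.2 - 1))).
split=> //.
- apply: (paste_halves (g := fun p : T * R => k (base' (lam p.1), 1 - p.2))) => //.
    have c1 : continuous (fun t : R => 1 - t).
      by move=> t; apply: cvgB; [exact: cvg_cst|exact: cvg_id].
    have c2 : continuous (fun p : T * R => base' (lam p.1)).
      have cb : continuous (base' : discrete_topology L -> T) by exact: discrete_continuous.
      have cl1 : continuous (fun p : T * R => lam p.1).
        exact: (comp_continuous (@fst_continuous T R) cl).
      exact: (comp_continuous cl1 cb).
    exact: (comp_pair_continuous c2 (comp_continuous (@snd_continuous T R) c1) ck).
  by move=> x; rewrite /= subr0 !k1 lb'.
- by move=> x /=; rewrite ifT ?mulr0 ?clamp_le0E //; lra.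
- move=> x /=; rewrite ifF; last by apply/negbTE; rewrite -ltNge; lra.
  by rewrite clamp_ge1E ?subrr ?k0 //; lra.
- by move=> [x t] /=; case: ifP => _; rewrite lk //= lb'.
Qed.

Section Gluing.
Variables (A B C X : topologicalType).

Definition elim3 (Y : Type) (b : B -> Y) (e : A * R -> Y) (c : C -> Y)
    (s : B + (A * R + C)) : Y :=
  match s with inl x => b x | inr (inl p) => e p | inr (inr x) => c x end.

(** [X] is dominated by the double mapping cylinder of [B <- A -> C]. The section
   [j] is a mere function to the disjoint union of the three parts. Its
   continuity is expressed through the maps out of these parts that agree on the
   gluing (with a parameter, for homotopies), so that the cylinder itself need
   not be constructed. *)
Record cylinder_section (i : A -> B) (F : A -> C) (u : B -> X) (v : C -> X)
    (j : X -> B + (A * R + C)) : Prop := {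
  cyl_cont : forall (Y : topologicalType) (b : B * R -> Y)
      (e : A * R * R -> Y) (c : C * R -> Y),
    continuous b -> continuous e -> continuous c ->
    (forall a s, e (a, 0, s) = b (i a, s)) ->
    (forall a s, e (a, 1, s) = c (F a, s)) ->
    continuous (fun p : X * R => elim3 (fun x => b (x, p.2))
       (fun q => e (q, p.2)) (fun x => c (x, p.2)) (j p.1));
  cyl_id : homotopic (@id X)
    (fun x => elim3 u (fun q => u (i q.1)) v (j x)) }.

Variables (i : A -> B) (F : A -> C) (u : B -> X) (v : C -> X).
Variable j : X -> B + (A * R + C).
Hypothesis cyl : cylinder_section i F u v j.
Hypotheses (cF : continuous F) (ci : continuous i) (cu : continuous u)
  (cv : continuous v) (uv : forall a, u (i a) = v (F a)).

Variables (L : choiceType) (lamA : A -> discrete_topology L)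
  (lamC : C -> discrete_topology L) (bA : L -> A) (bC : L -> C)
  (kA : A * R -> A) (kC0 : C * R -> C).
Hypothesis hA : block_contraction lamA bA kA.
Hypothesis hC0 : block_contraction lamC bC kC0.
Hypothesis lamF : forall a, lamC (F a) = lamA a.

(** After [bc_rebase], the base points of [C] are the images of those of [A]. Let
   [E a] be the path from [u (i a)] to the image of the base point of its block,
   obtained by contracting [C]. The first homotopy contracts [C] and replaces the
   cylinder coordinate of [a] by the path [E a]. The second contracts [A] and
   then shrinks these paths towards [B], dragging [C] along. What results factors
   through the map [r] to [B], which is contractible. *)
Lemma cylinder_contractible : null_homotopic B -> null_homotopic X.
Proof.
move=> [b0 [kB [ckB kB0 kB1]]].
have lbF l : lamC (F (bA l)) = l by rewrite lamF (bc_base hA).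
have [kC hC] := bc_rebase hC0 lbF.
pose E (a : A) (q : R) : X := v (kC (F a, clamp q)).
have E0 a q : q <= 0 -> E a q = u (i a).
  by move=> q0; rewrite /E clamp_le0E // (bc_k0 hC) uv.
have E1 a q : 1 <= q -> E a q = v (F (bA (lamA a))).
  by move=> q0; rewrite /E clamp_ge1E // (bc_k1 hC) lamF.
have cE : continuous (fun p : A * R => E p.1 p.2).
  apply: (@comp_continuous _ _ _ (fun p : A * R => kC (F p.1, clamp p.2)) v) => //.
  apply: comp_pair_continuous; last exact: (bc_cont hC).
    by apply: comp_continuous => //; exact: fst_continuous.
  by apply: comp_continuous; [exact: snd_continuous|exact: clamp_continuous].
have cEc (S : topologicalType) (f : S -> A) (g : S -> R) :
    continuous f -> continuous g -> continuous (fun x => E (f x) (g x)).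
  by move=> cf cg; apply: (@comp_pair_continuous _ _ _ _ f g (fun p => E p.1 p.2)).
have cfst (S : topologicalType) : continuous (fun p : S * R => p.1) by exact: fst_continuous.
have csnd (S : topologicalType) : continuous (fun p : S * R => p.2) by exact: snd_continuous.
have ccl (S : topologicalType) (f : S -> R) : continuous f -> continuous (fun x => clamp (f x)).
  by move=> cf; apply: comp_continuous => //; exact: clamp_continuous.
have cub : continuous (fun p : B * R => u p.1).
  by apply: comp_continuous => //; exact: cfst.
have clamb : continuous (fun c : C => bA (lamC c)).
  apply: comp_continuous; first exact: (bc_lam hC).
  exact: discrete_continuous.
have c1 : continuous (fun p : A * R * R => p.1.1).
  by apply: comp_continuous; exact: fst_continuous.
have c2 : continuous (fun p : A * R * R => p.1.2).
  by apply: comp_continuous; [exact: fst_continuous|exact: snd_continuous].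
have H1 : homotopic (fun x => elim3 u (fun q => u (i q.1)) v (j x))
   (fun x => elim3 u (fun q => E q.1 (clamp q.2)) (fun c => v (F (bA (lamC c)))) (j x)).
  pose e (p : A * R * R) := E p.1.1 (clamp p.2 + clamp p.1.2 - 1).
  pose g (p : C * R) := v (kC (p.1, clamp p.2)).
  exists (fun p : X * R => elim3 (fun x => (fun q : B * R => u q.1) (x, p.2))
       (fun q => e (q, p.2)) (fun x => g (x, p.2)) (j p.1)); split.
  - apply: (cyl_cont cyl (b := fun q : B * R => u q.1) (e := e) (c := g)) => //.
    + apply: (cEc _ (fun p : A * R * R => p.1.1)
        (fun p => clamp p.2 + clamp p.1.2 - 1)) => // p; apply: cvgB; last exact: cvg_cst.
      by apply: cvgD; [exact: (ccl _ _ (csnd _))|exact: (ccl _ _ c2)].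
    + have h : continuous (fun p : C * R => kC (p.1, clamp p.2)).
        exact: (comp_pair_continuous (cfst C) (ccl _ _ (csnd C)) (bc_cont hC)).
      exact: (comp_continuous h cv).
    + move=> a s; rewrite /e /= E0 // (@clamp_le0E _ 0) // addr0.
      by rewrite subr_le0 clamp_le1.
    + by move=> a s; rewrite /e /g /E /= (@clamp_ge1E _ 1) // addrK clamp_clamp.
  - move=> x; case: (j x) => [b//|[[a t]|c]] /=.
      rewrite /e /= E0 // (@clamp_le0E _ 0) // add0r.
      by rewrite subr_le0 clamp_le1.
    by rewrite /g /= (@clamp_le0E _ 0) // (bc_k0 hC).
  - move=> x; case: (j x) => [b//|[[a t]|c]] /=.
      by rewrite /e /= (@clamp_ge1E _ 1) // addrAC subrr add0r.
    by rewrite /g /= clamp_ge1E // (bc_k1 hC).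
have H2 : homotopic
   (fun x => elim3 u (fun q => E q.1 (clamp q.2)) (fun c => v (F (bA (lamC c)))) (j x))
   (fun x => elim3 u (fun q => u (i (kA (q.1, clamp q.2))))
      (fun c => u (i (bA (lamC c)))) (j x)).
  pose e (p : A * R * R) := E (kA (p.1.1, clamp p.1.2 * clamp (2 * p.2)))
    (clamp p.1.2 * clamp (2 - 2 * p.2)).
  pose g (p : C * R) := E (bA (lamC p.1)) (clamp (2 - 2 * p.2)).
  have c2s (S : topologicalType) (f : S -> R) : continuous f -> continuous (fun x => 2 * f x).
    by move=> cf x; apply: cvgM; [exact: cvg_cst|exact: cf].
  have cm2s (S : topologicalType) (f : S -> R) : continuous f -> continuous (fun x => 2 - 2 * f x).
    by move=> cf x; apply: cvgB; [exact: cvg_cst|exact: c2s].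
  have cM (S : topologicalType) (f f' : S -> R) : continuous f -> continuous f' ->
      continuous (fun x => f x * f' x).
    by move=> cf cf' x; apply: cvgM; [exact: cf|exact: cf'].
  exists (fun p : X * R => elim3 (fun x => (fun q : B * R => u q.1) (x, p.2))
       (fun q => e (q, p.2)) (fun x => g (x, p.2)) (j p.1)); split.
  - apply: (cyl_cont cyl (b := fun q : B * R => u q.1) (e := e) (c := g)) => //.
    + have h1 := cM _ _ _ (ccl _ _ c2) (ccl _ _ (c2s _ _ (csnd (A * R)%type))).
      have h2 := cM _ _ _ (ccl _ _ c2) (ccl _ _ (cm2s _ _ (csnd (A * R)%type))).
      exact: (cEc _ _ _ (comp_pair_continuous c1 h1 (bc_cont hA)) h2).
    + exact: (cEc _ _ _ (comp_continuous (cfst C) clamb) (ccl _ _ (cm2s _ _ (csnd C)))).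
    + by move=> a s; rewrite /e /= (@clamp_le0E _ 0) // !mul0r E0 // (bc_k0 hA).
    + move=> a s; rewrite /e /g /= (@clamp_ge1E _ 1) // !mul1r.
      have [h|h] := leP (2 * s) 1.
        rewrite [clamp (2 - _)]clamp_ge1E; last lra.
        by rewrite !E1 // (bc_lamk hA) (bc_base hA) lamF.
      rewrite [clamp (2 * s)]clamp_ge1E; last exact: ltW.
      by rewrite (bc_k1 hA) lamF.
  - move=> x; case: (j x) => [b//|[[a t]|c]] /=.
      rewrite /e /= mulr0 (@clamp_le0E _ 0) // mulr0 (bc_k0 hA).
      by rewrite subr0 [clamp 2]clamp_ge1E ?mulr1 //; lra.
    rewrite /g /= mulr0 subr0 E1; last by rewrite clamp_ge1E //; lra.
    by rewrite (bc_base hA).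
  - move=> x; case: (j x) => [b//|[[a t]|c]] /=.
      rewrite /e /= mulr1 subrr [clamp 2]clamp_ge1E; last lra.
      by rewrite (@clamp_le0E _ 0) // mulr0 mulr1 E0.
    by rewrite /g /= mulr1 subrr E0 // clamp_le0E.
(* the second homotopy ends in the composite of [u] with this map; the real
   parameter is only there to use [cyl_cont] *)
pose r (p : X * R) : B := elim3 (fun x => (fun q : B * R => q.1) (x, p.2))
   (fun q => (fun q : A * R * R => i (kA (q.1.1, clamp q.1.2))) (q, p.2))
   (fun c => (fun q : C * R => i (bA (lamC q.1))) (c, p.2)) (j p.1).
have cr : continuous r.
  apply: (cyl_cont cyl (b := fun q : B * R => q.1)
    (e := fun q : A * R * R => i (kA (q.1.1, clamp q.1.2)))
    (c := fun q : C * R => i (bA (lamC q.1)))) => //.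
  - exact: (comp_continuous (comp_pair_continuous c1 (ccl _ _ c2) (bc_cont hA)) ci).
  - exact: (comp_continuous (comp_continuous (cfst C) clamb) ci).
  - by move=> a s /=; rewrite clamp_le0E // (bc_k0 hA).
  - by move=> a s /=; rewrite clamp_ge1E // (bc_k1 hA) lamF.
have rE x s : r (x, s) = r (x, 0) by rewrite /r /=; case: (j x) => [|[]].
have H3 : homotopic (fun x => u (r (x, 0))) (fun=> u b0).
  exists (fun p => u (kB (r p, p.2))); split.
  - exact: (comp_continuous (comp_pair_continuous cr (csnd X) ckB) cu).
  - by move=> x /=; rewrite kB0.
  - by move=> x /=; rewrite kB1.
exists (u b0); apply: homotopic_trans (cyl_id cyl) _.
apply: homotopic_trans H1 _; apply: homotopic_trans H2 _.
rewrite (_ : (fun x => elim3 _ _ _ _) = fun x => u (r (x, 0))) //.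
by apply/funext => x; rewrite /r /=; case: (j x) => [|[]].
Qed.

End Gluing.

End Homotopy.

Section CylinderSection.
Variable R : realType.

Lemma continuous_of_detection2 (B C X Y : topologicalType) (u : B -> X) (v : C -> X)
    (f : X * R -> Y) :
  (forall W : set X, closed (u @^-1` W) -> closed (v @^-1` W) -> closed W) ->
  continuous u -> continuous v ->
  (forall x, (exists b, x = u b) \/ (exists c, x = v c)) ->
  continuous (fun p : B * R => f (u p.1, p.2)) ->
  continuous (fun p : C * R => f (v p.1, p.2)) ->
  continuous f.
Proof.
move=> det cu cv cov cf1 cf2.
pose P (b : bool) : topologicalType := if b then B else C.
pose q (b : bool) : P b -> X := match b with true => u | false => v end.
apply: (@continuous_of_detection R bool X Y P q).
- by move=> W h; apply: det; [exact: (h true)|exact: (h false)].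
- by case.
- by move=> x; have [[b ->]|[c ->]] := cov x; [exists true, b|exists false, c].
- by case.
Qed.

Section OfRetraction.
Variables (A B C X : topologicalType).
Variables (i : A -> B) (F : A -> C) (u : B -> X) (v : C -> X).
Hypothesis po : closed_pushout i F u v.
Variable r : B * R -> B * R.
Hypothesis cr : continuous r.
Hypothesis r0 : forall b, r (b, 0) = (b, 0).
Hypothesis rU : forall a t, r (i a, t) = (i a, clamp t).
Hypothesis rT : forall p, (r p).2 = 0 \/ range i (r p).1.

Lemma range_inverse : exists g : set_type (range i) -> A,
  continuous g /\ forall x, i (g x) = val x.
Proof.
have ex (x : set_type (range i)) : exists a, i a = val x.
  by have [a _ e] := set_mem (valP x); exists a.
pose g x := projT1 (cid (ex x)).
have gP x : i (g x) = val x by exact: (projT2 (cid (ex x))).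
exists g; split=> //; apply/continuous_closedP => Z cZ.
apply/closed_subtypeP; exists (i @` Z); first exact: (cp_closed po).
apply/seteqP; split=> x; first by move=> Zx; exists (g x).
by move=> [a Za]; rewrite /preimage /= -[X in _ = X]gP => /(cp_inj po) <-.
Qed.

(** At time one the retraction sends a point of [B] either to the bottom, that is,
   to [B], or to the wall over [A], that is, to the cylinder on [A] at the height
   reached. *)
Lemma cylinder_of_retraction : exists j, cylinder_section (R := R) i F u v j.
Proof.
have [g [cg gP]] := range_inverse.
(* the value of the section on the image of [b] *)
pose jB (b : B) : B + (A * R + C) :=
  if (r (b, 1)).2 == 0 then inl (r (b, 1)).1
  else if pselect (range i (r (b, 1)).1) is left h
  then inr (inl (g (SigSub (mem_set h)), (r (b, 1)).2)) else inl (r (b, 1)).1.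
have jex x : exists s, (forall c, x = v c -> s = inr (inr c)) /\
    (forall b, ~ range i b -> x = u b -> s = jB b).
  have [[c xc]|nx] := pselect (exists c, x = v c).
    exists (inr (inr c)); split=> [c'|b nb]; first by rewrite xc => /(cp_v_inj po) ->.
    by rewrite xc => /esym /(cp_cross po)[a ba]; case: nb; exists a.
  have [[b xb]|//] := cp_cover po x; exists (jB b); split=> [c xc|b' nb'].
    by case: nx; exists c.
  by rewrite xb => e; have [-> //|[_ /nb']] := cp_quasi po e.
pose j x := projT1 (cid (jex x)).
have [jv ju] : (forall c, j (v c) = inr (inr c)) /\
    (forall b, ~ range i b -> j (u b) = jB b).
  split=> [c|b nb].
    by have [h _] := projT2 (cid (jex (v c))); exact: h.
  by have [_ h] := projT2 (cid (jex (u b))); exact: h.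
have jE (Y : Type) (b : B -> Y) (e : A * R -> Y) (c : C -> Y) :
    (forall a, e (a, 1) = c (F a)) ->
    forall x, elim3 b e c (j (u x)) = elim3 b e c (jB x).
  move=> ec x; have [[a _ <-]|nx] := pselect (range i x); last by rewrite ju.
  rewrite (cp_comm po) jv /= /jB rU clamp_ge1E // oner_eq0.
  case: pselect => [h|[]]; last by exists a.
  rewrite /= -ec; congr (e (_, _)); apply: (cp_inj po); by rewrite gP.
exists j; split.
- move=> Y b e c cb ce cc e0 e1.
  have cr1 : continuous (fun p : B * R => r (p.1, 1)).
    exact: (comp_pair_continuous (@fst_continuous B R) (fun x => cvg_cst _) cr).
  apply: (continuous_of_detection2 (cp_detect po) (cp_u po) (cp_v po) (cp_cover po)); last first.
    by rewrite (_ : (fun p => _) = c) //; apply/funext => -[x s] /=; rewrite jv.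
  pose E := [set p : B * R | (r (p.1, 1)).2 = 0].
  pose K := [set p : B * R | range i (r (p.1, 1)).1].
  have c1 : continuous (fun p : B * R => (r (p.1, 1)).1).
    exact: (comp_continuous cr1 (@fst_continuous B R)).
  have c2 : continuous (fun p : B * R => (r (p.1, 1)).2).
    exact: (comp_continuous cr1 (@snd_continuous B R)).
  have KP (p : set_type K) : range i (r ((val p).1, 1)).1 by exact: (set_mem (valP p)).
  pose k (p : set_type K) : set_type (range i) := SigSub (mem_set (KP p)).
  have ck : continuous k.
    apply: continuous_subtype.
    exact: (comp_continuous (@continuous_set_val _ K) c1).
  pose h (p : set_type K) : A * R * R := (g (k p), (r ((val p).1, 1)).2, (val p).2).
  have ch : continuous h.
    apply: pair_continuous.
      apply: pair_continuous; first exact: (comp_continuous ck cg).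
      exact: (comp_continuous (@continuous_set_val _ K) c2).
    exact: (comp_continuous (@continuous_set_val _ K) (@snd_continuous B R)).
  apply: (@paste_continuous (B * R)%type Y E K _ (fun p => b ((r (p.1, 1)).1, p.2))
    (fun p => e (h p))).
  + exact: (closed_preim c2 (@closed_eq R 0)).
  + apply: (closed_preim c1 (cp_closed po (@closedT A))).
  + by move=> p; exact: rT.
  + exact: (comp_pair_continuous c1 (@snd_continuous B R) cb).
  + exact: (comp_continuous ch ce).
  + move=> [x s] /= Ep; rewrite jE //= /jB.
    by move: Ep; rewrite /E /= => ->; rewrite eqxx.
  + move=> p; rewrite jE //= /jB.
    case: eqP => [t0|_] /=.
      rewrite /h /= t0 e0 gP; congr (b (_, _)).
    case: pselect => [h'|[]]; last exact: KP.
    by rewrite /h /= /k (Prop_irrelevance h' (KP p)).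
- pose d (p : X * R) : X := if pselect (exists c, p.1 = v c) then p.1 else
    if pselect (exists b, p.1 = u b) is left h then u (r (projT1 (cid h), p.2)).1 else p.1.
  have dv c s : d (v c, s) = v c.
    by rewrite /d /=; case: pselect => // -[]; exists c.
  have du b s : d (u b, s) = u (r (b, s)).1.
    have [[a _ <-]|nb] := pselect (range i b); first by rewrite rU (cp_comm po) dv.
    rewrite /d /=; case: pselect => [h|/= _].
      by have [c /(cp_cross po)[a ba _]] := h; case: nb; exists a.
    case: pselect => [h|[]]; last by exists b.
    by case: cid => b' /= e; have [<-|[/nb]] := cp_quasi po e.
  exists d; split.
  + apply: (continuous_of_detection2 (cp_detect po) (cp_u po) (cp_v po) (cp_cover po)).
      rewrite (_ : (fun p => _) = fun p => u (r p).1); last by apply/funext => -[b s]; exact: du.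
      exact: (comp_continuous (comp_continuous cr (@fst_continuous B R)) (cp_u po)).
    rewrite (_ : (fun p => _) = fun p => v p.1); last by apply/funext => -[b s]; exact: dv.
    exact: (comp_continuous (@fst_continuous C R) (cp_v po)).
  + by move=> x; have [[b ->]|[c ->]] := cp_cover po x; [rewrite du r0|rewrite dv].
  + move=> x; have [[b ->]|[c ->]] := cp_cover po x; last by rewrite dv jv.
    rewrite du jE //=; last exact: (cp_comm po).
    rewrite /jB; case: eqP => [//|nt].
    by case: pselect => [h|_] //=; rewrite gP.
Qed.

End OfRetraction.

(** The double mapping cylinder is symmetric, so that either map of the square may
   be the inclusion. *)
Lemma cylinder_flip (A B C X : topologicalType) (i : A -> B) (F : A -> C)
    (u : B -> X) (v : C -> X) :
  (forall a, u (i a) = v (F a)) ->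
  (exists j, cylinder_section (R := R) F i v u j) -> exists j, cylinder_section (R := R) i F u v j.
Proof.
move=> uv [j cyl].
pose fl (s : C + (A * R + B)) : B + (A * R + C) := match s with
  | inl c => inr (inr c) | inr (inl p) => inr (inl (p.1, 1 - p.2)) | inr (inr b) => inl b end.
have c1 : continuous (fun t : R => 1 - t).
  by move=> t; apply: cvgB; [exact: cvg_cst|exact: cvg_id].
exists (fun x => fl (j x)); split.
- move=> Y b e c cb ce cc e0 e1.
  pose e' (p : A * R * R) := e (p.1.1, 1 - p.1.2, p.2).
  have ce' : continuous e'.
    have h1 := comp_continuous (@fst_continuous (A * R)%type R) (@fst_continuous A R).
    have h2 := comp_continuous (@fst_continuous (A * R)%type R) (@snd_continuous A R).
    exact: (comp_pair_continuous (pair_continuous h1 (comp_continuous h2 c1))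
      (@snd_continuous (A * R)%type R) ce).
  rewrite (_ : (fun p => _) = fun p : X * R => elim3 (fun x => c (x, p.2))
       (fun q => e' (q, p.2)) (fun x => b (x, p.2)) (j p.1)).
    apply: (cyl_cont cyl) => // a s; rewrite /e' /=; first by rewrite subr0 e1.
    by rewrite subrr e0.
  by apply/funext => -[x s] /=; case: (j x) => [|[]].
- have := cyl_id cyl; congr homotopic; apply/funext => x.
  by case: (j x) => [|[[a t]|]] //=; rewrite uv.
Qed.

End CylinderSection.

(** * Fixed points of a pushout *)

Lemma closed_val_image (T : topologicalType) (A : set T) (W : set (set_type A)) :
  closed A -> closed W -> closed (val @` W).
Proof.
move=> cA /closed_subtypeP[Z cZ ->].
rewrite (_ : _ @` _ = A `&` Z); first exact: closedI.
apply/seteqP; split=> x; first by move=> [w Zw <-]; split=> //; exact: (set_mem (valP w)).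
by move=> [Ax Zx]; exists (SigSub (mem_set Ax)).
Qed.

Lemma val_preimage_image (T : Type) (A : set T) (W : set (set_type A)) :
  val @^-1` (val @` W) = W.
Proof.
apply/seteqP; split=> x; last by exists x.
by move=> [w Ww /val_inj <-].
Qed.

Section FixedPoints.
Variables (G : groupType) (H : set G).
Local Notation fix_ X := (fixed_points X H).

Lemma fix_mapP (X Y : gspace G) (f : X -> Y) (ef : equivariant f) (x : set_type (fix_ X)) :
  fix_ Y (f (val x)).
Proof. by move=> h Hh; rewrite -ef; congr f; exact: (set_mem (valP x)). Qed.

Definition fix_map (X Y : gspace G) (f : X -> Y) (ef : equivariant f)
  (x : set_type (fix_ X)) : set_type (fix_ Y) := SigSub (mem_set (fix_mapP ef x)).

Lemma fix_map_continuous (Y Z : gspace G) (f : Y -> Z) (ef : equivariant f) :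
  continuous f -> continuous (fix_map ef).
Proof.
move=> cf; apply: continuous_subtype.
exact: (comp_continuous (@continuous_set_val _ _) cf).
Qed.

Variables (A B C X : gspace G).
Variables (i : A -> B) (F : A -> C) (u : B -> X) (v : C -> X).
Hypothesis po : closed_pushout i F u v.
Hypotheses (ei : equivariant i) (eF : equivariant F) (eu : equivariant u)
  (ev : equivariant v).

Lemma fix_of_inj (Y Z : gspace G) (f : Y -> Z) (y : Y) :
  equivariant f -> injective f -> fix_ Z (f y) -> fix_ Y y.
Proof. by move=> ef fI h k Hk; apply: fI; rewrite ef h. Qed.

Hypotheses (cB : closed (fix_ B)) (cC : closed (fix_ C)).

(** Both [u], off the range of [i], and [v] are injective, so a fixed point of [X]
   comes from a fixed point of [B] or [C]. *)
Lemma fixed_pushout :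
  closed_pushout (fix_map ei) (fix_map eF) (fix_map eu) (fix_map ev).
Proof.
have fix_u b : ~ range i b -> fix_ X (u b) -> fix_ B b.
  move=> nb fb h Hh; have := fb h Hh; rewrite -eu => /(cp_quasi po)[//|[_]].
  by move/nb.
have rng (b : set_type (fix_ B)) : range i (val b) -> range (fix_map ei) b.
  move=> [a _ e]; have fa : fix_ A a.
    by apply: (fix_of_inj ei (cp_inj po)); rewrite e; exact: (set_mem (valP b)).
  by exists (SigSub (mem_set fa)) => //; exact: val_inj.
split.
- exact/fix_map_continuous/(cp_i po).
- exact/fix_map_continuous/(cp_F po).
- exact/fix_map_continuous/(cp_u po).
- exact/fix_map_continuous/(cp_v po).
- by move=> a; apply: val_inj; exact: (cp_comm po).
- by move=> a b /(congr1 val) /(cp_inj po) /val_inj.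
- move=> Z /closed_subtypeP[Y cY ->]; apply/closed_subtypeP.
  exists (i @` Y); first exact: (cp_closed po).
  apply/seteqP; split=> b; first by move=> [a Ya <-]; exists (val a).
  move=> [a Ya e]; have [|a' _ e'] := rng b; first by exists a.
  exists a' => //; rewrite /preimage /=.
  by rewrite (_ : set_val a' = a) //; apply: (cp_inj po); rewrite e -e'.
- move=> x; have fx := set_mem (valP x).
  have [[c xc]|nx] := pselect (exists c, val x = v c).
    right; have fc : fix_ C c by apply: (fix_of_inj ev (cp_v_inj po)); rewrite -xc.
    by exists (SigSub (mem_set fc)); exact: val_inj.
  have [[b xb]|//] := cp_cover po (val x); left.
  have nb : ~ range i b by move=> [a _ e]; apply: nx; exists (F a); rewrite xb -e (cp_comm po).
  have fb : fix_ B b by apply: fix_u => //; rewrite -xb.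
  by exists (SigSub (mem_set fb)); exact: val_inj.
- by move=> a b /(congr1 val) /(cp_v_inj po) /val_inj.
- move=> b c /(congr1 val) /(cp_cross po)[a ba ca].
  have fa : fix_ A a.
    by apply: (fix_of_inj ei (cp_inj po)); rewrite -ba; exact: (set_mem (valP b)).
  by exists (SigSub (mem_set fa)); exact: val_inj.
- move=> b b' /(congr1 val) /(cp_quasi po)[/val_inj|[h h']]; [by left|right].
  by split; exact: rng.
- move=> W cu cv.
  have cv' : closed (v @^-1` (val @` W)).
    rewrite (_ : _ @^-1` _ = val @` (fix_map ev @^-1` W)); first exact: closed_val_image.
    apply/seteqP; split=> c; last by move=> [c' Wc <-]; exists (fix_map ev c').
    move=> [x Wx e]; have fc : fix_ C c.
      by apply: (fix_of_inj ev (cp_v_inj po)); rewrite -e; exact: (set_mem (valP x)).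
    exists (SigSub (mem_set fc)) => //; rewrite /preimage /=.
    by rewrite (_ : fix_map ev _ = x) //; exact: val_inj.
  rewrite -(val_preimage_image W).
  apply: closed_preim; first exact: continuous_set_val.
  apply: (cp_detect po) => //.
  rewrite (_ : _ @^-1` _ = val @` (fix_map eu @^-1` W) `|` i @` (F @^-1` (v @^-1` (val @` W)))).
    apply: closedU; first exact: closed_val_image.
    by apply: (cp_closed po); exact: closed_preim (cp_F po) _.
  apply/seteqP; split=> b.
    move=> [x Wx e]; have [[a _ ea]|nb] := pselect (range i b); [right|left].
      by exists a => //; exists x; rewrite // -(cp_comm po) ea.
    have fb : fix_ B b by apply: fix_u => //; rewrite -e; exact: (set_mem (valP x)).
    exists (SigSub (mem_set fb)) => //; rewrite /preimage /=.
    by rewrite (_ : fix_map eu _ = x) //; exact: val_inj.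
  move=> [[b' Wb <-]|[a [x Wx e] <-]]; first by exists (fix_map eu b').
  by exists x => //; rewrite (cp_comm po).
Qed.

Variable R : realType.
Variables (sk ctr : nat -> set B) (chi : forall n, B -> 'rV[R]_n -> B).
Arguments chi : clear implicits.
Hypothesis cs : cellular_structure sk ctr chi.
Hypothesis sat : forall n x d e, ctr n x -> odisk n d -> odisk n e ->
  range i (chi n x d) -> range i (chi n x e).

Lemma fixed_cylinder : exists j, cylinder_section (R := R)
  (fix_map ei) (fix_map eF) (fix_map eu) (fix_map ev) j.
Proof.
have Uact g b : range i (gact g b) <-> range i b by exact: range_act.
have [r [cr r0 rU rT ract]] := equivariant_retraction cs
  (cp_closed po (@closedT A)) Uact sat.
have fr (p : set_type (fix_ B) * R) : fix_ B (r (val p.1, p.2)).1.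
  move=> h Hh; have := ract h (val p.1) p.2.
  by rewrite (set_mem (valP p.1)) // => /(congr1 fst) /= <-.
pose rH (p : set_type (fix_ B) * R) : set_type (fix_ B) * R :=
  (SigSub (mem_set (fr p)), (r (val p.1, p.2)).2).
have cv : continuous (fun p : set_type (fix_ B) * R => r (val p.1, p.2)).
  exact: (comp_pair_continuous (comp_continuous (@fst_continuous _ R)
    (@continuous_set_val _ (fix_ B))) (@snd_continuous _ R) cr).
apply: (cylinder_of_retraction fixed_pushout (r := rH)).
- apply: pair_continuous; last exact: (comp_continuous cv (@snd_continuous _ _)).
  apply: continuous_subtype; exact: (comp_continuous cv (@fst_continuous _ _)).
- by move=> b; congr pair; [apply: val_inj|]; rewrite /= r0.
- move=> a t; have h : range i (i (val a)) by exists (val a).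
  by congr pair; [apply: val_inj|]; rewrite /= rU.
- move=> [b t]; have [[h|h] _] := rT (val b, t); [by left|right].
  have [a _ e] := h; have fa : fix_ A a.
    by apply: (fix_of_inj ei (cp_inj po)); rewrite e; exact: (fr (b, t)).
  by exists (SigSub (mem_set fa)) => //; exact: val_inj.
Qed.

End FixedPoints.

(** * Blocks of an induced space *)

Definition sg_mk (G : groupType) (H : subgroup G) (x : G) (h : sg_set H x) :
  sg_type H := exist (fun x => x \in (H : set G)) x (mem_set h).

Section Blocks.
Variables (R : realType) (G : groupType) (I : choiceType).
Variables (N : I -> subgroup G) (Y : forall i, gspace (sg_type (N i))).
Let CI : gspace G := coprod_gspace (fun i => ind_gspace (Y i)).
Local Notation pt i g := (@ind_pt G I N Y i g).

Definition block_index : choiceType := {i : I & lcosets (N i)}.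

(** A coproduct of induced spaces is a disjoint union of copies of the spaces
   [Y i], one for each coset of [N i]; these are the blocks. *)
Definition block (p : CI) : block_index :=
  existT _ (projT1 p) (coset_of (N (projT1 p)) (repr (projT2 p : ind _)).1).

Lemma blockE i g y : block (pt i g y) = existT _ i (coset_of (N i) g).
Proof.
rewrite /block /=; congr existT; apply/coset_ofP.
have [n [e _]] := ind_repr g y; rewrite {2}e mulKg.
exact: (set_mem (valP n)).
Qed.

Definition rep_of (l : block_index) : G := repr (projT2 l).

Lemma rep_ofK (l : block_index) : existT _ (projT1 l) (coset_of _ (rep_of l)) = l.
Proof. by case: l => i q; rewrite /rep_of /= coset_of_repr. Qed.

Lemma block_coord (p : CI) : exists y, p = pt (projT1 (block p)) (rep_of (block p)) y.
Proof.
have [i [g [y ->]]] := ind_ptP p; rewrite blockE /rep_of /=.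
have h := repr_coset_of (N i) g.
pose n : sg_type (N i) := sg_mk h.
exists (gact n^-1%g y); apply/ind_pt_eqP; exists n^-1%g; split=> //.
rewrite -[val _]/((g^-1 * repr (coset_of (N i) g))^-1)%g.
by rewrite invgM invgK mulgA mulgV mul1g.
Qed.

Lemma ind_pt_inj i g : injective (pt i g).
Proof.
move=> y z /ind_pt_eqP[n [e ->]]; have n1 : n = 1%g.
  by apply: val_inj; apply: (mulgI g); rewrite -e /= mulg1.
by rewrite n1 gact1.
Qed.

Variable H : set G.
Local Notation fixC := (fixed_points CI H).

Definition block_fixed (l : block_index) : set (Y (projT1 l)) :=
  [set y | fixC (pt (projT1 l) (rep_of l) y)].

Arguments block_fixed : clear implicits.

Hypothesis cfix : closed fixC.
Variable LL : set block_index.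
Hypothesis LL_block : forall p, fixC p -> LL (block p).
Hypothesis LL_contr : forall l, LL l -> contractible R (set_type (block_fixed l)).

(** The contractions of the fixed points of the single blocks glue, since a subset
   is closed as soon as its trace on each block is. The index set [LL] is a
   parameter, so that two spaces with the same subgroups can share it. *)
Lemma ind_block_contraction : exists lam base (k : set_type fixC * R -> set_type fixC),
  @block_contraction R _ (set_type LL) lam base k /\
  forall x, val (lam x : set_type LL) = block (val x).
Proof.
have exK l : exists K : set_type (block_fixed l) * R -> set_type (block_fixed l),
    [/\ continuous K, forall y, K (y, 0) = y & forall y z, K (y, 1) = K (z, 1)].
  have [Ll|nL] := pselect (LL l).
    have /contractibleP[d0 [K [cK K0 K1]]] := LL_contr Ll.
    by exists K; split=> // y z; rewrite !K1.
  exists fst; split=> //; first exact: fst_continuous.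
  move=> y; exfalso; apply: nL; have := LL_block (set_mem (valP y)).
  by rewrite blockE rep_ofK.
pose K l := projT1 (cid (exK l)).
have KP l : [/\ continuous (K l), forall y, K l (y, 0) = y &
    forall y z, K l (y, 1) = K l (z, 1)] by exact: (projT2 (cid (exK l))).
have pt_fix l (y : set_type (block_fixed l)) : fixC (pt (projT1 l) (rep_of l) (val y)).
  exact: (set_mem (valP y)).
pose q l (y : set_type (block_fixed l)) : set_type fixC := SigSub (mem_set (pt_fix l y)).
have qblock l y : block (val (q l y)) = l by rewrite blockE rep_ofK.
have qcov (x : set_type fixC) : exists y, x = q (block (val x)) y.
  have [y e] := block_coord (val x).
  have fy : block_fixed _ y by rewrite /block_fixed /= -e; exact: (set_mem (valP x)).
  by exists (SigSub (mem_set fy)); exact: val_inj.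
pose yof x := projT1 (cid (qcov x)).
have yofP x : x = q (block (val x)) (yof x) by exact: (projT2 (cid (qcov x))).
pose k (p : set_type fixC * R) : set_type fixC := q (block (val p.1)) (K _ (yof p.1, p.2)).
have kq l y t : k (q l y, t) = q l (K l (y, t)).
  have gen l' (z : set_type (block_fixed l')) (e : l = l') :
      q l y = q l' z -> q l' (K l' (z, t)) = q l (K l (y, t)).
    case: _ / e z => z /(congr1 val) /ind_pt_inj /val_inj -> //.
  by apply: gen; rewrite ?qblock //; exact: yofP.
have cq l : continuous (q l).
  apply: continuous_subtype.
  exact: (comp_continuous (@continuous_set_val _ _) (@ind_pt_continuous _ _ _ _ (projT1 l) (rep_of l))).
have det (W : set (set_type fixC)) : (forall l, closed (q l @^-1` W)) -> closed W.
  move=> hW; rewrite -(val_preimage_image W).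
  apply: closed_preim; first exact: continuous_set_val.
  apply/ind_pt_closedP => i g; pose l : block_index := existT _ i (coset_of (N i) g).
  have h := repr_coset_of (N i) g.
  pose n : sg_type (N i) := sg_mk h.
  have ptn y : pt i g y = pt i (rep_of l) (gact n^-1%g y).
    apply/ind_pt_eqP; exists n^-1%g; split=> //.
    rewrite -[val _]/((g^-1 * repr (coset_of (N i) g))^-1)%g.
    by rewrite invgM invgK mulgA mulgV mul1g.
  have cl : closed (val @` (q l @^-1` W)).
    apply: closed_val_image; last exact: hW.
    exact: (closed_preim (@ind_pt_continuous _ _ _ _ i (rep_of l)) cfix).
  rewrite (_ : [set y | _] = gact n^-1%g @^-1` (val @` (q l @^-1` W))).
    by apply: closed_preim cl; exact: gact_cont.
  apply/seteqP; split=> y.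
    move=> [x Wx e]; have fy : block_fixed l (gact n^-1%g y).
      by rewrite /block_fixed /= -ptn -e; exact: (set_mem (valP x)).
    exists (SigSub (mem_set fy)) => //; rewrite /preimage /= (_ : q l _ = x) //.
    by apply: val_inj; rewrite /= -ptn e.
  move=> [y' Wy e]; exists (q l y') => //.
  by rewrite ptn -e.
have lamP (x : set_type fixC) : LL (block (val x)) by exact: (LL_block (set_mem (valP x))).
pose lam (x : set_type fixC) : discrete_topology (set_type LL) := SigSub (mem_set (lamP x)).
have exB (l : set_type LL) : exists x : set_type fixC, block (val x) = val l.
  have [d0 _] := LL_contr (set_mem (valP l)).
  by exists (q (val l) d0); rewrite qblock.
pose base0 (l : set_type LL) := projT1 (cid (exB l)).
have base0P l : block (val (base0 l)) = val l by exact: (projT2 (cid (exB l))).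
(* the base point of a block is where its contraction ends *)
exists lam, (fun l => k (base0 l, 1)), k; split=> //.
have lamk p : lam (k p) = lam p.1 by apply: val_inj; exact: qblock.
split=> //.
- apply/continuous_closedP => Z _; apply: det => l.
  have [Zl|nZ] := pselect (exists2 z, Z z & val (z : set_type LL) = l).
    rewrite (_ : _ @^-1` _ = setT); first exact: closedT.
    apply/seteqP; split=> // y _; have [z Zz zl] := Zl.
    by rewrite /preimage /= (_ : lam (q l y) = z) //; apply: val_inj; exact: (etrans (qblock l y) (esym zl)).
  rewrite (_ : _ @^-1` _ = set0); first exact: closed0.
  apply/seteqP; split=> // y Zy; apply: nZ; exists (lam (q l y)) => //=.
  exact: qblock.
- by move=> l; rewrite lamk; apply: val_inj; exact: base0P.
- apply: (@continuous_of_detection R block_index _ _ (fun l => set_type (block_fixed l)) q) => //.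
    by move=> x; exists (block (val x)); have [y e] := qcov x; exists y.
  move=> l; rewrite (_ : (fun p => _) = fun p => q l (K l p)).
    have [cK _ _] := KP l; exact: (comp_continuous cK (cq l)).
  by apply/funext => -[y t]; exact: kq.
- by move=> x; rewrite [in LHS](yofP x) kq; have [_ -> _] := KP (block (val x)); rewrite -yofP.
- move=> x; rewrite /k /=.
  have e : block (val (base0 (lam x))) = block (val x) by rewrite base0P.
  have gen l l' (z : set_type (block_fixed l)) (z' : set_type (block_fixed l')) :
      l = l' -> q l (K l (z, 1)) = q l' (K l' (z', 1)).
    move=> ll; case: _ / ll z' => z'; congr (q _ _).
    by have [_ _ h] := KP l; exact: h.
  exact: gen.
Qed.

End Blocks.

(** * Conjugates and bounded algebraic integers *)

Section Embeddings.
Variables (k : fieldExtType rat) (K : numClosedFieldType).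

Local Notation "p ^kk" := (map_poly (in_alg k) p) (at level 2, format "p ^kk").
Local Notation "p ^cc" := (map_poly (ratr : rat -> K) p) (at level 2, format "p ^cc").

Lemma rat_minpoly (a : k) : exists q : {poly rat},
  [/\ q \is monic, root q^kk a, (size q <= (\dim {:k}).+1)%N &
      forall p : {poly rat}, root p^kk a -> q %| p].
Proof.
have /polyOver1P[q e] := minPolyOver 1%AS a.
exists q; split.
- by rewrite -(map_monic (in_alg k)) -e monic_minPoly.
- by rewrite -e root_minPoly.
- rewrite -(size_map_poly (in_alg k)) -e size_minPoly ltnS.
  by have := dim_Fadjoin 1%AS a; rewrite dimv1 muln1 => <-; exact: dimvS (subvf _).
- move=> p pa; rewrite -(dvdp_map (in_alg k)) -e; apply: minPoly_dvdp => //.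
  by apply/polyOver1P; exists p.
Qed.

Lemma primitive_element : exists th : k, forall x : k, exists q : {poly rat}, x = q^kk.[th].
Proof.
have sep : separable 1%AS {:k}%AS.
  apply/separableP => y _; apply: pcharf0_separable.
  by move=> p; rewrite pchar_lalg pchar_num.
exists (separable_generator 1%AS {:k}%AS) => x.
have := eq_adjoin_separable_generator sep (sub1v _) => e.
have : x \in <<1%AS; separable_generator 1%AS {:k}%AS>>%VS by rewrite -e memvf.
by case/Fadjoin_polyP => p /polyOver1P[q ->] ->; exists q.
Qed.

Lemma embedding_of_root (th : k) (P : {poly rat}) (t : K) :
  (forall x : k, exists q : {poly rat}, x = q^kk.[th]) ->
  (forall q : {poly rat}, root q^kk th -> P %| q) -> root P^cc t ->
  exists s : {rmorphism k -> K}, forall q : {poly rat}, s q^kk.[th] = q^cc.[t].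
Proof.
move=> gen Pmin Pt.
have wd (q : {poly rat}) : q^kk.[th] = 0 -> q^cc.[t] = 0.
  move=> /rootP /Pmin; rewrite -(dvdp_map (ratr : rat -> K)) => /dvdpP[c ->].
  by rewrite hornerM (rootP Pt) mulr0.
pose f x := projT1 (cid (gen x)).
have fP x : x = (f x)^kk.[th] by exact: (projT2 (cid (gen x))).
pose s x : K := (f x)^cc.[t].
have sE q x : x = q^kk.[th] -> s x = q^cc.[t].
  move=> e; apply/eqP; rewrite -subr_eq0 -hornerN -hornerD -rmorphB /=.
  by apply/eqP/wd; rewrite rmorphB /= hornerD hornerN -fP e subrr.
have sB : {morph s : x y / x - y}.
  move=> x y; rewrite (sE (f x - f y)) /s ?rmorphB /= ?hornerD ?hornerN //.
  by rewrite -!fP.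
have sM : {morph s : x y / x * y}.
  by move=> x y; rewrite (sE (f x * f y)) /s ?rmorphM /= ?hornerM // -!fP.
have s1 : s 1 = 1 by rewrite (sE 1) ?rmorph1 ?hornerC.
pose Sa := GRing.isZmodMorphism.Build _ _ s sB.
pose Sm := GRing.isMonoidMorphism.Build _ _ s (conj s1 sM).
pose S : {rmorphism k -> K} := HB.pack s Sa Sm.
by exists S => q; exact: (sE q).
Qed.

(** Write [a = f(th)] with [th] primitive of minimal polynomial [P]. If no root
   [t'] of [P] satisfied [f(t') = t], then [P] would be coprime to [f - t] and
   divide [Q1 \Po f], where [q = ('X - t) Q1]. So the powers of [f] below [deg q]
   would be linearly dependent modulo [P] over [K]; as they have rational
   coefficients, they would be dependent over the rationals, against the
   minimality of [q]. *)
Lemma conjugate_embedding (a : k) (q : {poly rat}) (t : K) :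
  (forall p : {poly rat}, root p^kk a -> q %| p) -> q != 0 -> root q^kk a -> root q^cc t ->
  exists s : {rmorphism k -> K}, s a = t.
Proof.
move=> qmin q0 qa qt.
have [th gen] := primitive_element.
have [P [Pm Pth _ Pmin]] := rat_minpoly th.
have [f fa] := gen a.
suff [t' Pt' ft'] : exists2 t', root P^cc t' & f^cc.[t'] = t.
  have [s sP] := embedding_of_root gen Pmin Pt'.
  by exists s; rewrite fa sP.
apply: contrapT => nt.
have cop : coprimep P^cc (f^cc - t%:P).
  apply: Pdiv.ClosedField.root_coprimep => t' Pt'.
  rewrite hornerD hornerN hornerC subr_eq0; apply/eqP => e; apply: nt.
  by exists t'.
have [Q1 Q1E] := factor_theorem _ _ qt.
have Q1n0 : Q1 != 0.
  apply: contraNneq q0 => e; move: Q1E; rewrite e mul0r => /eqP.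
  by rewrite map_poly_eq0.
have sQ1 : size Q1 = (size q).-1.
  have := congr1 (fun p : {poly K} => size p) Q1E.
  by rewrite size_map_poly size_Mmonic ?monicXsubC // size_XsubC addn2 => ->.
have dv : P^cc %| Q1 \Po f^cc.
  rewrite -(Gauss_dvdpl _ cop).
  rewrite (_ : f^cc - t%:P = ('X - t%:P) \Po f^cc); last by rewrite comp_polyB comp_polyX comp_polyC.
  rewrite -comp_polyM -Q1E -map_comp_poly dvdp_map; apply: Pmin.
  by rewrite /root map_comp_poly horner_comp -fa (rootP qa).
pose m := (size q).-1; pose d := (size P).-1.
have P0 : P != 0 by exact: monic_neq0.
have sP : size P = d.+1 by rewrite /d prednK // size_poly_gt0.
have sq : size q = m.+1 by rewrite /m prednK // size_poly_gt0.
have szmod (F : fieldType) (g h : {poly F}) : size g = d.+1 -> (size (h %% g)%R <= d)%N.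
  by move=> sg; rewrite -ltnS -sg ltn_modp -size_poly_gt0 sg.
(* the rows are the powers of [f] below the degree of [q], reduced modulo [P] *)
pose M : 'M[rat]_(m, d) := \matrix_(i < m) poly_rV ((f ^+ i) %% P).
have mulM (F : fieldType) (g h : {poly F}) (u : 'rV[F]_m) : size g = d.+1 ->
    u *m (\matrix_(i < m) (poly_rV ((h ^+ i) %% g) : 'rV_d)) = poly_rV ((rVpoly u \Po h) %% g).
  move=> sg; have uE : rVpoly u = \sum_(i < m) u 0 i *: 'X^i.
    rewrite /rVpoly poly_def; apply: eq_bigr => i _.
    by rewrite insubT // => hi; congr (u _ _ *: _); exact: val_inj.
  rewrite uE linear_sum /=.
  have modp_sum (G : 'I_m -> {poly F}) : (\sum_i G i) %% g = \sum_i (G i %% g).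
    by apply: (big_morph (fun p => p %% g)) => [x y|]; [exact: modpD|exact: mod0p].
  rewrite modp_sum linear_sum mulmx_sum_row /=; apply: eq_bigr => i _.
  by rewrite rowK comp_polyZ comp_Xn_poly modpZl linearZ.
have kernel0 (F : fieldType) (g h : {poly F}) : size g = d.+1 ->
    (row_free (\matrix_(i < m) (poly_rV ((h ^+ i) %% g) : 'rV_d)) <->
     forall Q : {poly F}, (size Q <= m)%N -> g %| Q \Po h -> Q = 0).
  move=> sg; pose N : 'M[F]_(m, d) := \matrix_(i < m) (poly_rV ((h ^+ i) %% g) : 'rV_d); rewrite -/N.
  have z (Q : {poly F}) : (size Q <= m)%N -> (g %| Q \Po h) = ((poly_rV Q : 'rV_m) *m N == 0).
    move=> sQ; rewrite mulM // poly_rV_K // /dvdp -(inj_eq (can_inj (@rVpolyK F d))).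
    by rewrite linear0 poly_rV_K ?szmod // size_poly_eq0.
  split=> [/row_freeP[N' NN'] Q sQ|h0].
    rewrite z // => /eqP e; rewrite -(poly_rV_K sQ) -[poly_rV Q]mulmx1 -NN' mulmxA e.
    by rewrite mul0mx linear0.
  rewrite -kermx_eq0; apply/rowV0P => w /sub_kermxP wN.
  rewrite -[w]rVpolyK (h0 (rVpoly w)) ?linear0 //; first exact: size_poly.
  by rewrite z ?rVpolyK ?wN //; exact: size_poly.
have free : row_free M.
  apply/kernel0 => // Q sQ dQ; apply/eqP; apply: contraTT sQ => Q0.
  rewrite -ltnNge -sq; apply: dvdp_leq => //; apply: qmin.
  move: dQ; rewrite -(dvdp_map (in_alg k)) => /dvdpP[c].
  rewrite map_comp_poly => /(congr1 (horner^~ th)).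
  by rewrite horner_comp -fa hornerM (rootP Pth) mulr0 => /rootP.
have : row_free (map_mx (ratr : rat -> K) M) by rewrite row_free_map.
rewrite (_ : map_mx _ M = \matrix_(i < m) (poly_rV (((f^cc) ^+ i) %% P^cc) : 'rV_d)); last first.
  by apply/row_matrixP => i; rewrite -map_row !rowK map_poly_rV /= map_modp rmorphXn.
rewrite kernel0; last by rewrite size_map_poly.
move=> /(_ Q1); rewrite sQ1 leqnn => /(_ isT dv) /eqP; exact/negP.
Qed.

Lemma finite_roots (L : fieldType) (p : {poly L}) : p != 0 -> finite_set [set x | root p x].
Proof.
elim: {p}(size p) {-2}p (leqnn (size p)) => [|n IH] p sp p0.
  by move: sp; rewrite leqn0 size_poly_eq0 (negbTE p0).
have [[x px]|np] := pselect (exists x, root p x); last first.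
  by rewrite (_ : [set x | _] = set0) //; apply/seteqP; split=> // x px; apply: np; exists x.
have [q qE] := factor_theorem _ _ px.
have q0 : q != 0 by apply: contraNneq p0 => q0; rewrite qE q0 mul0r.
apply: (@sub_finite_set _ _ ([set x] `|` [set y | root q y])).
  move=> y /=; rewrite qE rootM root_XsubC => /orP[|/eqP]; by [right|left].
rewrite finite_setU; split; first exact: finite_set1.
by apply: IH => //; move: sp; rewrite qE size_Mmonic ?monicXsubC // size_XsubC addn2.
Qed.

Lemma coef_prod_bound (B : nat) (rs : seq K) (j : nat) :
  (forall t, t \in rs -> `|t| <= B%:R) ->
  `|(\prod_(t <- rs) ('X - t%:P))`_j| <= ((1 + B) ^ size rs)%:R.
Proof.
elim: rs j => [|t rs IH] j h.
  rewrite big_nil coef1 expn0; case: (j == 0)%N; by rewrite ?normr1 ?normr0 // ler01.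
rewrite big_cons mulrC mulrBr coefB coefMX coefMC expnS natrM natrD.
have h' : forall s, s \in rs -> `|s| <= B%:R by move=> s sr; apply: h; rewrite inE sr orbT.
apply: (le_trans (ler_normB _ _)); rewrite mulrDl lerD //.
  case: (j == 0)%N; first by rewrite normr0 mulr_ge0.
  by rewrite mul1r; exact: IH.
rewrite normrM mulrC ler_pM //; last exact: IH.
by apply: h; rewrite inE eqxx.
Qed.

Definition algebraic_integer (a : k) := integralOver (intr : int -> k) a.

(** The lemma of Gauss: the minimal polynomial divides a monic polynomial with
   integral coefficients. *)
Lemma integral_minpoly (a : k) : algebraic_integer a ->
  exists p : {poly int}, [/\ map_poly intr p \is (@monic rat),
     root (map_poly intr p : {poly rat})^kk a, (size p <= (\dim {:k}).+1)%N &
     forall q : {poly rat}, root q^kk a -> map_poly intr p %| q].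
Proof.
move=> [g gm ga]; have [q [qm qa sq qmin]] := rat_minpoly a.
have intk (p : {poly int}) : (map_poly intr p : {poly rat})^kk = map_poly intr p.
  by rewrite -map_poly_comp; apply: eq_map_poly => z /=; rewrite scaler_int.
have /dvdpP_rat_int[p1 [c c0 qE] [r rE]] : q %| map_poly intr g by apply: qmin; rewrite intk.
have lc : lead_coef p1 * lead_coef r = 1.
  by rewrite -lead_coefM -rE (monicP gm).
have lq : c * (lead_coef p1)%:~R = 1.
  have := monicP qm; rewrite qE lead_coefZ lead_coef_map_inj //; exact: intr_inj.
have qE' : exists p : {poly int}, q = map_poly intr p.
  have [l1|l1] : lead_coef p1 = 1 \/ lead_coef p1 = -1.
    by have := congr1 absz lc; rewrite abszM => /eqP; rewrite muln_eq1 => /andP[/eqP h _]; lia.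
    rewrite l1 in lq; exists p1; rewrite qE (_ : c = 1) ?scale1r //; by rewrite mulr1 in lq.
  rewrite l1 in lq; exists (- p1); rewrite qE (_ : c = -1) ?scaleN1r ?rmorphN //.
  by apply: oppr_inj; rewrite opprK -lq mulrN mulr1.
have [p pE] := qE'; exists p; rewrite -pE; split=> //.
by rewrite -(size_map_inj_poly (@intr_inj rat)) // -pE.
Qed.

(** The coefficients of the minimal polynomial are integers, and symmetric
   functions of the conjugates; all conjugates are values of embeddings. So
   finitely many polynomials occur. *)
Lemma bounded_integers_finite (B : nat) :
  finite_set [set a : k | algebraic_integer a /\
    forall s : {rmorphism k -> K}, `|s a| <= B%:R].
Proof.
pose d := (\dim {:k}).+1; pose M := ((1 + B) ^ d)%N.
(* coefficients between [- M] and [M], shifted to be natural numbers *)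
pose pol (c : {ffun 'I_d -> 'I_(2 * M).+1}) : {poly int} :=
  \poly_(j < d) (if insub j is Some i then (c i : nat)%:Z - M%:Z else 0).
pose rts c := [set a : k | map_poly intr (pol c) != 0 :> {poly k} /\
   root (map_poly intr (pol c)) a].
apply: (@sub_finite_set _ _ (\bigcup_(c in [set: {ffun 'I_d -> 'I_(2 * M).+1}]) rts c)); last first.
  apply: bigcup_finite; first exact: finite_finset.
  move=> c _; have [e|n0] := eqVneq (map_poly intr (pol c) : {poly k}) 0.
    by rewrite (_ : rts c = set0) //; apply/seteqP; split=> // a []; rewrite e eqxx.
  by apply: sub_finite_set (finite_roots n0) => a [].
move=> a [ai ab]; have [p [pm pa sp pmin]] := integral_minpoly ai.
have p0 : (map_poly intr p : {poly rat}) != 0 by exact: monic_neq0.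
have intk (q : {poly int}) : (map_poly intr q : {poly rat})^kk = map_poly intr q.
  by rewrite -map_poly_comp; apply: eq_map_poly => z /=; rewrite scaler_int.
have intc (q : {poly int}) : (map_poly intr q : {poly rat})^cc = map_poly intr q.
  by rewrite -map_poly_comp; apply: eq_map_poly => z /=; rewrite rmorph_int.
have [rs rsE] := closed_field_poly_normal (map_poly intr p : {poly K}).
have lp : lead_coef (map_poly intr p : {poly K}) = 1.
  by rewrite -intc lead_coef_map (monicP pm) rmorph1.
rewrite lp scale1r in rsE.
have srs : (size rs <= d)%N.
  have := congr1 (fun q : {poly K} => size q) rsE.
  rewrite size_prod_XsubC size_map_inj_poly //; last exact: intr_inj.
  by move=> e; rewrite -ltnS -e (leq_trans sp).
have bound j : (absz (p`_j)%R <= M)%N.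
  have : `|(map_poly intr p : {poly K})`_j| <= ((1 + B) ^ size rs)%:R.
    rewrite rsE; apply: coef_prod_bound => t tr.
    have [s <-] : exists s : {rmorphism k -> K}, s a = t.
      apply: (conjugate_embedding pmin) => //.
      by rewrite intc rsE root_prod_XsubC.
    exact: ab.
  rewrite coef_map /= -intr_norm -[X in _ <= X]/(((1 + B) ^ size rs)%N%:~R) ler_int.
  rewrite -abszE lez_nat => h; apply: (leq_trans h).
  by rewrite leq_pexp2l.
have cP (j : 'I_d) : (absz (p`_j + M%:Z)%R < (2 * M).+1)%N.
  have := bound j; rewrite ltnS; lia.
exists [ffun j => Ordinal (cP j)] => //.
rewrite /rts /= (_ : pol _ = p); first by rewrite -intk map_poly_eq0 p0.
apply/polyP => j; rewrite coef_poly; case: ltnP => jd; last by rewrite nth_default // (leq_trans sp).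
rewrite insubT ffunE /=; have := bound j.
move: (p`_j) => z; clearbody M. move=> h.
have hz : 0 <= z + M%:Z by lia.
by rewrite gez0_abs // addrK.
Qed.

End Embeddings.

Local Close Scope ring_scope.

Local Open Scope group_scope.

(** * Roots in a group *)

Section RootClosure.
Variables (G : groupType) (g : G).
Hypothesis ginf : forall n, (0 < n)%N -> g ^+ n != 1.
Hypothesis roots_comm : forall x n m, (0 < n)%N -> (0 < m)%N ->
  x ^+ n = g ^+ m -> commute x g.
Hypothesis cent_comm : forall x y, commute x g -> commute y g -> commute x y.
Hypothesis cent_tf : forall z d, commute z g -> (0 < d)%N -> z ^+ d = 1 -> z = 1.
Hypothesis roots_finite : finite_set [set x | exists2 n, (0 < n)%N & x ^+ n = g].

Lemma powersV (x y : G) : powers x y -> powers x y^-1.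
Proof. by move=> [n [->|->]]; exists n; [right|left; rewrite invgK]. Qed.

(** If [e] is a root of maximal index and [y] is commensurable to [g], the group
   generated by [e] and [y] is cyclic by Bezout, and its generator is a root of
   [g] of larger index unless [e] generates the same group. *)
Lemma maximal_root : exists e n, [/\ (0 < n)%N, e ^+ n = g &
  forall y b a, (0 < b)%N -> (0 < a)%N -> y ^+ b = g ^+ a \/ y ^+ b = g ^- a ->
    powers e y].
Proof.
have uniq_idx x m n : (0 < m)%N -> (m < n)%N -> x ^+ m = g -> x ^+ n = g -> False.
  move=> m0 mn xm xn; have nm : (0 < n - m)%N by rewrite subn_gt0.
  have x1 : x ^+ (n - m) = 1 by rewrite (expgnFr _ (ltnW mn)) xm xn mulgV.
  by have /negP := ginf nm; rewrite -xm expgnAC x1 expg1n eqxx.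
pose P n := `[< (0 < n)%N /\ exists x, x ^+ n = g >].
have [N NP] : exists N, forall n, P n -> (n <= N)%N.
  have /finite_seqP[s sE] := roots_finite.
  have [N h] : exists N, forall x n, x \in s -> (0 < n)%N -> x ^+ n = g -> (n <= N)%N.
    elim: {sE}s => [|x s [N IH]]; first by exists 0%N.
    have [[m [m0 xm]]|nx] := pselect (exists m, (0 < m)%N /\ x ^+ m = g).
      exists (maxn m N) => y n; rewrite inE => /orP[/eqP ->|ys] n0 yn; last first.
        by rewrite leq_max (IH y) ?orbT.
      rewrite leq_max; case: (ltngtP n m) => [//|mn|-> //].
      by case: (uniq_idx x m n).
    exists N => y n; rewrite inE => /orP[/eqP ->|ys] n0 yn; last exact: (IH y).
    by case: nx; exists n.
  exists N => n /asboolP[n0 [x xn]]; apply: (h x) => //.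
  have : [set x | exists2 n, (0 < n)%N & x ^+ n = g] x by exists n.
  by rewrite sE.
have P1 : P 1%N by apply/asboolP; split=> //; exists g; rewrite expg1.
case: (ex_maxnP (ex_intro P _ P1) NP) => n /asboolP[n0 [e en]] nmax.
exists e, n; split=> //.
suff main y b a : (0 < b)%N -> (0 < a)%N -> y ^+ b = g ^+ a -> powers e y.
  move=> y b a b0 a0 [h|h]; first exact: (main y b a).
  rewrite -(invgK y); apply: powersV; apply: (main _ b a) => //.
  by rewrite expVgn h invgK.
move=> b0 a0 yb.
have ye : commute y e.
  by apply: cent_comm; [exact: roots_comm yb|rewrite -en; exact: commuteX].
pose c := (n * a)%N; have c0 : (0 < c)%N by rewrite muln_gt0 n0.
have yc : y ^+ b = e ^+ c by rewrite yb -en expgnA.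
pose d := gcdn b c; have d0 : (0 < d)%N by rewrite gcdn_gt0 b0.
have [b' bE] : exists b', b = (b' * d)%N by exists (b %/ d)%N; rewrite divnK // dvdn_gcdl.
have [c' cE] : exists c', c = (c' * d)%N by exists (c %/ d)%N; rewrite divnK // dvdn_gcdr.
have b'0 : (0 < b')%N by move: b0; rewrite bE muln_gt0 => /andP[].
have cop : coprime b' c'.
  by rewrite /coprime -(eqn_pmul2r d0) muln_gcdl -bE -cE mul1n.
have ye' : y ^+ b' = e ^+ c'.
  have ce' : commute (y ^+ b') (e ^+ c') by exact: commuteX2.
  apply/eqP; rewrite -divg_eq1; apply/eqP.
  apply: (cent_tf (d := d)) => //.
    apply: commute_sym; apply: commuteM; last apply: commuteV.
      by apply: commuteX; apply: commute_sym; exact: roots_comm yb.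
    by apply: commuteX; apply: commute_sym; rewrite -en; exact: commuteX.
  by rewrite expgnFl // -!expgnA -bE -cE yc mulgV.
case: (egcdnP c' b'0) => u v uv _.
rewrite (eqP cop) in uv.
(* by Bezout, a generator of the group spanned by [e] and [y] *)
pose f := e ^+ u / y ^+ v.
have fe : f ^+ b' = e.
  rewrite /f expgnFl; last by apply: commuteX2; exact: commute_sym.
  rewrite -!expgnA uv [(v * b')%N]mulnC (expgnA y) ye' -expgnA [(c' * v)%N]mulnC.
  by rewrite addnC expgnDr expg1 mulgK.
have : (b' * n <= n)%N.
  apply: nmax; apply/asboolP; split; first by rewrite muln_gt0 b'0.
  by exists f; rewrite expgnA fe.
rewrite -{2}[n]mul1n leq_pmul2r // => b'1.
have b1 : b' = 1%N by apply/eqP; rewrite eqn_leq b'1.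
by exists c'; left; rewrite -ye' b1 expg1.
Qed.

End RootClosure.

Local Close Scope group_scope.

Local Open Scope ring_scope.

(** * Two by two matrices *)

Section TwoByTwo.
Variable F : fieldType.
Implicit Types A B x : 'M[F]_2.

Lemma ord2P (P : 'I_2 -> Prop) : P 0 -> P 1 -> forall i, P i.
Proof.
move=> h0 h1 [[|[|i]] hi] //; [rewrite (_ : Ordinal _ = 0)|rewrite (_ : Ordinal _ = 1)] => //;
  exact: val_inj.
Qed.

Lemma mx2P A B : A 0 0 = B 0 0 -> A 0 1 = B 0 1 -> A 1 0 = B 1 0 -> A 1 1 = B 1 1 -> A = B.
Proof. by move=> *; apply/matrixP; apply: ord2P; apply: ord2P. Qed.

Lemma mul2E A B i j : (A *m B) i j = A i 0 * B 0 j + A i 1 * B 1 j.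
Proof.
rewrite mxE big_ord_recl big_ord1; congr (_ + A i _ * B _ j); exact: val_inj.
Qed.

Lemma tr2E A : \tr A = A 0 0 + A 1 1.
Proof. by rewrite /mxtrace big_ord_recl big_ord1; congr (_ + A _ _); exact: val_inj. Qed.

Lemma scal2E (a : F) : ((a%:M : 'M_2) 0 0 = a) * ((a%:M : 'M_2) 1 1 = a) *
  ((a%:M : 'M_2) 0 1 = 0) * ((a%:M : 'M_2) 1 0 = 0).
Proof. by rewrite !mxE. Qed.

Definition lin2 (al be : F) A := al%:M + be *: A.

Lemma lin2E al be A : (lin2 al be A 0 0 = al + be * A 0 0) *
  (lin2 al be A 1 1 = al + be * A 1 1) * (lin2 al be A 0 1 = be * A 0 1) *
  (lin2 al be A 1 0 = be * A 1 0).
Proof. by rewrite !mxE /= !mulr0n !mulr1n !add0r. Qed.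

(** The equation says that the off-diagonal entries and the difference of the
   diagonal entries are proportional for [x] and [A]; some of these three numbers
   is nonzero for [A]. *)
Lemma commuting_span A x : (forall a, A != a%:M) -> x *m A = A *m x ->
  exists al be, x = lin2 al be A.
Proof.
move=> ns com.
have e i j : x i 0 * A 0 j + x i 1 * A 1 j = A i 0 * x 0 j + A i 1 * x 1 j.
  by rewrite -!mul2E com.
have z i j : x i 0 * A 0 j + x i 1 * A 1 j - (A i 0 * x 0 j + A i 1 * x 1 j) = 0.
  by rewrite e subrr.
have z00 := z 0 0; have z01 := z 0 1; have z10 := z 1 0.
have mk be : x 0 1 = be * A 0 1 -> x 1 0 = be * A 1 0 ->
    x 0 0 - x 1 1 = be * (A 0 0 - A 1 1) -> exists al be, x = lin2 al be A.
  move=> h1 h2 h3; exists (x 0 0 - be * A 0 0), be; apply: mx2P; rewrite lin2E //; first by ring.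
  by apply: subr0_eq; rewrite -[RHS](subrr (be * (A 0 0 - A 1 1))) -{2}h3; ring.
have [b0|b0] := eqVneq (A 0 1) 0; last first.
  apply: (mk (x 0 1 / A 0 1)); first by rewrite divfK.
    by apply: (mulIf b0); rewrite mulrAC divfK //; apply: subr0_eq; rewrite -[RHS]oppr0 -z00; ring.
  by apply: (mulIf b0); rewrite mulrAC divfK //; apply: subr0_eq; rewrite -z01; ring.
have [c0|c0] := eqVneq (A 1 0) 0; last first.
  apply: (mk (x 1 0 / A 1 0)); last 1 first.
  - by apply: (mulIf c0); rewrite mulrAC divfK //; apply: subr0_eq; rewrite -[RHS]oppr0 -z10; ring.
  - by apply: (mulIf c0); rewrite mulrAC divfK //; apply: subr0_eq; rewrite -z00; ring.
  - by rewrite divfK.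
have d0 : A 0 0 - A 1 1 != 0.
  rewrite subr_eq0; apply: contraNneq (ns (A 0 0)) => /esym e1.
  by apply/eqP/mx2P; rewrite scal2E.
have x01 : x 0 1 = 0.
  by apply: (mulIf d0); rewrite mul0r -[RHS]oppr0 -z01 b0; ring.
have x10 : x 1 0 = 0.
  by apply: (mulIf d0); rewrite mul0r -z10 c0; ring.
by apply: (mk ((x 0 0 - x 1 1) / (A 0 0 - A 1 1))); rewrite ?b0 ?c0 ?mulr0 // divfK.
Qed.

Lemma lin2_comm al be al' be' A : lin2 al be A *m lin2 al' be' A = lin2 al' be' A *m lin2 al be A.
Proof. by apply: mx2P; rewrite !mul2E !lin2E; ring. Qed.

Lemma tr_lin2 al be A : \tr (lin2 al be A) = al *+ 2 + be * \tr A.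
Proof. by rewrite !tr2E !lin2E; ring. Qed.

Lemma det2E A : \det A = A 0 0 * A 1 1 - A 0 1 * A 1 0.
Proof.
rewrite (expand_det_row _ ord0) big_ord_recl big_ord1 /cofactor !det_mx11 !mxE /=.
rewrite expr0 mul1r expr1 mulN1r mulrN.
by congr (_ * A _ _ - A _ _ * A _ _); exact: val_inj.
Qed.

Lemma det_lin2 al be A :
  \det (lin2 al be A) = al ^+ 2 + al * be * \tr A + be ^+ 2 * \det A.
Proof. by rewrite !det2E tr2E !lin2E; ring. Qed.

Lemma disc_lin2 al be A : \det A = 1 -> \det (lin2 al be A) = 1 ->
  \tr (lin2 al be A) ^+ 2 - 4%:R = be ^+ 2 * (\tr A ^+ 2 - 4%:R).
Proof.
move=> dA dx; have : \tr (lin2 al be A) ^+ 2 - 4%:R * \det (lin2 al be A) = be ^+ 2 * (\tr A ^+ 2 - 4%:R * \det A).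
  by rewrite det_lin2 tr_lin2; ring.
by rewrite dA dx !mulr1.
Qed.

Lemma cayley2 A : A *m A = \tr A *: A - (\det A)%:M.
Proof. by apply: mx2P; rewrite !mul2E !mxE /= det2E tr2E ?mulr1n ?mulr0n; ring. Qed.

Definition pow2 A n : 'M[F]_2 := iter n (mulmx A) 1%:M.

Lemma pow2S A n : pow2 A n.+1 = A *m pow2 A n. Proof. by []. Qed.

Lemma tr_pow2SS A n : \det A = 1 ->
  \tr (pow2 A n.+2) = \tr A * \tr (pow2 A n.+1) - \tr (pow2 A n).
Proof.
move=> dA; rewrite 2!pow2S mulmxA cayley2 dA mulmxBl mul1mx -scalemxAl.
by rewrite raddfB /= mxtraceZ.
Qed.

Lemma pow2_unipotent (e c : F) (Nm : 'M[F]_2) n : Nm *m Nm = 0 ->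
  pow2 (e *: lin2 1 c Nm) n = e ^+ n *: lin2 1 (c *+ n) Nm.
Proof.
move=> N2; elim: n => [|n IH]; first by rewrite mulr0n /lin2 scale0r addr0 expr0 scale1r.
rewrite pow2S IH -scalemxAl -scalemxAr scalerA -exprS; congr (_ *: _).
rewrite /lin2 mulmxDl !mulmxDr !mul1mx mulmx1 -scalemxAl -scalemxAr N2 !scaler0 addr0.
by rewrite -addrA -scalerDl mulrSr.
Qed.

End TwoByTwo.

(** * Traces in SL2 of a ring of integers *)

Section Arithmetic.
Variables (k : fieldExtType rat) (K : numClosedFieldType).
Hypothesis Karch : forall z : K, exists n : nat, `|z| <= n%:R.

Local Notation O := (ring_of_integers k).
Local Notation Gam := (SL2 O).

Definition mat (x : Gam) : 'M[k]_2 := map_mx (val : O -> k) (val x).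

Lemma matM x y : mat (x * y)%g = mat x *m mat y.
Proof. by rewrite /mat -map_mxM. Qed.

Lemma mat1 : mat 1%g = 1%:M.
Proof. exact: map_mx1. Qed.

Lemma mat_inj : injective mat.
Proof.
move=> x y e; apply: val_inj; apply/matrixP => i j; apply: val_inj.
by have := congr1 (fun M : 'M_2 => M i j) e; rewrite !mxE.
Qed.

Lemma det_mat x : \det (mat x) = 1.
Proof. by rewrite det_map_mx (eqP (valP x)) rmorph1. Qed.

Lemma matX x n : mat (x ^+ n)%g = pow2 (mat x) n.
Proof. by elim: n => [|n IH]; [exact: mat1|rewrite expgS matM IH]. Qed.

Lemma matV x : mat x^-1%g = (\tr (mat x))%:M - mat x.
Proof.
have h : mat x *m ((\tr (mat x))%:M - mat x) = 1%:M.
  by rewrite mulmxBr cayley2 det_mat mul_mx_scalar opprB addrC subrK.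
have h' : mat x^-1%g *m mat x = 1%:M by rewrite -matM mulVg mat1.
by rewrite -[LHS]mulmx1 -h mulmxA h' mul1mx.
Qed.

Lemma tr_matV x : \tr (mat x^-1%g) = \tr (mat x).
Proof. by rewrite matV raddfB /= mxtrace_scalar mulr2n addrK. Qed.

Lemma mat_integer x i j : algebraic_integer (mat x i j).
Proof. by rewrite mxE; apply/asboolP; exact: (valP (val x i j)). Qed.

(** The house of [a], that is, the largest absolute value of its conjugates, is at
   most [B]. *)
Definition house_le (B : nat) (a : k) := forall s : {rmorphism k -> K}, `|s a| <= B%:R.

Lemma house_leD B C a b : house_le B a -> house_le C b -> house_le (B + C) (a + b).
Proof.
move=> ha hb s; rewrite rmorphD natrD; apply: (le_trans (ler_normD _ _)).
by rewrite lerD.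
Qed.

Lemma house_leM B C a b : house_le B a -> house_le C b -> house_le (B * C) (a * b).
Proof. by move=> ha hb s; rewrite rmorphM natrM normrM ler_pM. Qed.

Lemma house_leN B a : house_le B a -> house_le B (- a).
Proof. by move=> ha s; rewrite rmorphN normrN. Qed.

Lemma house_leW B C a : (B <= C)%N -> house_le B a -> house_le C a.
Proof. by move=> BC ha s; apply: (le_trans (ha s)); rewrite ler_nat. Qed.

Lemma house_le_sqr B a : house_le B (a ^+ 2) -> house_le B.+1 a.
Proof.
move=> ha s; have := ha s; rewrite rmorphXn normrX => h.
have [h1|/ltW h1] := real_leP (normr_real (s a)) (@real1 K).
  by apply: (le_trans h1); rewrite ler1n.
apply: (@le_trans _ _ (`|s a| ^+ 2)); first by rewrite expr2 ler_peMr.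
by apply: (le_trans h); rewrite ler_nat.
Qed.

Lemma seq_bound (rs : seq K) : exists B : nat, forall t, t \in rs -> `|t| <= B%:R.
Proof.
elim: rs => [|t rs [B h]]; first by exists 0%N.
have [n hn] := Karch t; exists (n + B)%N => u; rewrite inE => /orP[/eqP ->|/h hu].
  by apply: (le_trans hn); rewrite ler_nat leq_addr.
by apply: (le_trans hu); rewrite ler_nat leq_addl.
Qed.

Lemma house_bounded a : exists B, house_le B a.
Proof.
have [q [qm qa _ _]] := rat_minpoly a.
have [rs rsE] := closed_field_poly_normal (map_poly (ratr : rat -> K) q).
have [B hB] := seq_bound rs; exists B => s; apply: hB.
have : root (map_poly (ratr : rat -> K) q) (s a).
  rewrite /root (_ : map_poly _ q = map_poly s (map_poly (in_alg k) q)).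
    by rewrite horner_map /= (rootP qa) rmorph0.
  rewrite -map_poly_comp; apply: eq_map_poly => c /=.
  exact/esym/(fmorph_eq_rat (s \o in_alg k)).
rewrite rsE rootZ ?root_prod_XsubC //.
by rewrite lead_coef_map fmorph_eq0 (monicP qm) oner_eq0.
Qed.

(** The entries of [x] are integers of bounded house. *)
Lemma finite_span (h : Gam) (B1 B2 : nat) :
  finite_set [set x : Gam | exists al be,
    [/\ mat x = lin2 al be (mat h), house_le B1 al & house_le B2 be]].
Proof.
have [C hC] : exists C, forall i j, house_le C (mat h i j).
  have [c00 h00] := house_bounded (mat h 0 0); have [c01 h01] := house_bounded (mat h 0 1).
  have [c10 h10] := house_bounded (mat h 1 0); have [c11 h11] := house_bounded (mat h 1 1).
  exists (c00 + c01 + c10 + c11)%N; apply: ord2P; apply: ord2P;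
    [apply: house_leW h00|apply: house_leW h01|apply: house_leW h10|apply: house_leW h11]; lia.
pose S := [set a : k | algebraic_integer a /\
  forall s : {rmorphism k -> K}, `|s a| <= (B1 + B2 * C)%:R].
have fS : finite_set S by exact: bounded_integers_finite.
pose e (x : Gam) := (((mat x 0 0, mat x 0 1), mat x 1 0), mat x 1 1).
have eI : injective e by move=> x y [*]; apply/mat_inj/mx2P.
apply: (@sub_finite_set _ _ (e @^-1` (((S `*` S) `*` S) `*` S))); last first.
  apply: finite_preimage; first by move=> x y _ _; exact: eI.
  by do 3!apply: finite_setX => //.
move=> x [al [be [xE h1 h2]]].
have key i j : S (mat x i j).
  split; first exact: mat_integer.
  suff : house_le (B1 + B2 * C) (mat x i j) by [].
  rewrite xE /lin2 mxE [X in house_le _ (X + _)]mxE [X in house_le _ (_ + X)]mxE.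
  apply: house_leD; last by apply: house_leM.
  by case: (i == j); rewrite ?mulr1n // mulr0n => s; rewrite rmorph0 normr0.
exact: (conj (conj (conj (key 0 0) (key 0 1)) (key 1 0)) (key 1 1)).
Qed.

(** An eigenvalue of the image under [s] of a matrix of determinant one and trace
   [t]; the other one is its inverse. *)
Definition eigen_root (s : {rmorphism k -> K}) (t : k) : K :=
  (s t + sqrtC (s t ^+ 2 - 4%:R)) / 2%:R.

Lemma eigen_rootP s t : eigen_root s t * (s t - eigen_root s t) = 1.
Proof.
have n2 : (2%:R : K) != 0 by rewrite pnatr_eq0.
rewrite /eigen_root; set r := sqrtC _; have r2 : r ^+ 2 = s t ^+ 2 - 4%:R by rewrite sqrtCK.
have -> : (s t + r) / 2%:R * (s t - (s t + r) / 2%:R) = (s t ^+ 2 - r ^+ 2) / 4%:R.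
  by field; rewrite ?n2.
by rewrite r2 opprB addrC subrK divff // pnatr_eq0.
Qed.

Lemma eigen_root_neq0 s t : eigen_root s t != 0.
Proof.
by apply: contraTneq (oner_neq0 K) => e; rewrite -(eigen_rootP s t) e mul0r eqxx.
Qed.

Lemma eigen_rootV s t : (eigen_root s t)^-1 = s t - eigen_root s t.
Proof.
apply: (mulfI (eigen_root_neq0 s t)).
by rewrite mulfV ?eigen_root_neq0 // eigen_rootP.
Qed.

Lemma tr_eigen s (x : Gam) n (m := eigen_root s (\tr (mat x))) :
  s (\tr (pow2 (mat x) n)) = m ^+ n + m ^- n.
Proof.
have tE : s (\tr (mat x)) = m + m^-1 by rewrite eigen_rootV addrC subrK.
suff : s (\tr (pow2 (mat x) n)) = m ^+ n + m ^- n /\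
       s (\tr (pow2 (mat x) n.+1)) = m ^+ n.+1 + m ^- n.+1 by case.
elim: n => [|n [IH1 IH2]].
  rewrite /= mulmx1 mxtrace_scalar rmorphMn rmorph1 expr0 invr1 expr1; split=> //.
split=> //; rewrite tr_pow2SS ?det_mat // rmorphB rmorphM IH1 IH2 tE.
have m0 : m != 0 by exact: eigen_root_neq0.
by rewrite -!exprVn !exprS; set a := m ^+ n; set b := m^-1 ^+ n; field.
Qed.

(** If [m] is the eigenvalue of [x] of absolute value at least one, then
   [`|m| <= `|m ^+ n|], which the trace of the power bounds. *)
Lemma root_trace_bound (x y : Gam) (ep : k) n B : (0 < n)%N -> ep = 1 \/ ep = -1 ->
  pow2 (mat x) n = ep *: mat y -> house_le B (\tr (mat y)) -> house_le (2 * B.+1) (\tr (mat x)).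
Proof.
move=> n0 epE xn hB s; have := tr_eigen s x n.
set m := eigen_root s _; have m0 : m != 0 by exact: eigen_root_neq0.
have tE : s (\tr (mat x)) = m + m^-1 by rewrite eigen_rootV addrC subrK.
rewrite xn mxtraceZ rmorphM => e.
have ne : `|m ^+ n + m ^- n| <= B%:R.
  rewrite -e normrM; have -> : `|s ep| = 1.
    by case: epE => ->; rewrite ?rmorphN rmorph1 ?normrN normr1.
  by rewrite mul1r; exact: hB.
rewrite tE.
have main (z : K) : z != 0 -> 1 <= `|z| -> `|z ^+ n + z ^- n| <= B%:R ->
    `|z + z^-1| <= (2 * B.+1)%:R.
  move=> z0 z1 h.
  have zV (j : nat) : `|z ^- j| <= 1.
    by rewrite normrV ?unitfE ?expf_neq0 // invf_le1 ?normr_gt0 ?expf_neq0 // normrX exprn_ege1.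
  have zb : `|z| <= B.+1%:R.
    apply: (@le_trans _ _ (`|z ^+ n|)).
      by rewrite normrX -[leLHS]expr1 ler_weXn2l.
    have -> : z ^+ n = (z ^+ n + z ^- n) - z ^- n by rewrite addrK.
    apply: (le_trans (ler_normB _ _)); rewrite -natr1 lerD //.
  apply: (le_trans (ler_normD _ _)); rewrite mul2n -addnn natrD lerD //.
  by apply: le_trans zb; apply: le_trans z1; have := zV 1%N; rewrite expr1.
have [m1|/ltW m1] := real_leP (@real1 K) (normr_real m); first exact: main.
rewrite addrC -{2}[m]invrK; apply: main; first by rewrite invr_eq0.
  by rewrite normrV ?unitfE // invf_ge1 ?normr_gt0.
by rewrite exprVn invrK addrC.
Qed.

(** The eigenvalues are roots of unity. *)
Lemma torsion_trace_bound (x : Gam) (ep : k) n : (0 < n)%N -> ep = 1 \/ ep = -1 ->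
  pow2 (mat x) n = ep%:M -> house_le 2 (\tr (mat x)).
Proof.
move=> n0 epE xn s; have := tr_eigen s x n.
set m := eigen_root s _; have m0 : m != 0 by exact: eigen_root_neq0.
have tE : s (\tr (mat x)) = m + m^-1 by rewrite eigen_rootV addrC subrK.
rewrite xn mxtrace_scalar rmorphMn /= => e.
have mn : m ^+ n = s ep.
  have s1 : s ep * s ep = 1.
    by rewrite -rmorphM; case: epE => ->; rewrite ?mulrNN mulr1 rmorph1.
  have w0 : m ^+ n != 0 by rewrite expf_neq0.
  apply/eqP; rewrite -subr_eq0 -sqrf_eq0; apply/eqP.
  have -> : (m ^+ n - s ep) ^+ 2 = m ^+ n * (m ^+ n + m ^- n - s ep *+ 2) + (s ep * s ep - 1).
    by set w := m ^+ n; field.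
  by rewrite -e subrr mulr0 s1 subrr addr0.
have nm : `|m| = 1.
  apply: (pexpIrn n0); rewrite ?nnegrE ?ler01 //.
  rewrite -normrX mn expr1n.
  by case: epE => ->; rewrite ?rmorphN rmorph1 ?normrN normr1.
rewrite tE; apply: (le_trans (ler_normD _ _)).
by rewrite normrV ?unitfE // nm invr1.
Qed.

End Arithmetic.

(** * Centralizers and roots in SL2 *)

Section SL2Elements.
Variables (k : fieldExtType rat) (K : numClosedFieldType).
Hypothesis Kreal : forall (s : {rmorphism k -> K}) x, s x \is Num.real.
Hypothesis Karch : forall z : K, exists n : nat, `|z| <= n%:R.

Local Notation O := (ring_of_integers k).
Local Notation Gam := (SL2 O).
Local Notation house_le := (@house_le k K).

Definition inforder (G : groupType) (x : G) := forall n, (0 < n)%N -> (x ^+ n != 1)%g.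

Lemma natrS_neq0 n : n.+1%:R != 0 :> k.
Proof.
have /pcharf0P h : [pchar k] =i pred0 by move=> p; rewrite pchar_lalg pchar_num.
by rewrite h.
Qed.

Let two_neq0 : 2%:R != 0 :> k := natrS_neq0 1.

Lemma sqr1P (a : k) : a ^+ 2 = 1 -> a = 1 \/ a = -1.
Proof. by move/eqP; rewrite sqrf_eq1 => /orP[] /eqP ->; [left|right]. Qed.

Lemma mat_scalar_sign (x : Gam) a : mat x = a%:M -> a = 1 \/ a = -1.
Proof. by move=> e; apply: sqr1P; rewrite -(det_mat x) e det_scalar. Qed.

Lemma sign_order (x : Gam) a : mat x = a%:M -> (x ^+ 2 = 1)%g.
Proof.
move=> e; have ha := mat_scalar_sign e; apply: mat_inj.
rewrite matX mat1 2!pow2S mulmx1 e -scalar_mxM.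
by case: ha => ->; rewrite ?mulrNN mulr1.
Qed.

Lemma inforder_nonscalar (x : Gam) : inforder x -> forall a, mat x != a%:M.
Proof.
move=> h a; apply/eqP => /sign_order e.
by have := h 2%N isT; rewrite e eqxx.
Qed.

Lemma inforderX (G : groupType) (x : G) n : (0 < n)%N -> inforder x -> inforder (x ^+ n)%g.
Proof. by move=> n0 h m m0; rewrite -expgnA h // muln_gt0 n0. Qed.

Lemma sign_pow (x : Gam) n a : (0 < n)%N -> inforder x -> pow2 (mat x) n != a%:M.
Proof. by move=> n0 h; rewrite -matX; apply: inforder_nonscalar; exact: inforderX. Qed.

Lemma mat_comm (x y : Gam) : commute x y <-> mat x *m mat y = mat y *m mat x.
Proof. by rewrite -!matM; split=> [->//|/mat_inj]. Qed.

Lemma comm_lin (h x : Gam) : inforder h -> commute x h ->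
  exists al be, mat x = lin2 al be (mat h).
Proof.
move=> hi /mat_comm; apply: commuting_span; exact: inforder_nonscalar.
Qed.

Lemma cent_abelian (h x y : Gam) : inforder h -> commute x h -> commute y h -> commute x y.
Proof.
move=> hi /(comm_lin hi)[a [b xE]] /(comm_lin hi)[a' [b' yE]].
by apply/mat_comm; rewrite xE yE lin2_comm.
Qed.

Section Fixed.
Variable h : Gam.
Hypothesis hi : inforder h.
Let t := \tr (mat h).

(** The discriminant [tr^2 - 4] determines the coefficient [be] up to sign unless
   [h] is parabolic. *)
Lemma disc_commuting (x : Gam) al be : mat x = lin2 al be (mat h) ->
  \tr (mat x) ^+ 2 - 4%:R = be ^+ 2 * (t ^+ 2 - 4%:R).
Proof. by move=> e; rewrite e disc_lin2 ?det_mat // -e det_mat. Qed.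

Lemma finite_comm (B1 B2 : nat) : finite_set [set x : Gam |
  exists al be, [/\ mat x = lin2 al be (mat h), house_le B1 (\tr (mat x)) & house_le B2 be]].
Proof.
have [T hT] := house_bounded Karch t; have [D hD] := house_bounded Karch (2%:R^-1 : k).
apply: sub_finite_set (finite_span Karch h ((B1 + B2 * T) * D) B2) => x [al [be [xE h1 h2]]].
exists al, be; split=> //.
have -> : al = (\tr (mat x) - be * t) / 2%:R.
  by rewrite xE tr_lin2 addrK -[al *+ 2]mulr_natr mulfK.
apply: house_leM => //; apply: house_leD => //; apply: house_leN; exact: house_leM.
Qed.

(** By [disc_commuting], a bound on the trace of [x] bounds its coefficients. *)
Lemma semisimple_finite B : t ^+ 2 != 4%:R -> finite_set [set x : Gam |
  commute x h /\ house_le B (\tr (mat x))].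
Proof.
move=> ss; have d0 : t ^+ 2 - 4%:R != 0 by rewrite subr_eq0.
have [C hC] := house_bounded Karch ((t ^+ 2 - 4%:R)^-1).
have [Q hQ] := house_bounded Karch (4%:R : k).
apply: sub_finite_set (finite_comm B ((B * B + Q) * C).+1) => x [xh hb].
have [al [be xE]] := comm_lin hi xh; exists al, be; split=> //.
apply: house_le_sqr; have -> : be ^+ 2 = (\tr (mat x) ^+ 2 - 4%:R) / (t ^+ 2 - 4%:R).
  by rewrite (disc_commuting xE) mulfK.
apply: house_leM => //; apply: house_leD; last exact: house_leN.
by rewrite expr2; exact: house_leM.
Qed.

(** Let [x] be a non-scalar torsion element. Its conjugate traces are real of
   absolute value at most two, so its discriminant is nonpositive in all
   embeddings. By [disc_commuting] the same holds for [h], and then for all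
   powers of [h]. So their traces are bounded by two, which leaves finitely many
   of them by [semisimple_finite]. *)
Lemma semisimple_torsion (x : Gam) (ep : k) n : t ^+ 2 != 4%:R -> commute x h ->
  (0 < n)%N -> ep = 1 \/ ep = -1 -> pow2 (mat x) n = ep%:M -> exists a, mat x = a%:M.
Proof.
move=> ss xh n0 epE xn; have [al [be xE]] := comm_lin hi xh.
have [b0|b0] := eqVneq be 0.
  by exists al; rewrite xE b0 /lin2 scale0r addr0.
exfalso; have tb := @torsion_trace_bound k K x ep n n0 epE xn.
have disc (s : {rmorphism k -> K}) (y : Gam) : commute y h -> s (\tr (mat y)) ^+ 2 <= 4%:R :> K.
  move=> yh; have [al' [be' yE]] := comm_lin hi yh.
  have ge0 (z : k) : 0 <= (s z) ^+ 2.
    by rewrite -real_normK; [exact: exprn_ge0|exact: Kreal].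
  have tx4 : (s (\tr (mat x))) ^+ 2 <= 4%:R.
    have -> : (4%:R : K) = 2%:R ^+ 2 by rewrite -natrX.
    rewrite -real_normK; last exact: Kreal.
    by rewrite ler_pXn2r // ?nnegrE ?ler0n.
  have e1 := congr1 s (disc_commuting xE); have e2 := congr1 s (disc_commuting yE).
  rewrite !(rmorphB, rmorphM, rmorphXn, rmorph_nat) /= in e1 e2.
  have b2 : 0 < s be ^+ 2.
    by rewrite lt_def ge0 andbT expf_neq0 // fmorph_eq0.
  rewrite -subr_le0 e2 mulr_ge0_le0 //; first exact: ge0.
  by rewrite -(pmulr_rle0 _ b2) -e1 subr_le0.
have fin := semisimple_finite 2 ss.
apply: (infinite_nat : infinite_set [set: nat]).
have sub : [set: nat] `<=` (fun j => (h ^+ j)%g) @^-1` [set x : Gam | commute x h /\ house_le 2 (\tr (mat x))].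
  move=> j _; split; first by apply: commute_sym; exact: commuteX.
  move=> s; have hj : commute (h ^+ j)%g h by apply: commute_sym; exact: commuteX.
  have := disc s _ hj; rewrite -real_normK; last exact: Kreal.
  have -> : (4%:R : K) = 2%:R ^+ 2 by rewrite -natrX.
  by rewrite ler_pXn2r // ?nnegrE ?ler0n.
apply: sub_finite_set sub _; apply: finite_preimage => //.
move=> i j _ _ /= e; apply: contrapT => /eqP; rewrite neq_ltn.
wlog ij : i j e / (i < j)%N.
  by move=> w /orP[ij|ij]; [apply: (w i j)|apply: (w j i)] => //; rewrite ij.
move=> _; have ji : (0 < j - i)%N by rewrite subn_gt0.
have := hi ji; rewrite (expgnFr _ (ltnW ij)) -e mulgV eqxx //.
Qed.

Hypothesis par : t ^+ 2 = 4%:R.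
Let ep : k := t / 2%:R.
(** In the parabolic case [h] is a sign times a unipotent matrix [1 + Nm]. *)
Let Nm : 'M[k]_2 := ep *: mat h - 1%:M.

Lemma half_sq (a : k) : a ^+ 2 = 4%:R -> (a / 2%:R) ^+ 2 = 1.
Proof.
move=> e; rewrite expr_div_n e -natrX divff //; exact: (natrS_neq0 3).
Qed.

Lemma parabolic_sign : ep * ep = 1.
Proof. by rewrite -expr2 half_sq. Qed.

Lemma parabolic_trace : t = ep *+ 2.
Proof. by rewrite -[ep *+ 2]mulr_natr /ep divfK. Qed.

Lemma parabolic_nilpotent : Nm *m Nm = 0.
Proof.
rewrite /Nm mulmxBl mulmxBr mul1mx mulmx1 -scalemxAl -scalemxAr scalerA parabolic_sign scale1r.
rewrite cayley2 det_mat -/t parabolic_trace; move: (mat h) ep => A e.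
by apply/matrixP => i j; rewrite !mxE; ring.
Qed.

Lemma parabolic_nilpotent_tr : \tr Nm = 0.
Proof.
by rewrite raddfB /= mxtraceZ -/t mxtrace_scalar parabolic_trace mulrnAr parabolic_sign subrr.
Qed.

Lemma parabolic_indep a b : lin2 a b Nm = 0 -> a = 0 /\ b = 0.
Proof.
move=> e; have a0 : a = 0.
  have := congr1 mxtrace e; rewrite tr_lin2 parabolic_nilpotent_tr mulr0 addr0 mxtrace0.
  by rewrite -[a *+ 2]mulr_natr => /eqP; rewrite mulf_eq0 (negbTE two_neq0) orbF => /eqP.
split=> //; apply: contrapT => /eqP b0; have Nm0 : Nm = 0.
  by move/eqP: e; rewrite a0 /lin2 raddf0 add0r scaler_eq0 (negbTE b0) => /eqP.
have := inforder_nonscalar hi ep; rewrite -[mat h]scale1r -parabolic_sign -scalerA.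
move: Nm0 => /eqP; rewrite subr_eq0 => /eqP ->.
by rewrite scale_scalar_mx mulr1 eqxx.
Qed.

Lemma parabolic_form (x : Gam) al be : mat x = lin2 al be (mat h) ->
  exists e', e' ^+ 2 = 1 /\ mat x = e' *: lin2 1 (e' * ep * be) Nm.
Proof.
move=> xE; pose e' := \tr (mat x) / 2%:R; exists e'; have e2 : e' ^+ 2 = 1.
  apply: half_sq; apply/eqP; rewrite -subr_eq0 (disc_commuting xE) par subrr mulr0 //.
split=> //; have e'E : e' = al + be * ep.
  by rewrite /e' xE tr_lin2 -/t parabolic_trace mulrnAr -mulrnDl -[(_ + _) *+ 2]mulr_natr mulfK.
rewrite /lin2 scalerDr scalerA 2!mulrA -expr2 e2 mul1r.
rewrite /Nm scalerBr scalerA [ep * be * ep]mulrAC parabolic_sign mul1r.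
rewrite {1}xE /lin2; apply/matrixP => i j; rewrite !mxE e'E.
by case: (i == j); rewrite ?mulr1n ?mulr0n; ring.
Qed.

Lemma parabolic_torsion (x : Gam) a n : commute x h -> (0 < n)%N ->
  pow2 (mat x) n = a%:M -> exists b, mat x = b%:M.
Proof.
move=> xh n0 xn; have [al [be xE]] := comm_lin hi xh.
have [e' [e2 xF]] := parabolic_form xE.
rewrite xF pow2_unipotent ?parabolic_nilpotent // in xn.
have e'n : e' ^+ n != 0 by rewrite expf_neq0 // -sqrf_eq0 e2 oner_eq0.
move: (e' * ep * be) xF xn => ga xF xn.
have [_ g0] : 1 - a / e' ^+ n = 0 /\ ga *+ n = 0.
  apply: parabolic_indep; move: xn => /(congr1 (fun M => (e' ^+ n)^-1 *: M)).
  rewrite scalerA mulVf // scale1r scale_scalar_mx => e.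
  rewrite /lin2; move: e; rewrite /lin2 => e.
  by rewrite raddfB /= addrAC e mulrC subrr.
exists e'; rewrite xF /lin2.
have -> : ga = 0.
  move: g0; rewrite -[ga *+ n]mulr_natr => /eqP; rewrite mulf_eq0 => /orP[/eqP //|].
  by case: (n) n0 => // m _; rewrite (negbTE (natrS_neq0 m)).
by rewrite scale0r addr0 scale_scalar_mx mulr1.
Qed.

(** Taking an [n]-th root divides the coefficient of [Nm] by [n], so its house is
   at most one. *)
Lemma parabolic_roots (x : Gam) (e0 : k) n : commute x h -> (0 < n)%N -> e0 = 1 \/ e0 = -1 ->
  pow2 (mat x) n = e0 *: mat h -> exists al be,
  [/\ mat x = lin2 al be (mat h), house_le 5 (\tr (mat x)) & house_le 2 be].
Proof.
move=> xh n0 e0E xn; have [al [be xE]] := comm_lin hi xh; exists al, be.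
have [e' [e2 xF]] := parabolic_form xE.
set ga := e' * ep * be in xF.
have hE : mat h = ep *: lin2 1 1 Nm.
  by rewrite /lin2 scale1r /Nm addrC subrK scalerA parabolic_sign scale1r.
have e00 : e0 * e0 = 1 by case: e0E => ->; rewrite ?mulrNN mulr1.
have g1 : ga *+ n = 1.
  move: xn; rewrite xF hE pow2_unipotent ?parabolic_nilpotent // scalerA => xn.
  set c := e' ^+ n in xn; set d := e0 * ep in xn.
  have [h1 h2] : c - d = 0 /\ c * (ga *+ n) - d = 0.
    apply: parabolic_indep; move/eqP: xn; rewrite -subr_eq0 => /eqP <-.
    by apply/matrixP => i j; rewrite !mxE; case: (i == j); rewrite ?mulr1n ?mulr0n; ring.
  have cd : c = d by apply: subr0_eq.
  have c0 : c != 0 by rewrite expf_neq0 // -sqrf_eq0 e2 oner_eq0.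
  by apply: (mulfI c0); rewrite mulr1; apply: subr0_eq; rewrite {2}cd.
have nn0 : n%:R != 0 :> k by case: (n) n0 => // m _; exact: natrS_neq0.
have gb : house_le 1 ga.
  move=> s; have -> : ga = n%:R^-1 by apply: (mulIf nn0); rewrite mulVf // mulr_natr.
  by rewrite fmorphV rmorph_nat normrV ?unitfE ?pnatr_eq0 -?lt0n // normr_nat invf_le1 ?ltr0n // ler1n.
split=> //.
  apply: house_le_sqr => s; rewrite (_ : \tr (mat x) ^+ 2 = 4%:R); first by rewrite rmorph_nat normr_nat.
  by apply/eqP; rewrite -subr_eq0 (disc_commuting xE) par subrr mulr0.
apply: house_le_sqr; rewrite (_ : be ^+ 2 = ga ^+ 2); first by rewrite expr2; exact: (house_leM gb gb).
have ep1 : ep ^+ 2 = 1 by rewrite expr2 parabolic_sign.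
by rewrite /ga exprMn exprMn e2 ep1 !mul1r.
Qed.

End Fixed.

Lemma commuting_torsion (h x : Gam) (ep : k) n : inforder h -> commute x h -> (0 < n)%N ->
  ep = 1 \/ ep = -1 -> pow2 (mat x) n = ep%:M -> exists a, mat x = a%:M.
Proof.
move=> hi xh n0 epE xn; have [par|ss] := eqVneq (\tr (mat h) ^+ 2) 4%:R.
  exact: (parabolic_torsion hi par xh n0 xn).
exact: (semisimple_torsion hi ss xh n0 epE xn).
Qed.

Lemma commuting_roots_finite (h : Gam) : inforder h ->
  finite_set [set x : Gam | commute x h /\ exists n ep,
    [/\ (0 < n)%N, ep = 1 \/ ep = -1 & pow2 (mat x) n = ep *: mat h]].
Proof.
move=> hi; have [par|ss] := eqVneq (\tr (mat h) ^+ 2) 4%:R.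
  apply: sub_finite_set (finite_comm h 5 2) => x [xh [n [ep [n0 epE xn]]]].
  exact: (parabolic_roots hi par xh n0 epE xn).
have [B hB] := house_bounded Karch (\tr (mat h)).
apply: sub_finite_set (semisimple_finite hi (2 * B.+1) ss) => x [xh [n [ep [n0 epE xn]]]].
split=> //; exact: (root_trace_bound n0 epE xn hB).
Qed.

End SL2Elements.

Local Close Scope ring_scope.

Local Open Scope group_scope.

(** * Infinite cyclic groups and the projection to PSL2 *)

Section PowersTheory.
Variable G : groupType.
Implicit Types (x y : G).

Lemma powers_mulX x (a b : nat) : powers x (x ^+ a * x ^- b).
Proof.
have [ba|/ltnW ab] := leqP b a.
  by exists (a - b)%N; left; rewrite expgnFr.
by exists (b - a)%N; right; rewrite expgnFr // invgM invgK.
Qed.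

Lemma powersM x y z : powers x y -> powers x z -> powers x (y * z).
Proof.
have cXV a b : x ^- a * x ^+ b = x ^+ b * x ^- a.
  by apply: commute_sym; apply: commuteV; apply: commuteX2.
move=> [a [->|->]] [b [->|->]].
- by exists (a + b)%N; left; rewrite expgnDr.
- exact: powers_mulX.
- by rewrite cXV; exact: powers_mulX.
- by exists (b + a)%N; right; rewrite expgnDr invgM.
Qed.

Lemma powers1 x : powers x 1.
Proof. by exists 0%N; left; rewrite expg0. Qed.

Lemma powers_self x : powers x x.
Proof. by exists 1%N; left; rewrite expg1. Qed.

Definition cyclic_subgroup x : subgroup G :=
  @Subgroup G (powers x) (powers1 x) (@powersM x) (@powersV G x).

Lemma subgX (H : subgroup G) x n : sg_set H x -> sg_set H (x ^+ n).
Proof. by move=> Hx; elim: n => [|n IH]; rewrite ?expg0 ?expgS; [exact: sg1|exact: sgM]. Qed.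

Lemma powers_sub (H : subgroup G) x : sg_set H x -> powers x `<=` H.
Proof. by move=> Hx y [n [->|->]]; [|apply: sgV]; exact: subgX. Qed.

Lemma powersI x : powers x^-1 = powers x.
Proof.
by apply/seteqP; split=> _ [n [->|->]]; exists n; rewrite ?expVgn ?invgK; [right|left|right|left].
Qed.

Lemma inforder_inj x m n : inforder x -> x ^+ m = x ^+ n -> m = n.
Proof.
move=> xi; wlog mn : m n / (m <= n)%N.
  move=> w e; have [|/ltnW] := leqP m n; first by move/w; apply.
  by move/w => /(_ (esym e)).
move=> e; apply/eqP; rewrite eqn_leq mn /= -subn_eq0 -leqn0 leqNgt; apply/negP => nm.
by have := xi _ nm; rewrite (expgnFr _ mn) e mulgV eqxx.
Qed.

Lemma powers_infinite x : infinite_set (powers x) <-> inforder x.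
Proof.
split=> [inf n n0|xi fin].
  apply/eqP => xn; apply: inf.
  apply: (@sub_finite_set _ _ ((fun j => x ^+ j) @` `I_n)); last first.
    by apply: finite_image; exact: finite_II.
  have red m : ((fun j => x ^+ j) @` `I_n) (x ^+ m).
    exists (m %% n)%N; first by rewrite /= ltn_mod.
    by rewrite [in RHS](divn_eq m n) expgnDr mulnC expgnA xn expg1n mul1g.
  move=> _ [m [->|->]]; first exact: red.
  have -> : x ^- m = x ^+ (m * n.-1).
    apply: (mulgI (x ^+ m)); rewrite mulgV -expgnDr -mulnS prednK // mulnC expgnA xn.
    by rewrite expg1n.
  exact: red.
apply: (infinite_nat : infinite_set [set: nat]).
apply: (@sub_finite_set _ _ ((fun j => x ^+ j) @^-1` powers x)).
  by move=> n _; exists n; left.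
by apply: finite_preimage fin => m n _ _; exact: inforder_inj.
Qed.

Lemma inforderP x n : inforder x -> x ^+ n = 1 -> n = 0%N.
Proof. by move=> xi e; apply: (inforder_inj xi); rewrite e expg0. Qed.

Lemma cyclic_generators x y : inforder x -> powers x y -> powers y x ->
  y = x \/ y = x^-1.
Proof.
move=> xi [m ym] [n xn].
have : x ^+ 1 = x ^+ (m * n) \/ x * x ^+ (m * n) = 1.
  case: ym xn => [->|->] [] xn; rewrite ?expVgn ?invgK -?expgnA in xn.
  - by left; rewrite expg1.
  - by right; rewrite {1}xn mulVg.
  - by right; rewrite {1}xn mulVg.
  - by left; rewrite expg1.
case=> [/(inforder_inj xi) /esym/eqP|].
  by rewrite muln_eq1 => /andP[/eqP m1 _]; move: ym; rewrite m1 expg1.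
by rewrite -expgS => /(inforderP xi).
Qed.

Lemma infinite_cyclicP (H : subgroup G) : infinite_cyclic H <->
  exists2 x, (H : set G) = powers x & inforder x.
Proof.
split=> [[[x e] inf]|[x e xi]]; first by exists x => //; apply/powers_infinite; rewrite -e.
by split; [exists x|rewrite e; exact/powers_infinite].
Qed.

Lemma conj_powers x g : conj_set (powers x) g = powers (x ^ g).
Proof.
apply/seteqP; split.
  move=> _ [_ [n [->|->]] <-]; exists n; rewrite ?conjVg conjXg; by [left|right].
move=> _ [n [->|->]].
  by exists (x ^+ n); rewrite ?conjXg //; exists n; left.
by exists (x ^- n); rewrite ?conjVg ?conjXg //; exists n; right.
Qed.

Program Definition conj_subgroup (H : subgroup G) (g : G) : subgroup G :=
  @Subgroup G (conj_set H g) _ _ _.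
Next Obligation. by move=> H g; exists 1; [exact: sg1|rewrite conj1g]. Qed.
Next Obligation.
by move=> H g _ _ [x Hx <-] [y Hy <-]; exists (x * y); [exact: sgM|rewrite conjMg].
Qed.
Next Obligation. by move=> H g _ [x Hx <-]; exists x^-1; [exact: sgV|rewrite conjVg]. Qed.

Lemma inforderJ x g : inforder x -> inforder (x ^ g).
Proof. by move=> xi n n0; rewrite -conjXg conjg_eq1 xi. Qed.

Lemma infinite_cyclicJ (H : subgroup G) g : infinite_cyclic H -> infinite_cyclic (conj_subgroup H g).
Proof.
move=> /infinite_cyclicP[x e xi]; apply/infinite_cyclicP; exists (x ^ g); last exact: inforderJ.
by rewrite /= e conj_powers.
Qed.

Lemma conj_set_sub (A B : set G) g : A `<=` B -> conj_set A g `<=` conj_set B g.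
Proof. by move=> AB _ [x Ax <-]; exists x => //; exact: AB. Qed.

Lemma conj_setK (A : set G) g : conj_set (conj_set A g) g^-1 = A.
Proof. by rewrite -conj_setM mulgV conj_set1. Qed.

Lemma conj_setKV (A : set G) g : conj_set (conj_set A g^-1) g = A.
Proof. by rewrite -conj_setM mulVg conj_set1. Qed.

Lemma maximal_infinite_cyclicJ (H : subgroup G) g :
  maximal_infinite_cyclic H -> maximal_infinite_cyclic (conj_subgroup H g).
Proof.
move=> [ic mx]; split; first exact: infinite_cyclicJ.
move=> L Lc /(conj_set_sub (g := g^-1)); rewrite conj_setK => HL.
have := mx (conj_subgroup L g^-1) (infinite_cyclicJ _ Lc) HL.
by move=> /(conj_set_sub (g := g)); rewrite /= conj_setKV.
Qed.

Lemma infinite_pigeonhole (T : choiceType) (A : set T) (f : nat -> T) :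
  finite_set A -> (forall n, A (f n)) -> exists i j, (i < j)%N /\ f i = f j.
Proof.
move=> fA fn; apply: contrapT => nij.
apply: (infinite_nat : infinite_set [set: nat]).
apply: (@sub_finite_set _ _ (f @^-1` A)); first by move=> n _; exact: fn.
apply: finite_preimage fA => i j _ _ e; apply: contrapT => /eqP.
rewrite neq_ltn => /orP[ij|ij]; apply: nij; first by exists i, j.
by exists j, i.
Qed.

Lemma finite_index_power (C H : subgroup G) x : finite_index C H -> sg_set H x ->
  exists2 n, (0 < n)%N & sg_set C (x ^+ n).
Proof.
move=> [_ fin] Hx.
have [|i [j [ij e]]] := infinite_pigeonhole (f := fun n => coset_of C (x ^+ n)) fin.
  by move=> n; exists (x ^+ n) => //; exact: subgX.
exists (j - i)%N; first by rewrite subn_gt0.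
move/coset_ofP: e; rewrite (expgnFr _ (ltnW ij)).
suff -> : x ^- i * x ^+ j = x ^+ j / x ^+ i by [].
by apply: commute_sym; apply: commuteV; apply: commuteX2.
Qed.

End PowersTheory.

Section PSL2Elements.
Variable k : fieldExtType rat.

Local Notation O := (ring_of_integers k).
Local Notation Gam := (SL2 O).
Local Notation PG := (PSL2 O).
Local Notation P := (@PSL2_proj O : Gam -> PG).

Lemma PSL2_projM (x y : Gam) : P (x * y) = P x * P y.
Proof. exact: (esym (quot_mulE _ x y)). Qed.

Lemma PSL2_projV (x : Gam) : P x^-1 = (P x)^-1.
Proof. exact: (esym (quot_invE _ x)). Qed.

Lemma PSL2_proj1 : P 1 = 1. Proof. by []. Qed.

Lemma PSL2_projX (x : Gam) n : P (x ^+ n) = P x ^+ n.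
Proof. by elim: n => [|n IH]; rewrite ?expg0 // !expgS PSL2_projM IH. Qed.

Lemma PSL2_projJ (x y : Gam) : P (x ^ y) = P x ^ P y.
Proof. by rewrite !conjgE !PSL2_projM PSL2_projV. Qed.

Lemma PSL2_proj_surj (g : PG) : exists x, g = P x.
Proof. by exists (repr g); rewrite /PSL2_proj /quot_proj coset_of_repr. Qed.

Local Open Scope ring_scope.

Lemma PSL2_proj_eq (x y : Gam) : P x = P y <-> mat y = mat x \/ mat y = - mat x.
Proof.
have mE (z : Gam) : val z = -1%:M <-> mat z = - 1%:M.
  rewrite /mat; split=> [->|e]; first by rewrite map_mxN map_mx1.
  apply/matrixP => i j; apply: val_inj.
  have := congr1 (fun M : 'M_2 => M i j) e; rewrite !mxE => ->.
  by rewrite rmorphN /=; case: (i == j); rewrite ?mulr1n ?mulr0n ?rmorph1 ?rmorph0.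
rewrite quot_projP; split.
  move=> [h|/mE h]; [left|right].
    have e : (x^-1 * y = 1)%g by exact: val_inj.
    by have := congr1 (fun z => x * z)%g e; rewrite mulVKg mulg1 => ->.
  have -> : y = (x * (x^-1 * y))%g by rewrite mulVKg.
  by rewrite matM h mulmxN mulmx1.
move=> [/mat_inj ->|e]; first by rewrite mulVg; left.
by right; apply/mE; rewrite matM e mulmxN -matM mulVg mat1.
Qed.

Lemma PSL2_projX_eq (x y : Gam) n : (P x ^+ n)%g = P y <-> exists2 ep, ep = 1 \/ ep = -1 & pow2 (mat x) n = ep *: mat y.
Proof.
rewrite -PSL2_projX; split.
  move=> /esym /PSL2_proj_eq; rewrite matX => -[e|e]; [exists 1|exists (-1)]; rewrite ?scale1r ?scaleN1r //; by [left|right].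
move=> [ep epE e]; apply/esym/PSL2_proj_eq; rewrite matX e.
by case: epE => ->; rewrite ?scale1r ?scaleN1r; [left|right].
Qed.

Lemma PSL2_proj_eq1 (x : Gam) : P x = 1%g <-> exists a, mat x = a%:M.
Proof.
split.
  move=> /esym; rewrite -PSL2_proj1 => /PSL2_proj_eq[]; rewrite mat1 => e; [exists 1|exists (-1)] => //.
  by rewrite e raddfN.
move=> [a e]; rewrite -PSL2_proj1; apply/esym/PSL2_proj_eq; rewrite mat1 e.
by case: (mat_scalar_sign e) => ->; [left|right; rewrite raddfN].
Qed.

Lemma inforder_PSL2_proj (x : Gam) : inforder (P x) <-> inforder x.
Proof.
split=> h n n0; apply/eqP => e; first by have := h n n0; rewrite -PSL2_projX e PSL2_proj1 eqxx.
move: e; rewrite -PSL2_projX => /PSL2_proj_eq1[a e]; have := inforderX n0 h.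
by move/inforder_nonscalar => /(_ a); rewrite e eqxx.
Qed.

(** By Cayley and Hamilton, the square of [x] is minus the identity. *)
Lemma trace0_order (x : Gam) : \tr (mat x) = 0 -> ~ inforder x.
Proof.
move=> t0 xi; have := sign_pow (n := 2) (-1) isT xi.
by rewrite 2!pow2S mulmx1 cayley2 det_mat t0 scale0r sub0r raddfN eqxx.
Qed.

End PSL2Elements.

Local Close Scope group_scope.

Local Open Scope ring_scope.

(** * Maximal infinite cyclic subgroups of PSL2 *)

Section MaximalCyclic.
Variables (k : fieldExtType rat) (K : numClosedFieldType).
Hypothesis Kreal : forall (s : {rmorphism k -> K}) x, s x \is Num.real.
Hypothesis Karch : forall z : K, exists n : nat, `|z| <= n%:R.

Local Notation O := (ring_of_integers k).
Local Notation Gam := (SL2 O).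
Local Notation PG := (PSL2 O).
Local Notation P := (@PSL2_proj O : Gam -> PG).

Lemma tr_conj (x h : Gam) : \tr (mat (h ^ x)%g) = \tr (mat h).
Proof. by rewrite conjgE matM mxtrace_mulC -matM -mulgA mulgV mulg1. Qed.

(** If [x] and [h] commuted up to the sign, [h] would be conjugate to its opposite
   and have trace zero. *)
Lemma PSL2_proj_commute (x h : Gam) : inforder h -> commute (P x) (P h) -> commute x h.
Proof.
move=> hi; rewrite /commute -!PSL2_projM => /PSL2_proj_eq[/mat_inj -> //|e]; exfalso.
apply: (trace0_order (x := h)) => //.
have e2 : mat (h ^ x)%g = - mat h.
  by rewrite conjgE matM e mulmxN -matM mulgA mulVg mul1g.
have /eqP := congr1 mxtrace e2; rewrite tr_conj raddfN /=.
rewrite -subr_eq0 opprK -mulr2n -mulr_natr mulf_eq0 (negbTE (natrS_neq0 k 1)) orbF.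
by move/eqP.
Qed.

Lemma PSL2_proj_roots_commute (h x : Gam) n m : inforder h -> (0 < n)%N -> (0 < m)%N ->
  (P x ^+ n = P h ^+ m)%g -> commute x h.
Proof.
move=> hi n0 m0; rewrite -[(P h ^+ m)%g]PSL2_projX => /PSL2_projX_eq[ep _ e].
have hm : inforder (h ^+ m)%g by exact: inforderX.
have xm : commute x (h ^+ m)%g.
  apply/mat_comm; have c : pow2 (mat x) n *m mat x = mat x *m pow2 (mat x) n.
    by rewrite -matX -!matM; congr mat; apply: commute_sym; exact: commuteX.
  have epn : ep != 0.
    apply: contraTneq (oner_neq0 k) => e0; move: e; rewrite e0 scale0r -matX => e.
    by rewrite -(det_mat (x ^+ n)%g) e det0 eqxx.
  move: c; rewrite e -scalemxAl -scalemxAr => /(scalerI epn) ->//.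
have hm' : commute h (h ^+ m)%g by exact: commuteX.
exact: (cent_abelian hm xm hm').
Qed.

(** This is [maximal_root] applied to [P h]; its assumptions are the facts on
   centralizers and roots in SL2, carried over by [PSL2_proj_commute]. *)
Lemma maximal_cyclic_over (h : Gam) : inforder h -> exists M : subgroup PG,
  [/\ maximal_infinite_cyclic M, sg_set M (P h) &
   forall L : subgroup PG, infinite_cyclic L ->
     forall m, (0 < m)%N -> sg_set L (P h ^+ m)%g -> L `<=` M].
Proof.
move=> hi; have gi : inforder (P h) by apply/inforder_PSL2_proj.
have [e [n [n0 en max]]] : exists e n, [/\ (0 < n)%N, (e ^+ n)%g = P h &
    forall y b a, (0 < b)%N -> (0 < a)%N ->
    (y ^+ b = P h ^+ a \/ y ^+ b = P h ^- a)%g -> powers e y].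
  apply: maximal_root => //.
  - move=> x' n m n0 m0; have [x ->] := PSL2_proj_surj x' => e.
    have := PSL2_proj_roots_commute hi n0 m0 e.
    by rewrite /commute -!PSL2_projM => ->.
  - move=> x' y'; have [x ->] := PSL2_proj_surj x'; have [y ->] := PSL2_proj_surj y'.
    move=> /(PSL2_proj_commute hi) xh /(PSL2_proj_commute hi) yh.
    by rewrite /commute -!PSL2_projM (cent_abelian hi xh yh).
  - move=> z' d; have [z ->] := PSL2_proj_surj z' => /(PSL2_proj_commute hi) zh d0.
    rewrite -PSL2_proj1 => /PSL2_projX_eq[ep epE]; rewrite mat1 scale_scalar_mx mulr1 => e.
    by apply/PSL2_proj_eq1; exact: (commuting_torsion Kreal Karch hi zh d0 epE e).
  - have fin := finite_image P (commuting_roots_finite Karch hi).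
    move: fin; apply: sub_finite_set.
    move=> x' [n n0]; have [x ->] := PSL2_proj_surj x' => e.
    exists x => //; split.
      by apply: (PSL2_proj_roots_commute (m := 1) hi n0).
    by have [ep epE e'] := (PSL2_projX_eq _ _ _).1 e; exists n, ep.
have ei : inforder e.
  move=> m m0; apply/eqP => em; have := gi m m0.
  by rewrite -en -expgnAC em expg1n eqxx.
pose M := cyclic_subgroup e.
have ub (L : subgroup PG) : infinite_cyclic L -> forall m, (0 < m)%N ->
    sg_set L (P h ^+ m)%g -> L `<=` M.
  move=> /infinite_cyclicP[y Ly yi] m m0; rewrite Ly => -[r yr].
  have r0 : (0 < r)%N.
    rewrite lt0n; apply/eqP => r0; have := gi m m0.
    by case: yr => ->; rewrite r0 expg0 ?invg1 eqxx.
  apply: (@powers_sub _ M); apply: (max y r m) => //.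
  by case: yr => ->; [left|right; rewrite invgK].
have Mc : infinite_cyclic M by apply/infinite_cyclicP; exists e.
have Mh : sg_set M (P h) by exists n; left.
exists M; split=> //; split=> // L Lc ML.
by apply: (ub L Lc 1%N) => //; rewrite expg1; exact: ML.
Qed.

(** Conjugation by [P x] sends the generator [P c] of [M] to itself or to its
   inverse. So [x] sends [c] to itself or to its inverse, up to a sign, which
   would make the trace of [c] zero. *)
Lemma normalizer_lift (C : subgroup Gam) (M : subgroup PG) (x : Gam) :
  infinite_cyclic C -> P @` C = (M : set PG) ->
  conj_set M (P x) = M -> conj_set C x = C.
Proof.
move=> /infinite_cyclicP[c Cc ci] CM Mx.
have Me : (M : set PG) = powers (P c).
  rewrite -CM Cc; apply/seteqP; split.
    by move=> _ [_ [n [->|->]] <-]; exists n; rewrite ?PSL2_projV PSL2_projX; [left|right].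
  move=> _ [n [->|->]]; first by exists (c ^+ n)%g; [exists n; left|rewrite PSL2_projX].
  by exists (c ^- n)%g; [exists n; right|rewrite PSL2_projV PSL2_projX].
have Pci : inforder (P c) by apply/inforder_PSL2_proj.
have e : powers (P c ^ P x)%g = powers (P c).
  by rewrite -conj_powers -Me.
have cc : (P c ^ P x = P c \/ P c ^ P x = (P c)^-1)%g.
  apply: cyclic_generators => //; first by rewrite -e; exact: powers_self.
  by rewrite e; exact: powers_self.
have key (y : Gam) : \tr (mat y) = \tr (mat c) -> P (c ^ x)%g = P y -> (c ^ x)%g = y.
  move=> ty /PSL2_proj_eq[/mat_inj -> //|e']; exfalso.
  apply: (trace0_order (x := c)) => //.
  have /eqP := congr1 mxtrace e'; rewrite ty raddfN /= tr_conj.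
  rewrite -subr_eq0 opprK -mulr2n -mulr_natr mulf_eq0 (negbTE (natrS_neq0 k 1)) orbF.
  by move/eqP.
rewrite Cc conj_powers.
case: cc => cc; first by rewrite (key c) // PSL2_projJ.
by rewrite (key c^-1%g) ?powersI // ?tr_matV // PSL2_projJ cc PSL2_projV.
Qed.

End MaximalCyclic.

Local Close Scope ring_scope.

Local Open Scope group_scope.

(** * Infinite virtually cyclic subgroups of SL2 *)

Definition weyl_image (G : groupType) (D : subgroup G) (H : set G) (g : G) : set (weyl D) :=
  [set weyl_proj D n | n in
    [set n : sg_type (normalizer D) | exists2 h, H h & val n = h ^ g]].

Arguments weyl_image {G} D H g.

Section VirtuallyCyclic.
Variables (k : fieldExtType rat) (K : numClosedFieldType).
Hypothesis Kreal : forall (s : {rmorphism k -> K}) x, s x \is Num.real.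
Hypothesis Karch : forall z : K, exists n : nat, (`|z| <= n%:R)%R.

Local Notation O := (ring_of_integers k).
Local Notation Gam := (SL2 O).
Local Notation PG := (PSL2 O).
Local Notation P := (@PSL2_proj O : Gam -> PG).

Variable I : set (subgroup PG).
Hypothesis I_repr : conj_representatives (@maximal_infinite_cyclic PG) I.
Variable C : set_type I -> subgroup Gam.
Hypothesis C_inf : forall L, infinite_cyclic (C L).
Hypothesis C_proj : forall L : set_type I, P @` C L = (val L : set PG).

Lemma powers_square (G : groupType) (x z : G) : powers x z ->
  exists b : bool, powers (x ^+ 2) (x ^- b * z).
Proof.
have h (m : nat) : x ^+ m = x ^+ odd m * (x ^+ 2) ^+ m./2.
  by rewrite -expgnA -expgnDr mul2n odd_double_half.
move=> [m [->|->]]; exists (odd m).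
  by rewrite [x ^+ m]h mulKg; exists m./2; left.
exists (uphalf m); right; rewrite -invgM; congr (_^-1).
rewrite -expgnDr -expgnA mul2n; congr (x ^+ _).
by rewrite -[in LHS](odd_double_half m) uphalf_half doubleD; case: (odd m) => /=; lia.
Qed.

(** Let [h] in [H] have infinite order, and let [M] be the maximal infinite cyclic
   subgroup over [P h]. For [x] in [H], some power of [h ^ x] is a power of [h],
   so [P x] normalizes [M] by maximality; and [M] is conjugate to exactly one
   element of [I]. This gives [L0] and [g0]. Conversely, if the image of [H ^ g]
   in [W(C L)] is finite, then [C L] contains a power of [h ^ g], so the maximal
   subgroup [L], conjugated back, is [M]. *)
Lemma infinite_block (H : subgroup Gam) :
  virtually_cyclic_subgroups H -> infinite_set H -> exists (L0 : set_type I) (g0 : Gam),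
  [/\ forall h, sg_set H h -> normalizer_set (C L0) (h ^ g0),
      finite_set (weyl_image (C L0) H g0) &
      forall (L : set_type I) (g : Gam),
        (forall h, sg_set H h -> normalizer_set (C L) (h ^ g)) ->
        finite_set (weyl_image (C L) H g) ->
        L = L0 /\ normalizer_set (C L) (g^-1 * g0)].
Proof.
move=> [C0 [[h C0h] C0H]] Hinf; have [C0sub C0fin] := C0H.
have Hh : sg_set H h by apply: C0sub; rewrite C0h; exact: powers_self.
have hi : inforder h.
  apply/powers_infinite; rewrite -C0h => fC0; apply: Hinf.
  have := finite_image2 (fun (q : lcosets C0) c => repr q * c) C0fin fC0.
  apply: sub_finite_set => x Hx.
  exists (coset_of C0 x); first by exists x.
  exists ((repr (coset_of C0 x))^-1 * x); last by rewrite mulVKg.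
  by have := sgV (repr_coset_of C0 x); rewrite invgM invgK.
have [M [Mmax Mh Mub]] := maximal_cyclic_over Kreal Karch hi.
have Mic : infinite_cyclic M by case: Mmax.
have conjM (x : Gam) : sg_set H x -> conj_set M (P x) `<=` M.
  move=> Hx; have Hhx : sg_set H (h ^ x) by apply: (sgM (sgV Hx)); exact: sgM.
  have [n n0] := finite_index_power C0H Hhx; rewrite C0h => -[m hm].
  have m0 : (0 < m)%N.
    rewrite lt0n; apply/eqP => m0; have := @inforderJ _ h x hi n n0.
    by case: hm => ->; rewrite m0 expg0 ?invg1 eqxx.
  apply: (Mub (conj_subgroup M (P x)) (infinite_cyclicJ _ Mic) m m0).
  have Mhx : sg_set (conj_subgroup M (P x)) (P (h ^ x) ^+ n).
    by apply: subgX; exists (P h) => //; rewrite PSL2_projJ.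
  case: hm => hm; first by rewrite -PSL2_projX -hm PSL2_projX.
  by rewrite -[P h ^+ m]invgK; apply: sgV; rewrite -PSL2_projX -PSL2_projV -hm PSL2_projX.
have conjME (x : Gam) : sg_set H x -> conj_set M (P x) = M.
  move=> Hx; apply/seteqP; split; first exact: conjM.
  have := conjM _ (sgV Hx); rewrite PSL2_projV => /(conj_set_sub (g := P x)).
  by rewrite conj_setKV.
have [L1 [[IL1 [ga' MLE]] Luniq]] := I_repr.2 M Mmax.
have [ga gaE] := PSL2_proj_surj ga'; rewrite {}gaE in MLE.
pose L0 : set_type I := SigSub (mem_set IL1).
have L0E : P @` C L0 = (L1 : set PG) by rewrite C_proj.
pose g0 := ga^-1.
have norm0 (x : Gam) : sg_set H x -> normalizer_set (C L0) (x ^ g0).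
  move=> Hx; apply: (normalizer_lift (C_inf L0) L0E).
  rewrite /g0 conjgE invgK !PSL2_projM PSL2_projV !conj_setM -MLE conjME // MLE.
  by rewrite conj_setK.
exists L0, g0; split=> //.
(* [h ^ g0] lies in [C L0] up to sign only, hence the square *)
- have h2C : sg_set (C L0) ((h ^+ 2) ^ g0).
    have : sg_set L1 (P (h ^ g0)).
      have : (M : set PG) (P h) by [].
      rewrite MLE => -[y Ly ye]; rewrite /g0 PSL2_projJ PSL2_projV -ye.
      by rewrite -conjgM mulgV conjg1.
    rewrite -L0E => -[c Cc /PSL2_proj_eq e].
    have -> : (h ^+ 2) ^ g0 = c ^+ 2.
      rewrite conjXg; apply: mat_inj; rewrite !matX !pow2S /= !mulmx1.
      by case: e => ->; rewrite ?mulmxN ?mulNmx ?opprK.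
    exact: subgX.
  pose N := normalizer (C L0).
  pose lift (y : Gam) : sg_type N :=
    if pselect (sg_set N y) is left hy then exist (fun x => x \in (N : set Gam)) y (mem_set hy)
    else 1.
  have liftE y : sg_set N y -> val (lift y) = y by rewrite /lift; case: pselect.
  pose Fn (p : lcosets C0 * bool) : weyl (C L0) :=
    weyl_proj (C L0) (lift ((repr p.1 * h ^+ p.2) ^ g0)).
  have fin : finite_set (Fn @` ([set coset_of C0 x | x in (H : set Gam)] `*` [set: bool])).
    by apply: finite_image; apply: finite_setX => //; exact: finite_finset.
  move: fin; apply: sub_finite_set => _ [n [x Hx nx] <-].
  have := sgV (repr_coset_of C0 x); rewrite invgM invgK C0h => /powers_square[b].
  set q := coset_of C0 x => hb.
  exists (q, b); first by split=> //; exists x.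
  have Hq : sg_set H (repr q).
    have hr : sg_set H (x^-1 * repr q) by apply: C0sub; exact: repr_coset_of.
    by have := sgM Hx hr; rewrite mulVKg.
  have Hqb : sg_set H (repr q * h ^+ b) by apply: sgM => //; exact: subgX.
  apply/quot_projP.
  change (sg_set (C L0) ((val (lift ((repr q * h ^+ b) ^ g0)))^-1 * val n)).
  rewrite nx liftE; last exact: norm0.
  rewrite -conjVg -conjMg invgM -mulgA.
  have : powers (h ^+ 2 ) (h ^- b * ((repr q)^-1 * x)) by [].
  move: (h ^- b * _) => z [m [->|->]].
    by rewrite conjXg; exact: subgX.
  by rewrite conjVg conjXg; apply: sgV; exact: subgX.
- move=> L g normL fin.
  pose N := normalizer (C L).
  have Ng y : sg_set H y -> sg_set N (y ^ g) by exact: normL.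
  pose nh : sg_type N := exist (fun x => x \in (N : set Gam)) (h ^ g) (mem_set (Ng h Hh)).
  have [|i [j [ij e]]] := @infinite_pigeonhole (weyl (C L)) _
    (fun n : nat => weyl_proj (C L) (nh ^+ n)) fin.
    move=> n; exists (nh ^+ n) => //; exists (h ^+ n); first exact: subgX.
    rewrite conjXg; elim: n => [//|n IH]; by rewrite !expgS -IH.
  have vX n : val (nh ^+ n) = (h ^ g) ^+ n.
    by elim: n => [//|n IH]; rewrite !expgS -IH.
  have hC : sg_set (C L) ((h ^ g) ^+ (j - i)).
    move/quot_projP: e.
    change (sg_set (C L) ((val (nh ^+ i))^-1 * val (nh ^+ j)) -> sg_set (C L) ((h ^ g) ^+ (j - i))).
    rewrite !vX.
    rewrite (expgnFr _ (ltnW ij)).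
    suff -> : (h ^ g) ^- i * (h ^ g) ^+ j = (h ^ g) ^+ j / (h ^ g) ^+ i by [].
    by apply: commute_sym; apply: commuteV; apply: commuteX2.
  have ji : (0 < j - i)%N by rewrite subn_gt0.
  have Lmax : maximal_infinite_cyclic (val L).
    by apply: I_repr.1; exact: (set_mem (valP L)).
  pose M' := conj_subgroup (val L) (P g)^-1.
  have M'max : maximal_infinite_cyclic M' by exact: maximal_infinite_cyclicJ.
  have M'M : (M' : set PG) `<=` M.
    apply: (Mub M' _ (j - i)%N ji); first by case: M'max.
    exists (P h ^+ (j - i) ^ P g); last by rewrite -conjgM mulgV conjg1.
    rewrite conjXg -PSL2_projJ -PSL2_projX -C_proj; by exists ((h ^ g) ^+ (j - i)).
  have MM' : (M : set PG) `<=` M' by case: M'max => _; apply.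
  have ME : (M : set PG) = conj_set (val L) (P g)^-1 by apply/seteqP; split.
  have LL0 : L = L0.
    apply: val_inj; apply/esym/Luniq; split; first exact: (set_mem (valP L)).
    by exists (P g)^-1.
  split=> //; apply: (normalizer_lift (C_inf L) (C_proj L)).
  rewrite PSL2_projM !PSL2_projV conj_setM -ME MLE.
  by rewrite LL0 conj_setK.
Qed.

End VirtuallyCyclic.

(** * Isotropy of induced spaces *)

Definition conj_points (G : groupType) (N H : subgroup G) (g : G) : set (sg_type N) :=
  [set n | exists2 h, sg_set H h & val n = h ^ g].

Arguments conj_points {G} N H g.

Program Definition conj_point_subgroup (G : groupType) (N H : subgroup G) (g : G) :
    subgroup (sg_type N) := @Subgroup _ (conj_points N H g) _ _ _.
Next Obligation. by move=> G N H g; exists 1; [exact: sg1|rewrite conj1g]. Qed.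
Next Obligation.
move=> G N H g x y [h Hh hx] [h' Hh' hy]; exists (h * h'); first exact: sgM.
by rewrite conjMg -hx -hy.
Qed.
Next Obligation.
by move=> G N H g x [h Hh hx]; exists h^-1; [exact: sgV|rewrite conjVg -hx].
Qed.

Program Definition image_subgroup (N W : groupType) (phi : UMagmaMorphism.type N W)
    (K : subgroup N) : subgroup W := @Subgroup _ (phi @` K) _ _ _.
Next Obligation. by move=> N W phi K; exists 1; [exact: sg1|rewrite gmulf1]. Qed.
Next Obligation.
by move=> N W phi K _ _ [x Kx <-] [y Ky <-]; exists (x * y); [exact: sgM|rewrite gmulfM].
Qed.
Next Obligation.
by move=> N W phi K _ [x Kx <-]; exists x^-1; [exact: sgV|rewrite gmulfV].
Qed.

Section InducedIsotropy.
Variables (G : groupType) (I : choiceType) (N : I -> subgroup G).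
Variable Y : forall i, gspace (sg_type (N i)).
Let CI : gspace G := coprod_gspace (fun i => ind_gspace (Y i)).
Local Notation pt i g := (@ind_pt G I N Y i g).

Lemma gact_ind_pt i g y h : gact h (pt i g y) = pt i g y <->
  exists2 n : sg_type (N i), val n = h ^ g & gact n y = y.
Proof.
rewrite ind_pt_act; split=> [/ind_pt_eqP[n [e ny]]|[n e ny]].
  by exists n => //; rewrite /conjg e mulKg.
by apply/ind_pt_eqP; exists n; rewrite ny e /conjg mulVKg.
Qed.

(** An element [h] fixes the class of [(g, y)] when [h ^ g] lies in [N i] and
   fixes [y]. *)
Lemma fixed_ind_ptP (H : subgroup G) i g y :
  fixed_points CI H (pt i g y) <->
  (forall h, sg_set H h -> sg_set (N i) (h ^ g)) /\
  fixed_points (Y i) (conj_points (N i) H g) y.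
Proof.
split=> [fy|[nH fy] h Hh].
  split=> [h /fy/gact_ind_pt[n <- _]|n [h Hh e]]; first exact: set_mem (valP n).
  have /gact_ind_pt[m me my] := fy h Hh.
  by have -> : n = m by apply: val_inj; rewrite e me.
apply/gact_ind_pt; exists (sg_mk (nH _ Hh)) => //.
by apply: fy; exists h.
Qed.

Lemma block_fixedE (H : subgroup G) (l : block_index N) :
  (forall h, sg_set H h -> sg_set (N (projT1 l)) (h ^ rep_of l)) ->
  @block_fixed G I N Y H l =
    fixed_points (Y (projT1 l)) (conj_points (N (projT1 l)) H (rep_of l)).
Proof.
move=> nH; apply/seteqP; split=> y; first by move=> /fixed_ind_ptP[].
by move=> fy; apply/fixed_ind_ptP.
Qed.

Lemma fixed_block (H : subgroup G) (p : CI) : fixed_points CI H p ->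
  forall h, sg_set H h -> sg_set (N (projT1 (block p))) (h ^ rep_of (block p)).
Proof.
move=> fp; have [y e] := block_coord p; move: (fp); rewrite {1}e.
by move=> /fixed_ind_ptP[].
Qed.

Lemma finite_conj_points (H : subgroup G) (i : I) g : finite_set (H : set G) ->
  finite_set (conj_points (N i) H g).
Proof.
move=> fH; apply: (@sub_finite_set _ _ (val @^-1` ((fun h => h ^ g) @` (H : set G)))).
  by move=> n [h Hh e]; exists h.
by apply: finite_preimage; [move=> x y _ _ /val_inj|exact: finite_image].
Qed.

End InducedIsotropy.

Lemma fixed_res (N W : groupType) (phi : UMagmaMorphism.type N W) (X : gspace W)
    (K : set N) : fixed_points (res_gspace phi X) K = fixed_points X (phi @` K) :> set X.
Proof.
apply/seteqP; split=> x fx => [_ [n Kn <-]|n Kn]; first exact: fx.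
by apply: fx; exists n.
Qed.

Lemma coprod_ind_mapE (G : groupType) (I : choiceType) (N : I -> subgroup G)
    (Y Z : forall i, gspace (sg_type (N i))) (f : forall i, Y i -> Z i) i g y :
  (forall i, equivariant (f i)) ->
  coprod_map (fun i => ind_map (f i)) (@ind_pt G I N Y i g y) = ind_pt g (f i y).
Proof.
move=> ef; rewrite /coprod_map /ind_pt /=; congr existT.
apply/esym/ind_mkP; have [n [e e']] := ind_repr g y.
by exists n; split; [exact: e|rewrite -ef; congr (f i _); exact: e'].
Qed.

(** Off the range of [i] the map [u] is injective, and [v] is injective. *)
Lemma stabilizer_pushout (G : groupType) (A B C X : gspace G)
    (i : A -> B) (F : A -> C) (u : B -> X) (v : C -> X) :
  closed_pushout i F u v -> equivariant i -> equivariant u -> equivariant v ->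
  forall x, (exists b, stabilizer_set x = stabilizer_set b :> set G /\ u b = x) \/
            (exists c, stabilizer_set x = stabilizer_set c :> set G /\ v c = x).
Proof.
move=> po ei eu ev x.
have stv c : stabilizer_set (v c) = stabilizer_set c.
  apply/seteqP; split=> g; rewrite /stabilizer_set /= -ev; first by move=> /(cp_v_inj po).
  by move=> ->.
have [[b ->]|[c ->]] := cp_cover po x; last by right; exists c.
have [[a _ <-]|nb] := pselect (range i b).
  by rewrite (cp_comm po); right; exists (F a).
left; exists b; split=> //; apply/seteqP; split=> g; rewrite /stabilizer_set /= -eu.
  by move=> /(cp_quasi po)[//|[_ /nb]].
by move=> ->.
Qed.

Lemma virtually_cyclic_ext (G : groupType) (H K : subgroup G) :
  (H : set G) = K -> virtually_cyclic_subgroups H -> virtually_cyclic_subgroups K.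
Proof. by rewrite /virtually_cyclic_subgroups /= /finite_index => ->. Qed.

Lemma finite_virtually_cyclic (G : groupType) (H : subgroup G) :
  finite_set (H : set G) -> virtually_cyclic_subgroups H.
Proof.
move=> fH; exists (cyclic_subgroup 1); split; first by exists 1.
split; last exact: finite_image.
by move=> _ [n [->|->]]; rewrite expg1n ?invg1; exact: sg1.
Qed.

Lemma cyclicJ (G : groupType) (C : subgroup G) g : cyclic C -> cyclic (conj_subgroup C g).
Proof. by move=> [x e]; exists (x ^ g); rewrite /= e conj_powers. Qed.

Section WeylIsotropy.
Variables (G : groupType) (I : choiceType) (C : I -> subgroup G).
Variable Z : forall i, gspace (weyl (C i)).
Local Notation Y := (fun i => res_gspace (weyl_proj (C i)) (Z i)).
Let CI : gspace G := coprod_gspace (fun i => ind_gspace (Y i)).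
Local Notation pt i g := (@ind_pt G I (fun i => normalizer (C i)) Y i g).

Lemma weyl_proj_eq1 i (c : G) (Cc : sg_set (C i) c) (n : sg_type (normalizer (C i))) :
  val n = c -> weyl_proj (C i) n = 1.
Proof.
move=> e; apply/esym; transitivity (weyl_proj (C i) 1); first by rewrite gmulf1.
apply/esym/quot_projP.
change (sg_set (C i) ((val n)^-1 * 1)); rewrite mulg1 e; exact: sgV.
Qed.

Lemma subgroup_normalizer (D : subgroup G) (x : G) :
  sg_set D x -> sg_set (normalizer D) x.
Proof.
move=> Dx; apply/seteqP; split=> [_ [y Dy <-]|y Dy].
  by apply: (sgM (sgV Dx)); apply: sgM.
exists (y ^ x^-1); last by rewrite -conjgM mulVg conjg1.
by rewrite /conjg invgK; apply: sgM => //; apply: sgM => //; exact: sgV.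
Qed.

(** The stabilizer is conjugate to the preimage in [N(C i)] of the finite
   stabilizer of [y] in [W(C i)], in which [C i] has finite index. *)
Lemma weyl_stabilizer i g (y : Z i) : cyclic (C i) ->
  finite_set (stabilizer y : set _) ->
  virtually_cyclic_subgroups (stabilizer (pt i g y : CI)).
Proof.
move=> cyc fin; exists (conj_subgroup (C i) g^-1); split; first exact: cyclicJ.
split=> [_ [c Cc <-]|].
  apply/gact_ind_pt.
  exists (sg_mk (subgroup_normalizer Cc)); first by rewrite -conjgM mulVg conjg1.
  change (gact (weyl_proj (C i) (sg_mk (subgroup_normalizer Cc))) y = y).
  by rewrite (weyl_proj_eq1 Cc) ?gact1.
pose Q (q : weyl (C i)) :=
  coset_of (conj_subgroup (C i) g^-1) (val (repr q : sg_type (normalizer (C i))) ^ g^-1).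
apply: (sub_finite_set _ (finite_image Q fin)) => _ [x /gact_ind_pt[n e ny] <-].
exists (weyl_proj (C i) n); first exact: ny.
apply/esym/coset_ofP; set r := repr _.
have hr : sg_set (C i) ((val n)^-1 * val r).
  exact: (repr_coset_of (sub_normalizer (C i)) n).
exists ((val n)^-1 * val r) => //.
by rewrite conjMg conjVg e -conjgM mulgV conjg1.
Qed.

Lemma weyl_imageM i (H : subgroup G) (g h : G) : sg_set (normalizer (C i)) h ->
  finite_set (weyl_image (C i) H g) -> finite_set (weyl_image (C i) H (g * h)).
Proof.
move=> Nh fin; pose m : sg_type (normalizer (C i)) := sg_mk Nh.
apply: (sub_finite_set _ (finite_image (fun q => q ^ weyl_proj (C i) m) fin)).
move=> _ [n [x Hx e] <-]; exists (weyl_proj (C i) (n ^ m^-1)).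
  exists (n ^ m^-1) => //; exists x => //.
  change ((val n) ^ (h^-1) = x ^ g).
  by rewrite e conjgM -conjgM mulgV conjg1.
rewrite /conjg !gmulfM !gmulfV invgK.
by rewrite !mulgA mulVg mul1g -mulgA mulVg mulg1.
Qed.

Lemma weyl_fixed_finite (H : subgroup G) i g (y : Z i) :
  finite_set (stabilizer y : set _) -> fixed_points CI H (pt i g y) ->
  finite_set (weyl_image (C i) H g).
Proof.
move=> fin /fixed_ind_ptP[_]; rewrite fixed_res => fy.
by apply: sub_finite_set fin => q /fy.
Qed.

End WeylIsotropy.

(** * The pushout as a classifying space *)

Section NullHomotopy.
Variable R : realType.

Lemma block_contraction1 (T : topologicalType) (L : choiceType)
    (lam : T -> discrete_topology L) (base : L -> T) (k : T * R -> T) (l0 : L) :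
  block_contraction lam base k -> (forall l, l = l0) -> null_homotopic R T.
Proof.
move=> bc L1; exists (base l0), k; split; [exact: bc_cont bc|exact: bc_k0 bc|move=> x].
by rewrite (bc_k1 bc) (L1 (lam x)).
Qed.

(** If [B] is empty, [v] is a continuous bijection that detects closed sets. *)
Lemma transport_null_homotopic (B C X : topologicalType) (u : B -> X) (v : C -> X) :
  (forall W : set X, closed (u @^-1` W) -> closed (v @^-1` W) -> closed W) ->
  continuous u -> continuous v ->
  (forall x : X, (exists b : B, x = u b) \/ (exists c : C, x = v c)) ->
  injective v -> (B -> False) -> null_homotopic R C -> null_homotopic R X.
Proof.
move=> det cu cv cov vinj B0 [c0 [h [ch h0 h1]]].
have ex x : exists c, x = v c by by case: (cov x) => [[b _]|//]; case: (B0 b).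
pose w x := projT1 (cid (ex x)).
have wK x : v (w x) = x by rewrite /w; case: cid.
have vK c : w (v c) = c by apply: vinj; rewrite wK.
exists (v c0), (fun p => v (h (w p.1, p.2))); split=> [|x|x].
- apply: (continuous_of_detection2 det cu cv cov); first by move=> -[b t]; case: (B0 b).
  have -> : (fun p : C * R => v (h (w (v p.1), p.2))) = (fun p => v (h p)).
    by apply/funext => -[c t]; rewrite /= vK.
  exact: (comp_continuous ch cv).
- by rewrite h0 wK.
- by rewrite h1.
Qed.
End NullHomotopy.

Section Pushout.
Variables (R : realType) (Gam : groupType) (I : choiceType).
Variable C : I -> subgroup Gam.
Hypothesis C_cyclic : forall L, cyclic (C L).
Hypothesis C_block : forall H : subgroup Gam,
  virtually_cyclic_subgroups H -> infinite_set H -> exists (L0 : I) (g0 : Gam),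
  [/\ forall h, sg_set H h -> normalizer_set (C L0) (h ^ g0),
      finite_set (weyl_image (C L0) H g0) &
      forall (L : I) (g : Gam),
        (forall h, sg_set H h -> normalizer_set (C L) (h ^ g)) ->
        finite_set (weyl_image (C L) H g) ->
        L = L0 /\ normalizer_set (C L) (g^-1 * g0)].
Variable EN : forall L : I, gcw R (sg_type (normalizer (C L))).
Hypothesis EN_model : forall L, classifying_space R (@finite_subgroups _) (EN L).
Variable EW : forall L : I, gcw R (weyl (C L)).
Hypothesis EW_model : forall L, classifying_space R (@finite_subgroups _) (EW L).
Variable EGamma : gcw R Gam.
Hypothesis EGamma_model : classifying_space R (@finite_subgroups _) EGamma.
Local Notation resEW := (fun L : I => res_gspace (weyl_proj (C L)) (EW L)).
Variable f : forall L : I, EN L -> resEW L.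
Arguments f : clear implicits.
Hypothesis f_gmap : forall L : I, gmap (f L).
Local Notation coprodEN := (coprod_gspace (fun L : I => ind_gspace (EN L))).
Local Notation coprodEW := (coprod_gspace (fun L : I => ind_gspace (resEW L))).
Local Notation skEN := (fun n => coprod_gsubset
     (fun L : I => ind_gsubset (skel (EN L) n))).
Local Notation skEW := (fun n => coprod_gsubset
     (fun L : I =>
        ind_gsubset (res_gsubset (weyl_proj (C L)) (skel (EW L) n)))).
Local Notation F := (coprod_map (fun L : I => ind_map (f L)) :
        coprodEN -> coprodEW).
Variable i : coprodEN -> EGamma.
Hypothesis i_cellular : cellular skEN (skel EGamma) i.
Hypothesis F_cellular : cellular skEN skEW F.
Hypothesis one_inclusion : gcw_inclusion skEN (skel EGamma) i \/
                   gcw_inclusion skEN skEW F.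
Variables (X : gspace Gam) (u : EGamma -> X) (v : coprodEW -> X).
Hypothesis X_pushout : gpushout i F u v.

Lemma cellular_EN : exists ctr chi,
  @cellular_structure R Gam coprodEN (fun n => gs_set (skEN n)) ctr chi.
Proof.
have h L := cellular_of_filtration (gcwP (EN L)).
pose ctr L := projT1 (cid (h L)).
pose chi L := projT1 (cid (projT2 (cid (h L)))).
exists (ind_ctr ctr), (ind_chi chi).
apply: (@ind_cellular _ _ _ _ _ (fun L => skel (EN L)) ctr chi) => L.
exact: projT2 (cid (projT2 (cid (h L)))).
Qed.

Lemma cellular_EW : exists ctr chi,
  @cellular_structure R Gam coprodEW (fun n => gs_set (skEW n)) ctr chi.
Proof.
have h L := cellular_of_filtration (gcwP (EW L)).
pose ctr L : nat -> set (resEW L) := projT1 (cid (h L)).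
pose chi L : forall n, resEW L -> 'rV_n -> resEW L := projT1 (cid (projT2 (cid (h L)))).
exists (ind_ctr ctr), (ind_chi chi).
apply: (@ind_cellular _ _ _ _ _
  (fun L n => res_gsubset (weyl_proj (C L)) (skel (EW L) n)) ctr chi) => L.
apply: (@res_cellular _ _ _ (weyl_proj (C L)) (EW L) (skel (EW L)) (ctr L) (chi L)).
exact: projT2 (cid (projT2 (cid (h L)))).
Qed.

Lemma pushout_stabilizer x : virtually_cyclic_subgroups (stabilizer (x : X)).
Proof.
have [[[_ ei] [_ eF]] [[_ eu] [_ ev]] _ _] := X_pushout.
have stB (b : EGamma) : virtually_cyclic_subgroups (stabilizer b).
  by apply: finite_virtually_cyclic; have [_ fin _] := EGamma_model; exact: fin.
have stC (c : coprodEW) : virtually_cyclic_subgroups (stabilizer c).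
  have [L [g [y ->]]] := ind_ptP c; apply: weyl_stabilizer => //.
  by have [_ fin _] := EW_model L; exact: fin.
have h : (exists b : EGamma, stabilizer_set x = stabilizer_set b /\ u b = x) \/
         (exists c : coprodEW, stabilizer_set x = stabilizer_set c /\ v c = x).
  case: one_inclusion => inc.
    exact: (stabilizer_pushout (closed_pushout_of_gpushout X_pushout
      (gcw_incl_inj inc) (gcw_incl_closed inc)) ei eu ev).
  apply/or_comm; exact: (stabilizer_pushout (closed_pushout_of_gpushout
    (gpushout_sym X_pushout) (gcw_incl_inj inc) (gcw_incl_closed inc)) eF ev eu).
case: h => [[b [e _]]|[c [e _]]].
  exact: (@virtually_cyclic_ext _ (stabilizer b) (stabilizer x) (esym e) (stB b)).
exact: (@virtually_cyclic_ext _ (stabilizer c) (stabilizer x) (esym e) (stC c)).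
Qed.

Lemma pushout_filtration : exists sk : nat -> gsubset X, gcw_filtration R sk.
Proof.
have [[[_ ei] [_ eF]] [[_ eu] [_ ev]] _ _] := X_pushout.
have [ctrB [chiB csB]] := cellular_of_filtration (gcwP EGamma).
have [ctrC [chiC csC]] := cellular_EW.
case: one_inclusion => inc.
  have po := closed_pushout_of_gpushout X_pushout (gcw_incl_inj inc) (gcw_incl_closed inc).
  have sat := saturated_cells csB (gcw_incl_cell inc).
  have cs := pushout_cellular po ei eu ev csB csC (gcw_incl_skel inc) F_cellular sat.
  by exists (cs_gsubset cs); exact: filtration_of_cellular.
have po := closed_pushout_of_gpushout (gpushout_sym X_pushout)
  (gcw_incl_inj inc) (gcw_incl_closed inc).
have sat := saturated_cells csC (gcw_incl_cell inc).
have cs := pushout_cellular po eF ev eu csC csB (gcw_incl_skel inc) i_cellular sat.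
by exists (cs_gsubset cs); exact: filtration_of_cellular.
Qed.

Lemma block_F a : block (F a) = block a.
Proof.
have [L [g [y ->]]] := ind_ptP a.
rewrite coprod_ind_mapE ?blockE // => L'; exact: (f_gmap L').2.
Qed.

Lemma EN_fixed_contractible (H : subgroup Gam) (L : I) g : finite_set (H : set Gam) ->
  contractible R (set_type (fixed_points (EN L) (conj_points (normalizer (C L)) H g))).
Proof.
move=> fH; have [_ _ ctr] := EN_model L.
apply: (ctr (conj_point_subgroup (normalizer (C L)) H g)).
exact: (@finite_conj_points _ _ (fun L => normalizer (C L))).
Qed.

Lemma EW_fixed_contractible (H : subgroup Gam) (L : I) g :
  finite_set (weyl_image (C L) H g) ->
  contractible R (set_type (fixed_points (resEW L) (conj_points (normalizer (C L)) H g))).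
Proof.
move=> fH; have [_ _ ctr] := EW_model L; rewrite fixed_res.
exact: (ctr (image_subgroup (weyl_proj (C L))
  (conj_point_subgroup (normalizer (C L)) H g))).
Qed.

(** The blocks with fixed points are the same for the two spaces on the left, and
   all are contractible on both sides. *)
Lemma finite_fixed_contractible (H : subgroup Gam) : finite_set (H : set Gam) ->
  contractible R (set_type (fixed_points X H)).
Proof.
move=> fH; have [[[ci ei] [cF eF]] [[cu eu] [cv ev]] comm _] := X_pushout.
have [ctrA [chiA csA]] := cellular_EN.
have [ctrB [chiB csB]] := cellular_of_filtration (gcwP EGamma).
have [ctrC [chiC csC]] := cellular_EW.
have clA : closed (fixed_points coprodEN H) := @closed_fixed_points _ _ _ _ _ _ csA (H : set Gam).
have clB : closed (fixed_points EGamma H) := @closed_fixed_points _ _ _ _ _ _ csB (H : set Gam).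
have clC : closed (fixed_points coprodEW H) := @closed_fixed_points _ _ _ _ _ _ csC (H : set Gam).
pose LL : set (block_index (fun L => normalizer (C L))) :=
  [set l | forall h, sg_set H h -> sg_set (normalizer (C (projT1 l))) (h ^ rep_of l)].
have [|l Ll|lamA [bA [kA [bcA lamAE]]]] := ind_block_contraction (R := R) clA (LL := LL).
- by move=> p fp; exact: fixed_block fp.
- by rewrite block_fixedE //; exact: EN_fixed_contractible.
have [|l Ll|lamC [bC [kC [bcC lamCE]]]] := ind_block_contraction (R := R) clC (LL := LL).
- by move=> p fp; exact: fixed_block fp.
- rewrite block_fixedE //; apply: EW_fixed_contractible.
  apply: finite_image; exact: (@finite_conj_points _ _ (fun L => normalizer (C L))).
have [j cyl] : exists j, cylinder_section (R := R) (fix_map (H := H) ei)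
    (fix_map (H := H) eF) (fix_map (H := H) eu) (fix_map (H := H) ev) j.
  case: one_inclusion => inc.
    apply: (fixed_cylinder _ _ _ _ _ _ _ csB) => //.
      exact: (closed_pushout_of_gpushout X_pushout (gcw_incl_inj inc) (gcw_incl_closed inc)).
    exact: (saturated_cells csB (gcw_incl_cell inc)).
  apply: cylinder_flip; last first.
    apply: (fixed_cylinder _ _ _ _ _ _ _ csC) => //.
      exact: closed_pushout_of_gpushout (gpushout_sym X_pushout)
        (gcw_incl_inj inc) (gcw_incl_closed inc).
    exact: (saturated_cells csC (gcw_incl_cell inc)).
  by move=> a; apply: val_inj => /=; exact: (congr1 (fun q => q (val a)) comm).
apply/contractibleP.
apply: (cylinder_contractible cyl _ _ _ _ _ bcA bcC).
- exact: fix_map_continuous.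
- exact: fix_map_continuous.
- exact: fix_map_continuous.
- exact: fix_map_continuous.
- by move=> a; apply: val_inj => /=; exact: (congr1 (fun q => q (val a)) comm).
- by move=> a; apply: val_inj; rewrite lamAE lamCE; exact: block_F.
- by apply/contractibleP; have [_ _ ctr] := EGamma_model; exact: ctr.
Qed.

(** [EGamma] has no fixed points, its isotropy being finite, so only the lower left
   corner contributes. A fixed point there makes the image of a conjugate of [H]
   in some [W(C L)] a subgroup of a finite isotropy group, which by [C_block]
   happens in a single block. *)
Lemma infinite_fixed_contractible (H : subgroup Gam) :
  virtually_cyclic_subgroups H -> infinite_set (H : set Gam) ->
  contractible R (set_type (fixed_points X H)).
Proof.
move=> vH iH; have [[[ci ei] [cF eF]] [[cu eu] [cv ev]] comm _] := X_pushout.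
have [L0 [g0 [nH wH uniqH]]] := C_block vH iH.
have [ctrB [chiB csB]] := cellular_of_filtration (gcwP EGamma).
have [ctrC [chiC csC]] := cellular_EW.
have clB : closed (fixed_points EGamma H) := @closed_fixed_points _ _ _ _ _ _ csB (H : set Gam).
have clC : closed (fixed_points coprodEW H) := @closed_fixed_points _ _ _ _ _ _ csC (H : set Gam).
have B0 : set_type (fixed_points EGamma H) -> False.
  move=> b; apply: iH; have [_ fin _] := EGamma_model.
  by apply: sub_finite_set (fin (val b)); exact: (set_mem (valP b)).
have A0 : set_type (fixed_points coprodEN H) -> False.
  by move=> a; exact: (B0 (fix_map ei a)).
pose l0 : block_index (fun L => normalizer (C L)) :=
  existT _ L0 (coset_of (normalizer (C L0)) g0).
have [n0 Nn0 l0E] : exists2 h, sg_set (normalizer (C L0)) h & rep_of l0 = g0 * h.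
  exists (g0^-1 * rep_of l0); last by rewrite mulVKg.
  exact: repr_coset_of.
have [p fp|l ->|lam [b [k [bc _]]]] := ind_block_contraction (R := R) clC (LL := [set l0]).
- have [L [g [y e]]] := ind_ptP p; rewrite e in fp *.
  rewrite blockE /=; have [nLH _] := (fixed_ind_ptP _ _ _).1 fp.
  have [LL0 Ng] : L = L0 /\ normalizer_set (C L) (g^-1 * g0).
    apply: uniqH => //; apply: weyl_fixed_finite fp.
    by have [_ fin _] := EW_model L; exact: fin.
  rewrite LL0 in Ng *; rewrite /l0; congr existT.
  exact/coset_ofP.
- rewrite block_fixedE /=; first apply: EW_fixed_contractible.
    by rewrite l0E; exact: weyl_imageM.
  move=> h Hh; rewrite l0E conjgM.
  have Ng : sg_set (normalizer (C L0)) (h ^ g0) by exact: nH.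
  exact: (sgM (sgV Nn0) (sgM Ng Nn0)).
apply/contractibleP.
have nC : null_homotopic R (set_type (fixed_points coprodEW H)).
  have l0s : l0 \in [set l0] by exact: mem_set.
  apply: (block_contraction1 (l0 := SigSub l0s) bc) => l.
  by apply: val_inj; rewrite (set_mem (valP l)).
have [inj det cov] : [/\ injective (fix_map (H := H) ev),
    forall W : set (set_type (fixed_points X H)), closed (fix_map (H := H) eu @^-1` W) ->
      closed (fix_map (H := H) ev @^-1` W) -> closed W &
    forall x, (exists b, x = fix_map (H := H) eu b) \/ (exists c, x = fix_map (H := H) ev c)].
  case: one_inclusion => inc.
    have po := closed_pushout_of_gpushout X_pushout (gcw_incl_inj inc) (gcw_incl_closed inc).
    have fpo := fixed_pushout po ei eF eu ev clB clC.
    split; [exact: cp_v_inj fpo|exact: cp_detect fpo|exact: cp_cover fpo].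
  have po := closed_pushout_of_gpushout (gpushout_sym X_pushout)
    (gcw_incl_inj inc) (gcw_incl_closed inc).
  have fpo := fixed_pushout po eF ei ev eu clC clB.
  split; last by move=> x; apply/or_comm; exact: (cp_cover fpo).
    by move=> c c' /(cp_quasi fpo)[//|[[a _ _] _]]; case: (A0 a).
  by move=> W cW cW'; exact: cp_detect fpo _ cW' cW.
apply: (transport_null_homotopic det _ _ cov inj B0 nC); exact: fix_map_continuous.
Qed.

Theorem pushout_classifying : classifying_space R (@virtually_cyclic_subgroups Gam) X.
Proof.
split; [exact: pushout_filtration|exact: pushout_stabilizer|move=> H vH].
have [fH|iH] := pselect (finite_set (H : set Gam)).
  exact: finite_fixed_contractible.
exact: infinite_fixed_contractible.
Qed.

End Pushout.

Local Close Scope group_scope.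

Theorem theorem4p16 (R : realType) (k : fieldExtType rat)
  (k_real : totally_real R k)
  (Gamma := SL2 (ring_of_integers k)) (G := PSL2 (ring_of_integers k))
  (p := @PSL2_proj (ring_of_integers k) : Gamma -> G)
  (I : set (subgroup G))
  (I_repr : conj_representatives (@maximal_infinite_cyclic G) I)
  (C : set_type I -> subgroup Gamma)
  (C_inf_cyclic : forall H : set_type I, infinite_cyclic (C H))
  (C_proj : forall H : set_type I, p @` C H = (val H : set G))
  (EN : forall H : set_type I, gcw R (sg_type (normalizer (C H))))
  (EN_model : forall H : set_type I,
     classifying_space R (@finite_subgroups _) (EN H))
  (EW : forall H : set_type I, gcw R (weyl (C H)))
  (EW_model : forall H : set_type I,
     classifying_space R (@finite_subgroups _) (EW H))
  (EGamma : gcw R Gamma)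
  (EGamma_model : classifying_space R (@finite_subgroups _) EGamma)
  (resEW := fun H : set_type I => res_gspace (weyl_proj (C H)) (EW H))
  (f : forall H : set_type I, EN H -> resEW H)
  (f_gmap : forall H : set_type I, gmap (f H))
  (coprodEN := coprod_gspace (fun H : set_type I => ind_gspace (EN H)))
  (coprodEW := coprod_gspace (fun H : set_type I => ind_gspace (resEW H)))
  (skEN := fun n => coprod_gsubset
     (fun H : set_type I => ind_gsubset (skel (EN H) n)))
  (skEW := fun n => coprod_gsubset
     (fun H : set_type I =>
        ind_gsubset (res_gsubset (weyl_proj (C H)) (skel (EW H) n))))
  (F := coprod_map (fun H : set_type I => ind_map (f H)) :
        coprodEN -> coprodEW)
  (i : coprodEN -> EGamma)
  (i_cellular : cellular skEN (skel EGamma) i)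
  (F_cellular : cellular skEN skEW F)
  (one_inclusion : gcw_inclusion skEN (skel EGamma) i \/
                   gcw_inclusion skEN skEW F)
  (X : gspace Gamma) (u : EGamma -> X) (v : coprodEW -> X)
  (X_pushout : gpushout i F u v) :
  classifying_space R (@virtually_cyclic_subgroups Gamma) X.

Proof.
have Kreal (s : {rmorphism k -> R[i]}) x : s x \is Num.real.
  by apply/complex_realP; have [r ->] := k_real s x; exists r.
have Karch (z : R[i]) : exists n : nat, (`|z| <= n%:R)%R.
  have /complex_realP[r ->] := normr_real z.
  exists (Num.bound `|r|); rewrite -(rmorph_nat (real_complex R)) lecR.
  exact: le_trans (ler_norm r) (ltW (archi_boundP (normr_ge0 r))).
apply: (pushout_classifying _ _ EN_model EW_model EGamma_model f_gmap i_cellular F_cellular one_inclusion X_pushout).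
  by move=> H; case: (C_inf_cyclic H).
exact: (infinite_block Kreal Karch I_repr C_inf_cyclic C_proj).
Qed.
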